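(* Let $\alpha_1,\alpha_2,\alpha_3>0$ with $\alpha_1+\alpha_2+\alpha_3=\pi$ and let $0<c<2$. Then the hexagonal circle pattern $Z^c$ with intersection angles $\alpha_1,\alpha_2,\alpha_3$ is an immersion.
   Context: For pairwise distinct $z_1,z_2,z_3,z_4\in\mathbb C$ let $q(z_1,z_2,z_3,z_4)=\frac{(z_1-z_2)(z_3-z_4)}{(z_2-z_3)(z_4-z_1)}$. Let $Q=\{(k,l,m)\in\mathbb Z^3: k\ge0,\ l\ge0,\ m\le0\}$. A map $z:Q\to\mathbb C$, $(k,l,m)\mapsto z_{k,l,m}$, is a solution of the system if (i) for all $(k,l,m)$ such that all arguments lie in $Q$: $q(z_{k,l,m},z_{k,l+1,m},z_{k-1,l+1,m},z_{k-1,l,m})=e^{-2i\alpha_1}$, $q(z_{k,l,m},z_{k,l,m-1},z_{k,l+1,m-1},z_{k,l+1,m})=e^{-2i\alpha_2}$, $q(z_{k,l,m},z_{k+1,l,m},z_{k+1,l,m-1},z_{k,l,m-1})=e^{-2i\alpha_3}$; and (ii) for all $(k,l,m)\in Q$: $$c\,z_{k,l,m}=2k\frac{(z_{k+1,l,m}-z_{k,l,m})(z_{k,l,m}-z_{k-1,l,m})}{z_{k+1,l,m}-z_{k-1,l,m}}+2l\frac{(z_{k,l+1,m}-z_{k,l,m})(z_{k,l,m}-z_{k,l-1,m})}{z_{k,l+1,m}-z_{k,l-1,m}}+2m\frac{(z_{k,l,m+1}-z_{k,l,m})(z_{k,l,m}-z_{k,l,m-1})}{z_{k,l,m+1}-z_{k,l,m-1}},$$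 where a term whose coefficient $2k$, $2l$ or $2m$ vanishes is omitted. (Such a solution has $z_{0,0,0}=0$ and is uniquely determined by $z_{1,0,0},z_{0,1,0},z_{0,0,-1}$.) Let $H=\{(k,l,m)\in\mathbb Z^3:|k+l+m|\le1\}$ and $Q_H=Q\cap H$. The hexagonal circle pattern $Z^c$ is the solution $z:Q\to\mathbb C$ of the system with initial data $z_{1,0,0}=1$, $z_{0,1,0}=e^{ic(\alpha_2+\alpha_3)}$, $z_{0,0,-1}=e^{ic\alpha_3}$, restricted to $Q_H$ (the points $z_{k,l,m}$ with $k+l+m=0$ are circle centers, those with $k+l+m=\pm1$ are intersection points of circles). An elementary quadrilateral of $Q_H$ is a quadruple $(p,p+e_i,p+e_i+e_j,p+e_j)$ with $p\in\mathbb Z^3$, $1\le i<j\le 3$, all four points in $Q_H$ ($e_1,e_2,e_3$ the standard basis); its image is the quadrilateral with vertices $z_p,z_{p+e_i},z_{p+e_i+e_j},z_{p+e_j}$. A map $z:Q_H\to\mathbb C$ is an immersion if the interiors of the images of any two adjacent (edge-sharing) elementary quadrilaterals are disjoint. *)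

(* Defs.v *)
From Stdlib Require Import Reals ZArith List.
From Coquelicot Require Import Coquelicot.
Import ListNotations.

Local Open Scope R_scope.

Definition expi (t : R) : C := (cos t, sin t).

Definition qcr (z1 z2 z3 z4 : C) : C :=
  Cdiv (Cmult (Cminus z1 z2) (Cminus z3 z4)) (Cmult (Cminus z2 z3) (Cminus z4 z1)).

Definition distinct4 (a b c d : C) : Prop :=
  a <> b /\ a <> c /\ a <> d /\ b <> c /\ b <> d /\ c <> d.

(** q is only defined for pairwise distinct points *)
Definition q_eq (a b c d w : C) : Prop := distinct4 a b c d /\ qcr a b c d = w.

Definition inQ (k l m : Z) : Prop := (0 <= k)%Z /\ (0 <= l)%Z /\ (m <= 0)%Z.

Definition cterm (n : Z) (zp z0 zm : C) : C :=
  if Z.eqb n 0 then RtoC 0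
  else Cmult (RtoC (2 * IZR n))
         (Cdiv (Cmult (Cminus zp z0) (Cminus z0 zm)) (Cminus zp zm)).

(** z : Q -> C (values outside Q are irrelevant) is a solution of the system *)
Definition is_solution (a1 a2 a3 c : R) (z : Z -> Z -> Z -> C) : Prop :=
  (forall k l m, inQ k l m -> inQ k (l+ 1)%Z m -> inQ (k- 1)%Z (l+ 1)%Z m -> inQ (k- 1)%Z l m ->
     q_eq (z k l m) (z k (l+ 1)%Z m) (z (k- 1)%Z (l+ 1)%Z m) (z (k- 1)%Z l m) (expi (-2 * a1))) /\
  (forall k l m, inQ k l m -> inQ k l (m- 1)%Z -> inQ k (l+ 1)%Z (m- 1)%Z -> inQ k (l+ 1)%Z m ->
     q_eq (z k l m) (z k l (m- 1)%Z) (z k (l+ 1)%Z (m- 1)%Z) (z k (l+ 1)%Z m) (expi (-2 * a2))) /\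
  (forall k l m, inQ k l m -> inQ (k+ 1)%Z l m -> inQ (k+ 1)%Z l (m- 1)%Z -> inQ k l (m- 1)%Z ->
     q_eq (z k l m) (z (k+ 1)%Z l m) (z (k+ 1)%Z l (m- 1)%Z) (z k l (m- 1)%Z) (expi (-2 * a3))) /\
  (forall k l m, inQ k l m ->
     Cmult (RtoC c) (z k l m) =
     Cplus (Cplus (cterm k (z (k+ 1)%Z l m) (z k l m) (z (k- 1)%Z l m))
                  (cterm l (z k (l+ 1)%Z m) (z k l m) (z k (l- 1)%Z m)))
           (cterm m (z k l (m+ 1)%Z) (z k l m) (z k l (m- 1)%Z))).

Definition pt := (Z * Z * Z)%type.

Definition inQH (v : pt) : Prop :=
  let '(k, l, m) := v in inQ k l m /\ (-1 <= k + l + m <= 1)%Z.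

Definition add_e (p : pt) (i : nat) : pt :=
  let '(k, l, m) := p in
  match i with
  | 1%nat => ((k + 1)%Z, l, m)
  | 2%nat => (k, (l + 1)%Z, m)
  | _ => (k, l, (m + 1)%Z)
  end.

Definition quad_vertices (p : pt) (i j : nat) : list pt :=
  [p; add_e p i; add_e (add_e p i) j; add_e p j].

Definition elem_quad (p : pt) (i j : nat) : Prop :=
  (1 <= i)%nat /\ (i < j)%nat /\ (j <= 3)%nat /\ List.Forall inQH (quad_vertices p i j).

Definition quad_edges {A : Type} (vs : list A) : list (A * A) :=
  match vs with
  | [a; b; c; d] => [(a, b); (b, c); (c, d); (d, a)]
  | _ => []
  end.

Definition adjacent (p : pt) (i j : nat) (p' : pt) (i' j' : nat) : Prop :=
  elem_quad p i j /\ elem_quad p' i' j' /\ (p, i, j) <> (p', i', j') /\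
  exists a b, In (a, b) (quad_edges (quad_vertices p i j)) /\
    (In (a, b) (quad_edges (quad_vertices p' i' j')) \/
     In (b, a) (quad_edges (quad_vertices p' i' j'))).

(** principal argument in (-pi, pi] of a complex number (0 for 0) *)
Definition carg (u : C) : R :=
  let x := fst u in let y := snd u in
  if Rlt_dec 0 x then atan (y / x)
  else if Rlt_dec x 0 then
    (if Rle_dec 0 y then atan (y / x) + PI else atan (y / x) - PI)
  else if Rlt_dec 0 y then PI / 2
  else if Rlt_dec y 0 then - (PI / 2) else 0.

Definition on_segment (w a b : C) : Prop :=
  exists t : R, 0 <= t <= 1 /\ w = Cplus a (Cmult (RtoC t) (Cminus b a)).

Definition edge_angle (w a b : C) : R := carg (Cdiv (Cminus b w) (Cminus a w)).

(** interior of the closed polygon through the points vs: the points not on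
    the polygon with nonzero winding number (2*pi*winding = sum of angles) *)
Definition poly_interior (vs : list C) (w : C) : Prop :=
  List.Forall (fun e => ~ on_segment w (fst e) (snd e)) (quad_edges vs) /\
  fold_right Rplus 0 (map (fun e => edge_angle w (fst e) (snd e)) (quad_edges vs)) <> 0.

Definition zv (z : Z -> Z -> Z -> C) (v : pt) : C :=
  let '(k, l, m) := v in z k l m.

Definition immersion (z : Z -> Z -> Z -> C) : Prop :=
  forall p i j p' i' j', adjacent p i j p' i' j' ->
    forall w : C, ~ (poly_interior (map (zv z) (quad_vertices p i j)) w /\
                     poly_interior (map (zv z) (quad_vertices p' i' j')) w).

(* Main.v *)
Require Import Defs.
From Stdlib Require Import Reals Ranalysis5 ZArith List Lra Lia Arith.
From Coquelicot Require Import Coquelicot.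
Import ListNotations.

(** Write [g = c / 2] and let [psi d] be the arguments of the three edge directions
    of [Q], rotated so that the middle one (along [- e_3]) is [0].  The cross-ratio
    equations factorise the edges as [z (v + d) - z v = exp (i psi d) w v w (v + d)],
    where [w] is real at circle centres (a signed radius) and of modulus one at
    intersection points.  If the signed radii at the centres of [Q_H] are positive,
    the quadrilaterals are positively oriented kites, and two adjacent ones lie in
    disjoint sectors at their common centre, because the half angles there are
    smaller than two intersection angles with sum less than [PI].

    Positivity comes from interpolation.  Transporting the vector
    [(t ^ 0, - t ^ g)], [t = exp (- 2 i psi)], by the Lax matrices of the
    cross-ratio system gives at [v = (k, l, - n)] quasi-polynomials that vanish at
    [psi 1, psi 2, psi 3] to the orders [k, l, n]: on an axis this is a
    hypergeometric computation based on the constraint (ii), and the other edges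
    preserve it.  At an intersection point both components are real up to a common
    phase, and minus their ratio, evaluated at [psi d], is the radius at [v + d].
    When [n >= k + l + 1], dividing by [sin ^ n] puts the components in the spans of
    [sin ^ j * fam (n - d + j)], [j <= k + l], for Gegenbauer-type functions [fam].
    Such a span is a Chebyshev system on [(- PI, PI)], so there are no further
    zeros, the ratio has constant sign, and the radii of the neighbouring circles
    have equal signs.  Walking along neighbours reaches the third axis, where the
    radii are explicit and positive. *)

Local Open Scope R_scope.

(** * Orders of vanishing and Rolle's theorem with multiplicities *)

(** The recurrence for the signed radii contains subtractions, so positivity does not propagate
    visibly; a count of zeros replaces an estimate. At an intersection point the real components [f]
    and [h] lie in spaces of dimension [k + l + 1] and already have [k + l] zeros at [psi D1] and
    [psi D2], the largest number possible. The remaining zero [psi D3 = 0] lies between these two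
    and is the singular point of the Gegenbauer equation, which is why powers of [sin] serve as
    integrating factors and zeros are followed on both sides of 0. The components belong to two
    families, with parameters [g] and [1 - g], which each pair of edges mixes; [0 < c < 2] puts both
    parameters into [(0, 1)]. There the functions of index at least 1 are positive, whereas index 0
    gives [- cos (g * x) / g], which can vanish; hence the restriction on [n]. The interval
    [(- PI, PI)] is where [sin (x / 2) ^ 2] stays below the radius of convergence 1. *)

Definition J (x : R) : Prop := - PI < x < PI.

Lemma J_locally (x : R) : J x -> locally x J.
Proof.
  intros [H1 H2].
  apply (locally_interval _ x (- PI) PI); simpl; [ lra | lra | ].
  intros y Hy1 Hy2; split; simpl in *; lra.
Qed.

Lemma J0 : J 0.
Proof. unfold J; pose proof PI_RGT_0; lra. Qed.

(** Differentiability is required on [J] only, since the power series behind [fam] is controlled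
    only there. *)
Fixpoint Cn (n : nat) (f : R -> R) : Prop :=
  match n with
  | O => True
  | S n => (forall x, J x -> ex_derive f x) /\ Cn n (Derive f)
  end.

Definition smooth (f : R -> R) : Prop := forall n, Cn n f.

Lemma J_eq_locally (f g : R -> R) (x : R) :
  (forall x, J x -> f x = g x) -> J x -> locally x (fun t => f t = g t).
Proof.
  intros H Hx. apply (filter_imp J); [ exact H | now apply J_locally ].
Qed.

Lemma Derive_ext_J (f g : R -> R) :
  (forall x, J x -> f x = g x) -> forall x, J x -> Derive f x = Derive g x.
Proof. intros H x Hx. apply Derive_ext_loc, J_eq_locally; auto. Qed.

Lemma Cn_ext (n : nat) : forall f g : R -> R,
  (forall x, J x -> f x = g x) -> Cn n f -> Cn n g.
Proof.
  induction n as [|n IH]; intros f g H; simpl; auto.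
  intros [H1 H2]; split.
  - intros x Hx. apply ex_derive_ext_loc with f; auto. apply J_eq_locally; auto.
  - apply IH with (Derive f); auto. now apply Derive_ext_J.
Qed.

Lemma Cn_le (n : nat) : forall f, Cn (S n) f -> Cn n f.
Proof.
  induction n as [|n IH]; intros f [H1 H2]; simpl; auto.
Qed.

Lemma Cn_const (n : nat) : forall a, Cn n (fun _ => a).
Proof.
  induction n as [|n IH]; intros a; simpl; auto. split.
  - intros; apply ex_derive_const.
  - apply Cn_ext with (fun _ => 0); auto. intros; now rewrite Derive_const.
Qed.

Lemma Cn_plus (n : nat) : forall f g, Cn n f -> Cn n g -> Cn n (fun x => f x + g x).
Proof.
  induction n as [|n IH]; intros f g; simpl; auto. intros [F1 F2] [G1 G2]; split.
  - intros x Hx. apply (ex_derive_plus f g); auto.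
  - apply Cn_ext with (fun x => Derive f x + Derive g x); auto.
    intros; now rewrite Derive_plus; auto.
Qed.

Lemma Cn_mult (n : nat) : forall f g, Cn n f -> Cn n g -> Cn n (fun x => f x * g x).
Proof.
  induction n as [|n IH]; intros f g; simpl; auto. intros F G.
  pose proof (Cn_le n _ F); pose proof (Cn_le n _ G).
  destruct F as [F1 F2]; destruct G as [G1 G2]; split.
  - intros x Hx. apply (ex_derive_mult f g); auto.
  - apply Cn_ext with (fun x => Derive f x * g x + f x * Derive g x); auto.
    + intros; now rewrite Derive_mult; auto.
    + apply Cn_plus; apply IH; auto.
Qed.

Lemma smooth_ext (f g : R -> R) : (forall x, J x -> f x = g x) -> smooth f -> smooth g.
Proof. intros H F n; now apply Cn_ext with f. Qed.

Lemma smooth_const (a : R) : smooth (fun _ => a).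
Proof. intro; apply Cn_const. Qed.

Lemma smooth_plus (f g : R -> R) : smooth f -> smooth g -> smooth (fun x => f x + g x).
Proof. intros F G n; now apply Cn_plus. Qed.

Lemma smooth_mult (f g : R -> R) : smooth f -> smooth g -> smooth (fun x => f x * g x).
Proof. intros F G n; now apply Cn_mult. Qed.

Lemma smooth_scal (a : R) (f : R -> R) : smooth f -> smooth (fun x => a * f x).
Proof. intros F; apply smooth_mult; auto using smooth_const. Qed.

Lemma smooth_minus (f g : R -> R) : smooth f -> smooth g -> smooth (fun x => f x - g x).
Proof.
  intros F G. apply smooth_ext with (fun x => f x + (-1) * g x).
  - intros; ring.
  - apply smooth_plus; auto. now apply smooth_scal.
Qed.

Lemma smooth_Derive (f : R -> R) : smooth f -> smooth (Derive f).
Proof. intros F n. exact (proj2 (F (S n))). Qed.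

Lemma smooth_ex_derive (f : R -> R) (x : R) : smooth f -> J x -> ex_derive f x.
Proof. intros F. exact (proj1 (F 1%nat) x). Qed.

Lemma smooth_continuous (f : R -> R) (x : R) : smooth f -> J x -> continuous f x.
Proof. intros F Hx. apply (ex_derive_continuous f). now apply smooth_ex_derive. Qed.

Lemma smooth_inv (f : R -> R) :
  smooth f -> (forall x, J x -> f x <> 0) -> smooth (fun x => / f x).
Proof.
  intros F H0 n. induction n as [|n IH]; simpl; auto. split.
  - intros x Hx. apply (ex_derive_inv f x); auto. now apply smooth_ex_derive.
  - apply Cn_ext with (fun x => (-1) * Derive f x * (/ f x * / f x)).
    + intros x Hx. rewrite Derive_inv; auto.
      * field; auto.
      * now apply smooth_ex_derive.
    + apply Cn_mult; [ | now apply Cn_mult ].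
      apply Cn_mult; [ apply Cn_const | now apply smooth_Derive ].
Qed.

Lemma Cn_sin_cos (a b : R) (n : nat) :
  Cn n (fun x => sin (a * x + b)) /\ Cn n (fun x => cos (a * x + b)).
Proof.
  induction n as [|n [IH1 IH2]]; simpl; auto. split; split.
  - intros; auto_derive; auto.
  - apply Cn_ext with (fun x => a * cos (a * x + b)).
    + intros. symmetry. apply is_derive_unique. auto_derive; auto. ring.
    + apply Cn_mult; auto using Cn_const.
  - intros; auto_derive; auto.
  - apply Cn_ext with (fun x => (- a) * sin (a * x + b)).
    + intros. symmetry. apply is_derive_unique. auto_derive; auto. ring.
    + apply Cn_mult; auto using Cn_const.
Qed.

Lemma smooth_sin_aff (a b : R) : smooth (fun x => sin (a * x + b)).
Proof. intro n; apply Cn_sin_cos. Qed.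

Lemma smooth_cos_aff (a b : R) : smooth (fun x => cos (a * x + b)).
Proof. intro n; apply Cn_sin_cos. Qed.

Lemma smooth_sin : smooth sin.
Proof.
  apply smooth_ext with (fun x => sin (1 * x + 0)); [ | apply smooth_sin_aff ].
  intros; f_equal; ring.
Qed.

Lemma smooth_cos : smooth cos.
Proof.
  apply smooth_ext with (fun x => cos (1 * x + 0)); [ | apply smooth_cos_aff ].
  intros; f_equal; ring.
Qed.

Lemma smooth_pow (f : R -> R) (n : nat) : smooth f -> smooth (fun x => f x ^ n).
Proof.
  intros F. induction n as [|n IH]; simpl.
  - apply smooth_const.
  - now apply smooth_mult.
Qed.

(** The [n]-th derivative at a zero of order at least [n]; its sign determines the sign of [f]
    nearby in [lead_sign]. *)
Fixpoint lead (n : nat) (f : R -> R) (a v : R) : Prop :=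
  match n with
  | O => f a = v
  | S n => f a = 0 /\ lead n (Derive f) a v
  end.

Fixpoint ord (n : nat) (f : R -> R) (a : R) : Prop :=
  match n with
  | O => True
  | S n => f a = 0 /\ ord n (Derive f) a
  end.

Lemma Derive_locally_eq (f g : R -> R) (a : R) :
  locally a (fun t => f t = g t) -> locally a (fun t => Derive f t = Derive g t).
Proof.
  intros H. apply locally_locally in H. revert H; apply filter_imp.
  intros x Hx. now apply Derive_ext_loc.
Qed.

Lemma ord_ext_loc (n : nat) : forall (f g : R -> R) (a : R),
  locally a (fun t => f t = g t) -> ord n f a -> ord n g a.
Proof.
  induction n as [|n IH]; intros f g a H; simpl; auto.
  intros [H0 H1]; split.
  - now rewrite <- (locally_singleton _ _ H).
  - apply IH with (Derive f); auto. now apply Derive_locally_eq.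
Qed.

Lemma ord_ext (n : nat) (f g : R -> R) (a : R) :
  (forall x, J x -> f x = g x) -> J a -> ord n f a -> ord n g a.
Proof. intros H Ha. apply ord_ext_loc, J_eq_locally; auto. Qed.

Lemma lead_ext_loc (n : nat) : forall (f g : R -> R) (a v : R),
  locally a (fun t => f t = g t) -> lead n f a v -> lead n g a v.
Proof.
  induction n as [|n IH]; intros f g a v H; simpl.
  - now rewrite <- (locally_singleton _ _ H).
  - intros [H0 H1]; split.
    + now rewrite <- (locally_singleton _ _ H).
    + apply IH with (Derive f); auto. now apply Derive_locally_eq.
Qed.

Lemma lead_ext (n : nat) (f g : R -> R) (a v : R) :
  (forall x, J x -> f x = g x) -> J a -> lead n f a v -> lead n g a v.
Proof. intros H Ha. apply lead_ext_loc, J_eq_locally; auto. Qed.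

Lemma ord_lead (n : nat) : forall (f : R -> R) (a : R), ord n f a -> exists v, lead n f a v.
Proof.
  induction n as [|n IH]; intros f a; simpl.
  - intros _; now exists (f a).
  - intros [H0 H1]. destruct (IH _ _ H1) as [v Hv]. now exists v.
Qed.

Lemma lead_ord (n : nat) : forall (f : R -> R) (a v : R), lead n f a v -> ord n f a.
Proof.
  induction n as [|n IH]; intros f a v; simpl; auto.
  intros [H0 H1]; eauto.
Qed.

Lemma lead_ord_S (n : nat) : forall (f : R -> R) (a v : R),
  lead n f a v -> (ord (S n) f a <-> v = 0).
Proof.
  induction n as [|n IH]; intros f a v.
  - simpl. intros <-; tauto.
  - intros [H0 H1]. specialize (IH _ _ _ H1).
    change (ord (S (S n)) f a) with (f a = 0 /\ ord (S n) (Derive f) a). tauto.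
Qed.

Lemma ord_le (n : nat) : forall (m : nat) (f : R -> R) (a : R), (m <= n)%nat -> ord n f a -> ord m f a.
Proof.
  induction n as [|n IH]; intros [|m] f a Hm; simpl; auto; try lia.
  intros [H0 H1]; split; auto. apply IH; auto; lia.
Qed.

Lemma lead_plus (n : nat) : forall (f g : R -> R) (a u v : R),
  smooth f -> smooth g -> J a -> lead n f a u -> lead n g a v ->
  lead n (fun x => f x + g x) a (u + v).
Proof.
  induction n as [|n IH]; intros f g a u v F G Ha; simpl.
  - intros; congruence.
  - intros [F0 F1] [G0 G1]; split; [ lra | ].
    apply lead_ext with (fun x => Derive f x + Derive g x); auto.
    + intros; rewrite Derive_plus; auto; now apply smooth_ex_derive.
    + apply IH; auto; now apply smooth_Derive.
Qed.

Lemma lead_mult (n : nat) : forall (f h : R -> R) (a v : R),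
  smooth f -> smooth h -> J a -> lead n f a v ->
  lead n (fun x => h x * f x) a (h a * v).
Proof.
  induction n as [|n IH]; intros f h a v F H Ha; simpl.
  - intros; congruence.
  - intros [F0 F1]; split; [ rewrite F0; ring | ].
    apply lead_ext with (fun x => Derive h x * f x + h x * Derive f x); auto.
    + intros; rewrite Derive_mult; auto; now apply smooth_ex_derive.
    + replace (h a * v) with (Derive h a * 0 + h a * v) by ring.
      apply lead_plus; auto using smooth_mult, smooth_Derive.
      apply IH; auto using smooth_Derive.
      (* [f] vanishes to order [S n], so the term with [Derive h] contributes nothing. *)
      assert (ord (S n) f a) by (split; auto; eapply lead_ord; eauto).
      destruct (ord_lead n f a) as [u Hu]; [ now apply ord_le with (S n); auto | ].
      apply (proj1 (lead_ord_S _ _ _ _ Hu)) in H0. now subst u.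
Qed.

Lemma ord_plus (n : nat) (f g : R -> R) (a : R) :
  smooth f -> smooth g -> J a -> ord n f a -> ord n g a -> ord n (fun x => f x + g x) a.
Proof.
  intros F G Ha Hf Hg.
  destruct (ord_lead _ _ _ Hf) as [u Hu]; destruct (ord_lead _ _ _ Hg) as [v Hv].
  eapply lead_ord, lead_plus; eauto.
Qed.

Lemma ord_mult (n : nat) (f h : R -> R) (a : R) :
  smooth f -> smooth h -> J a -> ord n f a -> ord n (fun x => h x * f x) a.
Proof.
  intros F H Ha Hf. destruct (ord_lead _ _ _ Hf) as [u Hu].
  eapply lead_ord, lead_mult; eauto.
Qed.

(** [h * f'] is [(h * f)'] minus [h' * f], and the last term has order [n] because [f] does by
    induction. *)
Lemma ord_cancel (n : nat) : forall (f h : R -> R) (a : R),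
  smooth f -> smooth h -> J a -> h a <> 0 -> ord n (fun x => h x * f x) a -> ord n f a.
Proof.
  induction n as [|n IH]; intros f h a F H Ha H0 Hord; simpl; auto.
  assert (Hn : ord n f a) by (apply (IH f h a); auto; now apply ord_le with (S n); auto).
  destruct Hord as [E O]. split.
  - apply Rmult_integral in E; tauto.
  - apply (IH (Derive f) h a); auto using smooth_Derive.
    apply ord_ext with (fun x => Derive (fun x => h x * f x) x + (-1) * (Derive h x * f x)); auto.
    + intros; rewrite Derive_mult; auto using smooth_ex_derive. ring.
    + apply ord_plus; auto using smooth_mult, smooth_scal, smooth_Derive.
      apply ord_mult; auto using smooth_mult, smooth_scal, smooth_Derive, smooth_const.
      apply ord_mult; auto using smooth_mult, smooth_scal, smooth_Derive.
Qed.

(** [S n] Leibniz terms carry exactly one derivative on [sin]; all others vanish at 0. *)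
Lemma lead_sin (n : nat) : forall (f : R -> R) (v : R),
  smooth f -> lead n f 0 v -> lead (S n) (fun x => sin x * f x) 0 (INR (S n) * v).
Proof.
  induction n as [|n IH]; intros f v F L.
  - split; [ rewrite sin_0; ring | ].
    simpl. rewrite Derive_mult; try (auto_derive; auto; fail).
    + rewrite (is_derive_unique sin 0 (cos 0)) by (auto_derive; auto; ring).
      rewrite cos_0, sin_0. simpl in L. rewrite L; ring.
    + apply smooth_ex_derive; auto using J0.
  - split; [ rewrite sin_0; ring | ].
    apply lead_ext with (fun x => cos x * f x + sin x * Derive f x); auto using J0.
    + intros. rewrite Derive_mult; try (auto_derive; auto; fail).
      * now rewrite (is_derive_unique sin x (cos x)) by (auto_derive; auto; ring).
      * now apply smooth_ex_derive.
    + rewrite S_INR. replace ((INR (S n) + 1) * v) with (cos 0 * v + INR (S n) * v)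
        by (rewrite cos_0; ring).
      apply lead_plus; auto using smooth_mult, smooth_cos, smooth_sin, smooth_Derive, J0.
      * apply lead_mult; auto using smooth_cos, J0.
      * apply IH; auto using smooth_Derive. apply L.
Qed.

Lemma lead_sin_pow (n : nat) (f : R -> R) :
  smooth f -> exists C, C <> 0 /\ lead n (fun x => sin x ^ n * f x) 0 (C * f 0).
Proof.
  intros F. induction n as [|n [C [HC IH]]].
  - exists 1; split; [ lra | simpl; ring ].
  - exists (INR (S n) * C); split.
    + apply Rmult_integral_contrapositive; split; auto. now apply not_0_INR.
    + apply lead_ext with (fun x => sin x * (sin x ^ n * f x)); auto using J0.
      * intros; simpl; ring.
      * rewrite Rmult_assoc. apply lead_sin; auto.
        auto using smooth_mult, smooth_pow, smooth_sin.
Qed.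

Lemma ord_sin (n : nat) (f : R -> R) :
  smooth f -> ord n f 0 -> ord (S n) (fun x => sin x * f x) 0.
Proof.
  intros F H. destruct (ord_lead _ _ _ H) as [v Hv].
  eapply lead_ord, lead_sin; eauto.
Qed.

Lemma ord_sin_pow (m n : nat) (f : R -> R) :
  smooth f -> ord n f 0 -> ord (m + n) (fun x => sin x ^ m * f x) 0.
Proof.
  intros F H. induction m as [|m IH].
  - apply ord_ext with f; auto using J0. intros; simpl; ring.
  - apply ord_ext with (fun x => sin x * (sin x ^ m * f x)); auto using J0.
    + intros; simpl; ring.
    + apply ord_sin; auto. auto using smooth_mult, smooth_pow, smooth_sin.
Qed.

Lemma ord_sin_pow_S (n : nat) (f : R -> R) :
  smooth f -> ord (S n) (fun x => sin x ^ n * f x) 0 -> f 0 = 0.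
Proof.
  intros F H. destruct (lead_sin_pow n f F) as [C [HC L]].
  apply (lead_ord_S _ _ _ _ L) in H. apply Rmult_integral in H; tauto.
Qed.

Lemma Derive_shift (f : R -> R) (t x : R) : Derive (fun y => f (y - t)) x = Derive f (x - t).
Proof.
  unfold Derive. f_equal. apply Lim_ext. intros h. now replace (x + h - t) with (x - t + h) by ring.
Qed.

Lemma ord_shift (n : nat) : forall (f : R -> R) (a t : R),
  ord n f (a - t) -> ord n (fun y => f (y - t)) a.
Proof.
  induction n as [|n IH]; intros f a t; simpl; auto.
  intros [H0 H1]; split; auto.
  apply ord_ext_loc with (fun y => Derive f (y - t)); auto.
  apply filter_forall. intros; now rewrite Derive_shift.
Qed.

Lemma Rolle_smooth_MVT (f : R -> R) (a b : R) :
  smooth f -> J a -> J b -> a < b -> exists c, f b - f a = Derive f c * (b - a) /\ a < c < b.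
Proof.
  intros F Ha Hb Hab. unfold J in *. apply (MVT_cor2 f (Derive f)); auto.
  intros y Hy. apply is_derive_Reals, Derive_correct, smooth_ex_derive; auto. unfold J; lra.
Qed.

(** Induction by the mean value theorem: [f x = Derive f c * (x - a)] with [c] between [a] and [x],
    where [(c - a) ^ k] and [(x - a) ^ k] have the same sign. *)
Lemma lead_sign (k : nat) : forall (f : R -> R) (a v : R),
  smooth f -> J a -> lead k f a v -> v <> 0 ->
  exists d, 0 < d /\ forall x, x <> a -> Rabs (x - a) < d -> 0 < f x * v * (x - a) ^ k.
Proof.
  induction k as [|k IH]; intros f a v F Ha L Hv.
  - simpl in L. assert (C : continuous f a) by now apply smooth_continuous.
    assert (P : 0 < f a * v) by (rewrite L; nra).
    assert (C' : continuous (fun x => f x * v) a)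
      by (apply (continuous_mult f (fun _ => v)); auto using continuous_const).
    specialize (C' (fun y => 0 < y) (open_gt 0 _ P)).
    destruct C' as [d Hd]. exists d; split; [ apply cond_pos | ].
    intros x _ Hx. simpl; rewrite Rmult_1_r. now apply (Hd x).
  - destruct L as [L0 L1].
    destruct (IH (Derive f) a v) as [d [Hd Hs]]; auto using smooth_Derive.
    destruct (J_locally a Ha) as [e He].
    exists (Rmin d e); split; [ apply Rmin_pos; auto; apply cond_pos | ].
    intros x Hxa Hx.
    pose proof (Rmin_l d e); pose proof (Rmin_r d e).
    assert (Hxe : Rabs (x - a) < e) by lra.
    assert (Jx : J x) by now apply He.
    assert (exists c, f x = Derive f c * (x - a) /\ 0 < (c - a) * (x - a) /\ Rabs (c - a) < d)
      as [c [E [Hc1 Hc2]]].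
    { destruct (Rlt_le_dec a x) as [Hlt|Hle].
      - destruct (Rolle_smooth_MVT f a x) as [c [E Hc]]; auto.
        exists c; split; [ lra | split; [ nra | ] ].
        rewrite Rabs_right in *; lra.
      - assert (x < a) by lra.
        destruct (Rolle_smooth_MVT f x a) as [c [E Hc]]; auto.
        exists c; split; [ lra | split; [ nra | ] ].
        rewrite Rabs_left in *; lra. }
    assert (0 < Derive f c * v * (c - a) ^ k) by (apply Hs; auto; intros ->; nra).
    assert (P : 0 < (c - a) ^ k * (x - a) ^ k) by (rewrite <- Rpow_mult_distr; now apply pow_lt).
    rewrite E. simpl. set (X := (x - a) ^ k) in *; set (Y := (c - a) ^ k) in *.
    assert (0 < (Derive f c * v * Y) * (Y * X)) by now apply Rmult_lt_0_compat.
    assert (0 < Y * Y) by (apply Rsqr_pos_lt; intros HY; rewrite HY in P; lra).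
    assert (0 < Derive f c * v * X) by nra.
    assert (0 < (x - a) * (x - a)) by nra.
    replace (Derive f c * (x - a) * v * ((x - a) * X))
      with (Derive f c * v * X * ((x - a) * (x - a))) by ring.
    now apply Rmult_lt_0_compat.
Qed.

(** At least [m] zeros, counted with multiplicity, in [(lo, PI)]. *)
Inductive zeros (f : R -> R) : R -> nat -> Prop :=
| zeros_nil lo : zeros f lo 0
| zeros_cons lo a n m :
    lo < a -> J a -> ord n f a -> zeros f a m -> zeros f lo (n + m).

Lemma zeros_weaken (f : R -> R) (lo lo' : R) (m : nat) :
  lo' <= lo -> zeros f lo m -> zeros f lo' m.
Proof.
  intros H Z; revert lo' H; induction Z as [|lo a n m]; intros lo' H'.
  - constructor.
  - apply zeros_cons with a; auto; lra.
Qed.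

Lemma zeros_impl (f g : R -> R) (lo : R) (m : nat) :
  (forall n a, J a -> ord n f a -> ord n g a) -> zeros f lo m -> zeros g lo m.
Proof.
  intros H Z; induction Z as [|lo a n m].
  - constructor.
  - apply zeros_cons with a; auto.
Qed.

Lemma Rolle_J (f : R -> R) (a b : R) :
  smooth f -> J a -> J b -> a < b -> f a = 0 -> f b = 0 ->
  exists y, a < y < b /\ J y /\ Derive f y = 0.
Proof.
  intros F Ha Hb Hab Fa Fb.
  destruct (Rolle_smooth_MVT f a b) as [c [E Hc]]; auto.
  exists c; split; [ auto | split; [ unfold J in *; lra | nra ] ].
Qed.

(** With a zero [b] to start from, each later zero of order [n > 0] yields a Rolle point before it
    and stays a zero of order [n - 1] of the derivative, so nothing is lost. *)
Lemma zeros_Derive_from (f : R -> R) (lo : R) (m : nat) :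
  smooth f -> zeros f lo m ->
  forall b, J b -> b <= lo -> f b = 0 -> zeros (Derive f) b m.
Proof.
  intros F Z; induction Z as [|lo a n m Hlo Ha Ho Z IH]; intros b Jb Hb Fb.
  - constructor.
  - destruct n as [|n]; simpl.
    + apply IH; auto; lra.
    + destruct Ho as [Fa Ho].
      destruct (Rolle_J f b a) as [y [Hy [Jy Dy]]]; auto; try lra.
      apply (zeros_cons _ b y 1 (n + m)); try lra; auto.
      * simpl; auto.
      * apply zeros_cons with a; try lra; auto. apply IH; auto; lra.
Qed.

(** Only the first zero lacks a Rolle point to its left. *)
Lemma zeros_Derive (f : R -> R) (lo : R) (m : nat) :
  smooth f -> zeros f lo (S m) -> zeros (Derive f) lo m.
Proof.
  intros F Z. remember (S m) as M eqn:E. revert m E.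
  induction Z as [|lo a n m' Hlo Ha Ho Z IH]; intros m E; [ discriminate | ].
  destruct n as [|n]; simpl in E.
  - apply zeros_weaken with a; [ lra | auto ].
  - injection E as <-. destruct Ho as [Fa Ho].
    apply zeros_cons with a; auto. apply (zeros_Derive_from f a m'); auto; lra.
Qed.

Lemma sin_J_neq_0 (x : R) : J x -> x <> 0 -> sin x <> 0.
Proof.
  intros [H1 H2] H0 E. destruct (Rlt_le_dec 0 x).
  - pose proof (sin_gt_0 x); lra.
  - pose proof (sin_gt_0 (- x)). rewrite sin_neg in *. lra.
Qed.

Lemma Derive_sin (x : R) : Derive sin x = cos x.
Proof. apply is_derive_unique. auto_derive; auto; ring. Qed.

Lemma Derive_cos (x : R) : Derive cos x = - sin x.
Proof. apply is_derive_unique. auto_derive; auto; ring. Qed.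

Lemma ex_derive_sin (x : R) : ex_derive sin x.
Proof. auto_derive; auto. Qed.

Lemma ex_derive_cos (x : R) : ex_derive cos x.
Proof. auto_derive; auto. Qed.

(** [sin ^ k * pivot k f] is, up to the factor [sin], the derivative of
    [sin ^ k * f]; as the latter vanishes at [0], no zero of [f] is lost. *)
Definition pivot (k : nat) (f : R -> R) (x : R) : R :=
  INR k * cos x * f x + sin x * Derive f x.

Lemma Derive_sin_pow_mult (k : nat) (f : R -> R) (x : R) :
  smooth f -> J x ->
  Derive (fun x => sin x ^ S k * f x) x = sin x ^ k * pivot (S k) f x.
Proof.
  intros F Hx. rewrite Derive_mult.
  - rewrite Derive_pow; [ | apply ex_derive_sin ]. rewrite Derive_sin. unfold pivot.
    simpl pred. simpl pow. ring.
  - apply ex_derive_pow, ex_derive_sin.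
  - now apply smooth_ex_derive.
Qed.

Lemma ord_pivot (k n : nat) (f : R -> R) (a : R) :
  smooth f -> J a -> ord (S n) f a -> ord n (pivot k f) a.
Proof.
  intros F Ha Ho. unfold pivot. apply ord_plus; auto.
  1,2: auto 6 using smooth_plus, smooth_mult, smooth_const, smooth_cos, smooth_sin, smooth_Derive.
  - apply ord_mult; auto using smooth_mult, smooth_const, smooth_cos.
    now apply ord_le with (S n); auto.
  - apply ord_mult; auto using smooth_sin, smooth_Derive. apply Ho.
Qed.

(** At 0 the factor [sin] in front of [Derive f] restores the order lost by differentiation. *)
Lemma ord_pivot_0 (k n : nat) (f : R -> R) :
  smooth f -> ord n f 0 -> ord n (pivot k f) 0.
Proof.
  intros F Ho. unfold pivot. apply ord_plus; auto using J0.
  1,2: auto 6 using smooth_plus, smooth_mult, smooth_const, smooth_cos, smooth_sin, smooth_Derive.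
  - apply ord_mult; auto using smooth_mult, smooth_const, smooth_cos, J0.
  - destruct n as [|n]; [ exact I | ].
    apply ord_sin; [ now apply smooth_Derive | apply Ho ].
Qed.

Section Pivot.

Variables (k : nat) (f : R -> R).
Hypothesis F : smooth f.

Let H (x : R) : R := sin x ^ S k * f x.

Lemma smooth_H : smooth H.
Proof. apply smooth_mult; auto using smooth_pow, smooth_sin. Qed.

Lemma H_zero (a : R) : f a = 0 \/ a = 0 -> H a = 0.
Proof.
  unfold H; intros [E | ->].
  - rewrite E; ring.
  - rewrite sin_0; simpl; ring.
Qed.

(** The point 0 counts as a zero of [H] whatever [f] does there. It must not lie inside the
    interval, so that [sin ^ k] can be cancelled at the Rolle point. *)
Lemma Rolle_H (a b : R) :
  J a -> J b -> a < b -> (f a = 0 \/ a = 0) -> (f b = 0 \/ b = 0) -> 0 <= a \/ b <= 0 ->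
  exists y, a < y < b /\ J y /\ ord 1 (pivot (S k) f) y.
Proof.
  intros Ja Jb Hab Ha Hb Hs.
  destruct (Rolle_J H a b) as [y [Hy [Jy Dy]]]; auto using smooth_H, H_zero.
  exists y; split; [ auto | split; [ auto | ] ].
  unfold H in Dy. rewrite Derive_sin_pow_mult in Dy; auto.
  simpl; split; auto.
  apply Rmult_integral in Dy; destruct Dy as [Dy|Dy]; auto.
  exfalso. apply (pow_nonzero (sin y) k); auto. apply sin_J_neq_0; auto. lra.
Qed.

Lemma zeros_pivot_pos (lo : R) (m : nat) :
  zeros f lo m -> forall b, J b -> 0 <= b <= lo -> (f b = 0 \/ b = 0) -> zeros (pivot (S k) f) b m.
Proof.
  intros Z; induction Z as [|lo a n m Hlo Ha Ho Z IH]; intros b Jb Hb Fb.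
  - constructor.
  - destruct n as [|n]; simpl.
    + apply IH; auto; lra.
    + destruct (Rolle_H b a) as [y [Hy [Jy Oy]]]; auto; try lra.
      { left; apply Ho. }
      apply (zeros_cons _ b y 1 (n + m)); auto; try lra.
      apply zeros_cons with a; auto; try lra.
      * now apply ord_pivot.
      * apply IH; auto; try lra. left; apply Ho.
Qed.

(** One zero is gained: to the right of [b < 0] the point 0 is an additional zero of [H]. *)
Lemma zeros_pivot_neg (lo : R) (m : nat) :
  zeros f lo m -> forall b, J b -> b < 0 -> b <= lo -> f b = 0 -> zeros (pivot (S k) f) b (S m).
Proof.
  intros Z; induction Z as [lo|lo a n m Hlo Ha Ho Z IH]; intros b Jb Hb0 Hb Fb.
  - destruct (Rolle_H b 0) as [y [Hy [Jy Oy]]]; auto using J0; try lra.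
    apply (zeros_cons _ b y 1 0); auto; try lra. constructor.
  - destruct n as [|n]; simpl.
    + apply IH; auto; lra.
    + destruct (Rlt_le_dec a 0) as [Ha0|Ha0].
      * destruct (Rolle_H b a) as [y [Hy [Jy Oy]]]; auto; try lra.
        { left; apply Ho. }
        replace (S (S (n + m))) with (1 + (n + S m))%nat by lia.
        apply (zeros_cons _ b y); auto; try lra.
        apply zeros_cons with a; auto; try lra.
        -- now apply ord_pivot.
        -- apply IH; auto; try lra. apply Ho.
      * destruct (Rolle_H b 0) as [y [Hy [Jy Oy]]]; auto using J0; try lra.
        replace (S (S (n + m))) with (1 + (S n + m))%nat by lia.
        apply (zeros_cons _ b y); auto; try lra.
        destruct Ha0 as [Ha0|<-].
        -- apply zeros_weaken with 0; [ lra | ].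
           apply (zeros_pivot_pos 0); auto using J0; try lra. now apply zeros_cons with a.
        -- apply zeros_cons with 0; auto; try lra.
           ++ now apply ord_pivot_0.
           ++ apply (zeros_pivot_pos 0); auto; try lra.
Qed.

Lemma zeros_pivot (lo : R) (m : nat) :
  - PI <= lo -> zeros f lo m -> zeros (pivot (S k) f) (- PI) m.
Proof.
  intros Hlo Z; induction Z as [lo|lo a n m Hla Ha Ho Z IH].
  - constructor.
  - destruct n as [|n].
    + apply IH; lra.
    + destruct (Rtotal_order a 0) as [Ha0|[->|Ha0]].
      (* The order lost at the leftmost zero is made up by the zero gained from 0. *)
      * replace (S n + m)%nat with (n + S m)%nat by lia.
        apply zeros_cons with a; auto; try lra.
        -- now apply ord_pivot.
        -- apply (zeros_pivot_neg a); auto; try lra. apply Ho.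
      * apply zeros_cons with 0; auto; try lra.
        -- now apply ord_pivot_0.
        -- apply (zeros_pivot_pos 0); auto; try lra.
      * apply zeros_weaken with 0; [ pose proof PI_RGT_0; lra | ].
        apply (zeros_pivot_pos 0); auto using J0; try lra.
        apply zeros_cons with a; auto.
Qed.

End Pivot.

(** * Gegenbauer-type functions *)

(** Taylor coefficients in [y = sin (x / 2) ^ 2] of the Gegenbauer-type functions
    [A_k], multiples of [2F1 (k + g, k - g; k + 1/2; y)]. *)
Fixpoint coef0 (g : R) (n : nat) : R :=
  match n with
  | O => - / g
  | S n => coef0 g n * ((INR n * INR n - g * g) / ((INR n + 1) * (INR n + / 2)))
  end.

(** Since [(1 - cos x) / 2] has derivative [sin x / 2], this scaling gives
    [Derive (fam g k) = sin * fam g (S k)]. *)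
Fixpoint coef (g : R) (k : nat) : nat -> R :=
  match k with
  | O => coef0 g
  | S k => PS_scal (/ 2) (PS_derive (coef g k))
  end.

Definition fam (g : R) (k : nat) (x : R) : R := PSeries (coef g k) ((1 - cos x) / 2).

Section Family.

Variable g : R.
Hypothesis Hg : 0 < g < 1.

Lemma coef0_factor_neq_0 (n : nat) :
  (INR n * INR n - g * g) / ((INR n + 1) * (INR n + / 2)) <> 0.
Proof.
  pose proof (pos_INR n) as Hn. apply Rmult_integral_contrapositive; split.
  - destruct n as [|n].
    + simpl; nra.
    + rewrite S_INR in *. pose proof (pos_INR n). nra.
  - apply Rinv_neq_0_compat, Rgt_not_eq. apply Rmult_lt_0_compat; lra.
Qed.

Lemma coef0_neq_0 (n : nat) : coef0 g n <> 0.
Proof.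
  induction n as [|n IH]; simpl.
  - apply Ropp_neq_0_compat, Rinv_neq_0_compat; lra.
  - apply Rmult_integral_contrapositive; split; auto using coef0_factor_neq_0.
Qed.

Lemma lim_shift_ratio (a b : R) : 0 < a ->
  is_lim_seq (fun n => (INR n + b) / (INR n + a)) 1.
Proof.
  intros Ha. apply is_lim_seq_ext with (fun n => 1 + (b - a) * / (INR n + a)).
  - intros n; pose proof (pos_INR n). field. lra.
  - replace 1 with (1 + (b - a) * 0) at 1 by ring.
    apply is_lim_seq_plus'; [ apply is_lim_seq_const | ].
    apply (is_lim_seq_scal_l _ (b - a) 0).
    apply (is_lim_seq_inv _ p_infty); [ | discriminate ].
    apply is_lim_seq_plus with p_infty a; [ apply is_lim_seq_INR | apply is_lim_seq_const | ].
    now simpl.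
Qed.

Lemma CV_radius_coef0 : CV_radius (coef0 g) = 1.
Proof.
  replace (Finite 1) with (Finite (/ 1)) by (f_equal; field).
  apply CV_radius_finite_DAlembert; [ apply coef0_neq_0 | lra | ].
  replace 1 with (Rabs (1 * 1)) by (rewrite Rmult_1_r; apply Rabs_R1).
  apply is_lim_seq_ext with
    (fun n => Rabs ((INR n + (- g)) / (INR n + 1) * ((INR n + g) / (INR n + / 2)))).
  - intros n. f_equal. simpl. pose proof (pos_INR n). field.
    repeat split; try lra. apply coef0_neq_0.
  - apply (is_lim_seq_abs _ (Finite (1 * 1))).
    apply is_lim_seq_mult'; apply lim_shift_ratio; lra.
Qed.

Lemma CV_radius_coef (k : nat) : CV_radius (coef g k) = 1.
Proof.
  induction k as [|k IH]; [ apply CV_radius_coef0 | ].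
  simpl. now rewrite CV_radius_scal, CV_radius_derive by lra.
Qed.

Lemma J_cos (x : R) : J x -> - 1 < cos x.
Proof.
  intros [H1 H2]. destruct (Rle_lt_dec 0 x).
  - rewrite <- cos_PI. apply cos_decreasing_1; lra.
  - rewrite <- cos_PI, <- (cos_neg x). apply cos_decreasing_1; lra.
Qed.

Lemma J_y (x : R) : J x -> 0 <= (1 - cos x) / 2 < 1.
Proof. intros Hx; pose proof (J_cos x Hx); pose proof (COS_bound x); lra. Qed.

Lemma y_in_disk (k : nat) (y : R) : 0 <= y < 1 -> Rbar_lt (Rabs y) (CV_radius (coef g k)).
Proof. intros H. rewrite CV_radius_coef. simpl. rewrite Rabs_right; lra. Qed.

Lemma ex_pseries_coef (k : nat) (y : R) : 0 <= y < 1 -> ex_pseries (coef g k) y.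
Proof. intros H. now apply CV_radius_inside, y_in_disk. Qed.

Lemma is_derive_fam (k : nat) (x : R) : J x -> is_derive (fam g k) x (sin x * fam g (S k) x).
Proof.
  intros Hx. unfold fam. simpl coef. rewrite PSeries_scal.
  replace (sin x * _) with
    (scal (sin x / 2) (PSeries (PS_derive (coef g k)) ((1 - cos x) / 2)))
    by (unfold scal; simpl; unfold mult; simpl; field).
  apply (is_derive_comp (PSeries (coef g k)) (fun x => (1 - cos x) / 2)).
  - apply is_derive_PSeries, y_in_disk, J_y, Hx.
  - auto_derive; auto. field.
Qed.

Lemma Derive_fam (k : nat) (x : R) : J x -> Derive (fam g k) x = sin x * fam g (S k) x.
Proof. intros Hx. now apply is_derive_unique, is_derive_fam. Qed.

Lemma smooth_fam (k : nat) : smooth (fam g k).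
Proof.
  intros n. revert k. induction n as [|n IH]; intros k; simpl; auto. split.
  - intros x Hx. eexists. now apply is_derive_fam.
  - apply Cn_ext with (fun x => sin x * fam g (S k) x).
    + intros; now rewrite Derive_fam.
    + apply Cn_mult; auto. apply smooth_sin.
Qed.

(** The negative factor at [n = 0] turns the sign of [- / g]; the later factors are positive because
    [n >= 1 > g]. *)
Lemma coef0_pos (n : nat) : 0 < coef0 g (S n).
Proof.
  induction n as [|n IH].
  - simpl. replace (- / g * ((0 * 0 - g * g) / ((0 + 1) * (0 + / 2)))) with (2 * g) by (field; lra). lra.
  - change (0 < coef0 g (S n) * ((INR (S n) * INR (S n) - g * g) / ((INR (S n) + 1) * (INR (S n) + / 2)))).
    apply Rmult_lt_0_compat; auto. rewrite S_INR. pose proof (pos_INR n).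
    apply Rdiv_lt_0_compat; nra.
Qed.

Lemma coef_pos (k n : nat) : 0 < coef g (S k) n.
Proof.
  revert n; induction k as [|k IH]; intros n.
  - simpl. unfold PS_scal, PS_derive, scal; simpl; unfold mult; simpl.
    pose proof (coef0_pos n). pose proof (pos_INR n).
    apply Rmult_lt_0_compat; [ lra | ].
    apply Rmult_lt_0_compat; auto. change (0 < INR (S n)). rewrite S_INR; lra.
  - change (coef g (S (S k)) n) with (/ 2 * (INR (S n) * coef g (S k) (S n))).
    specialize (IH (S n)). rewrite S_INR. pose proof (pos_INR n).
    apply Rmult_lt_0_compat; [ lra | ]. apply Rmult_lt_0_compat; auto; lra.
Qed.

Lemma PSeries_nonneg (a : nat -> R) (y : R) :
  (forall n, 0 <= a n) -> 0 <= y -> ex_pseries a y -> 0 <= PSeries a y.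
Proof.
  intros Ha Hy E. unfold PSeries.
  replace 0 with (PSeries (fun _ => 0) y) by apply PSeries_const_0.
  apply Series_le.
  - intros n. rewrite Rmult_0_l. split; [ lra | ].
    apply Rmult_le_pos; auto. now apply pow_le.
  - now apply ex_pseries_R.
Qed.

Lemma fam_pos (k : nat) (x : R) : J x -> 0 < fam g (S k) x.
Proof.
  intros Hx. unfold fam. pose proof (J_y x Hx) as Hy.
  rewrite PSeries_decr_1 by now apply ex_pseries_coef.
  assert (0 <= PSeries (PS_decr_1 (coef g (S k))) ((1 - cos x) / 2)).
  { apply PSeries_nonneg; try lra.
    - intros n. apply Rlt_le, coef_pos.
    - apply CV_radius_inside. rewrite CV_radius_decr_1. now apply y_in_disk. }
  pose proof (coef_pos k 0). set (Y := (1 - cos x) / 2) in *. nra.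
Qed.

Lemma fam_ODE_0 (x : R) : J x ->
  cos x * fam g 1 x + sin x * (sin x * fam g 2 x) + g * g * fam g 0 x = 0.
Proof.
  intros Hx. pose proof (J_y x Hx) as Hy. unfold fam.
  set (y := (1 - cos x) / 2) in *.
  replace (cos x) with (1 - 2 * y) by (unfold y; field).
  rewrite <- Rmult_assoc.
  replace (sin x * sin x) with (4 * y * (1 - y)).
  2:{ pose proof (sin2_cos2 x) as H. unfold Rsqr in H. unfold y.
      replace (sin x * sin x) with (1 - cos x * cos x) by lra. field. }
  (* The power series in [y] of the left-hand side; its coefficients vanish by the recursion of
     [coef0]. *)
  set (E := PS_plus
    (PS_plus (coef g 1) (PS_scal (-2) (PS_incr_1 (coef g 1))))
    (PS_plus
       (PS_incr_1 (PS_scal 4 (PS_plus (coef g 2) (PS_scal (-1) (PS_incr_1 (coef g 2))))))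
       (PS_scal (g * g) (coef g 0)))).
  assert (E0 : PSeries E y = 0).
  { rewrite <- (PSeries_const_0 y). apply PSeries_ext. intros n. unfold E.
    change (coef g 1) with (PS_scal (/ 2) (PS_derive (coef0 g))).
    change (coef g 2) with (PS_scal (/ 2) (PS_derive (PS_scal (/ 2) (PS_derive (coef0 g))))).
    change (coef g 0) with (coef0 g).
    unfold PS_plus, PS_scal, PS_derive, PS_incr_1, scal, plus, mult, zero; cbn -[INR coef0].
    assert (R0 : forall n, coef0 g (S n)
      = coef0 g n * ((INR n * INR n - g * g) / ((INR n + 1) * (INR n + / 2)))) by reflexivity.
    destruct n as [|[|n]]; rewrite !R0, ?S_INR; change (INR 0) with 0.
    all: try pose proof (pos_INR n); field; repeat split; lra. }
  rewrite <- E0. unfold E.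
  assert (X : forall k, ex_pseries (coef g k) y) by (intros; now apply ex_pseries_coef).
  assert (XI : forall k, ex_pseries (PS_incr_1 (coef g k)) y) by (intros; now apply ex_pseries_incr_1).
  assert (XS : forall c (a : nat -> R), ex_pseries a y -> ex_pseries (PS_scal c a) y)
    by (intros; apply ex_pseries_scal; [ apply Rmult_comm | assumption ]).
  rewrite (PSeries_plus (PS_plus _ _)), (PSeries_plus (coef g 1)), (PSeries_plus (PS_incr_1 _)),
    !PSeries_scal, !PSeries_incr_1, PSeries_scal, (PSeries_plus (coef g 2)), PSeries_scal, PSeries_incr_1;
    auto.
  - ring.
  - apply ex_pseries_incr_1, XS, ex_pseries_plus; auto.
  - apply ex_pseries_plus; auto.
  - apply ex_pseries_plus; auto. apply ex_pseries_incr_1, XS, ex_pseries_plus; auto.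
Qed.

Lemma Derive2_fam_0 (x : R) : J x -> Derive (fun x => sin x * fam g 1 x) x = - (g * g) * fam g 0 x.
Proof.
  intros Hx. rewrite Derive_mult, Derive_sin, Derive_fam; auto using ex_derive_sin.
  - pose proof (fam_ODE_0 x Hx). lra.
  - apply smooth_ex_derive; auto using smooth_fam.
Qed.

Lemma fam_at_0 : fam g 0 0 = - / g.
Proof.
  unfold fam. rewrite cos_0. replace ((1 - 1) / 2) with 0 by field.
  now rewrite PSeries_0.
Qed.

Lemma const_of_Derive_0 (f : R -> R) :
  smooth f -> (forall x, J x -> Derive f x = 0) -> forall x, J x -> f x = f 0.
Proof.
  intros F D x Hx. destruct (Rtotal_order x 0) as [H|[->|H]]; auto.
  - destruct (Rolle_smooth_MVT f x 0) as [c [E Hc]]; auto using J0.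
    rewrite D in E; [ lra | unfold J in *; lra ].
  - destruct (Rolle_smooth_MVT f 0 x) as [c [E Hc]]; auto using J0.
    rewrite D in E; [ lra | unfold J in *; pose proof J0; lra ].
Qed.

(** Conservation of energy. *)
Lemma oscillator_zero (u v : R -> R) : smooth u -> smooth v ->
  (forall x, J x -> Derive u x = v x) -> (forall x, J x -> Derive v x = - (g * g) * u x) ->
  u 0 = 0 -> v 0 = 0 -> forall x, J x -> u x = 0 /\ v x = 0.
Proof.
  intros Su Sv Du Dv U0 V0 x Hx.
  assert (C : g * g * (u x * u x) + v x * v x = 0).
  { rewrite (const_of_Derive_0 (fun x => g * g * (u x * u x) + v x * v x)); auto.
    - rewrite U0, V0; ring.
    - apply smooth_plus; [ apply smooth_scal | ]; auto using smooth_mult.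
    - intros t Ht. apply is_derive_unique.
      assert (ex_derive u t) by now apply smooth_ex_derive.
      assert (ex_derive v t) by now apply smooth_ex_derive.
      auto_derive; auto. change (Derive (fun x => u x) t) with (Derive u t).
      change (Derive (fun x => v x) t) with (Derive v t). rewrite Du, Dv by auto. ring. }
  assert (G : 0 < g * g) by nra.
  pose proof (Rle_0_sqr (u x)) as HU; pose proof (Rle_0_sqr (v x)) as HV. unfold Rsqr in *.
  pose proof (Rmult_le_pos _ _ (Rlt_le _ _ G) HU).
  assert (V : v x * v x = 0) by lra.
  assert (U : g * g * (u x * u x) = 0) by lra.
  apply Rmult_integral in U; destruct U as [U|U]; [ lra | ].
  apply Rmult_integral in U; apply Rmult_integral in V. tauto.
Qed.

(** In index 0 the equation is the harmonic oscillator, so it suffices to compare the data at 0. The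
    starting coefficient [- / g] normalises the second function to [sin (g * x)]. *)
Lemma fam_0_1 (x : R) : J x ->
  fam g 0 x = - cos (g * x) / g /\ sin x * fam g 1 x = sin (g * x).
Proof.
  intros Hx.
  set (u := fun x => fam g 0 x + / g * cos (g * x + 0)).
  set (v := fun x => sin x * fam g 1 x + (-1) * sin (g * x + 0)).
  assert (Su : smooth u) by (apply smooth_plus; auto using smooth_fam, smooth_scal, smooth_cos_aff).
  assert (Sv : smooth v)
    by (apply smooth_plus; auto using smooth_fam, smooth_scal, smooth_sin_aff, smooth_mult, smooth_sin).
  assert (Du : forall x, J x -> Derive u x = v x).
  { intros t Ht. unfold u, v. rewrite Derive_plus.
    - rewrite Derive_fam by auto. f_equal. apply is_derive_unique. auto_derive; auto. field; lra.
    - apply smooth_ex_derive; auto using smooth_fam.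
    - auto_derive; auto. }
  assert (Dv : forall x, J x -> Derive v x = - (g * g) * u x).
  { intros t Ht. unfold u, v. rewrite Derive_plus.
    - rewrite Derive2_fam_0 by auto.
      replace (Derive (fun x0 => -1 * sin (g * x0 + 0)) t) with (- g * cos (g * t + 0)).
      + field; lra.
      + symmetry; apply is_derive_unique. auto_derive; auto. field; lra.
    - apply smooth_ex_derive; auto using smooth_fam, smooth_mult, smooth_sin.
    - auto_derive; auto. }
  destruct (oscillator_zero u v Su Sv Du Dv) with (x := x) as [U0 V0]; auto.
  { unfold u. rewrite fam_at_0, Rmult_0_r, Rplus_0_r, cos_0. field; lra. }
  { unfold v. rewrite Rmult_0_r, Rplus_0_r, sin_0. ring. }
  unfold u, v in *. rewrite !Rplus_0_r in *. split; [ | lra ].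
  unfold Rdiv. lra.
Qed.

End Family.

(** At 0 a derivative replaces the division: [sin * (f - h)] vanishes to order 2 there, hence
    [f 0 = h 0]. *)
Lemma cancel_sin (f h : R -> R) : smooth f -> smooth h ->
  (forall x, J x -> sin x * f x = sin x * h x) -> forall x, J x -> f x = h x.
Proof.
  intros F H E x Hx. destruct (Req_dec x 0) as [->|H0].
  - assert (D : f 0 + -1 * h 0 = 0).
    { apply (ord_sin_pow_S 1 (fun x => f x + -1 * h x)).
      - apply smooth_plus; auto; now apply smooth_scal.
      - apply ord_ext with (fun _ => 0); auto using J0.
        + intros y Hy. simpl. specialize (E y Hy). nra.
        + simpl; rewrite !Derive_const; auto. }
    lra.
  - apply Rmult_eq_reg_l with (sin x); auto. now apply sin_J_neq_0.
Qed.

Section Contiguity.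

Variable g : R.
Hypothesis Hg : 0 < g < 1.

Let Hg' : 0 < 1 - g < 1.
Proof. lra. Qed.

(** At [k = 0] this is the addition formula for [sin (x - g * x)]; differentiating the relation at
    [k] and cancelling [sin] gives the one at [S k]. *)
Lemma fam_lower (k : nat) (x : R) : J x ->
  (INR k - g) * fam g k x = fam (1 - g) (S k) x + cos x * fam g (S k) x.
Proof.
  pose proof (smooth_fam g Hg) as SA; pose proof (smooth_fam (1 - g) Hg') as SB.
  revert x; induction k as [|k IH].
  - apply cancel_sin.
    + now apply smooth_scal.
    + apply smooth_plus; auto using smooth_mult, smooth_cos.
    + intros x Hx. destruct (fam_0_1 g Hg x Hx) as [E0 E1].
      destruct (fam_0_1 (1 - g) Hg' x Hx) as [_ E1'].
      rewrite E0. simpl INR.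
      replace (sin x * (_ + _)) with
        (sin x * fam (1 - g) 1 x + cos x * (sin x * fam g 1 x)) by ring.
      rewrite E1, E1'. replace ((1 - g) * x) with (x - g * x) by ring.
      rewrite sin_minus. field; lra.
  - apply cancel_sin.
    + now apply smooth_scal.
    + apply smooth_plus; auto using smooth_mult, smooth_cos.
    + intros x Hx. pose proof (Derive_ext_J _ _ IH x Hx) as D.
      rewrite Derive_scal, Derive_plus, Derive_mult, !Derive_fam, Derive_cos in D; auto.
      * rewrite S_INR. lra.
      * apply ex_derive_cos.
      * now apply smooth_ex_derive.
      * now apply smooth_ex_derive.
      * apply smooth_ex_derive; auto using smooth_mult, smooth_cos.
Qed.

End Contiguity.

Section Raising.

Variable g : R.
Hypothesis Hg : 0 < g < 1.

(** The relations [fam_lower] for [g] and for [1 - g] form a linear system in the functions of index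
    [S k], with determinant [sin ^ 2] up to sign. *)
Lemma fam_raise (k : nat) (x : R) : J x ->
  sin x * sin x * fam g (S k) x
    = (INR k - 1 + g) * fam (1 - g) k x - (INR k - g) * cos x * fam g k x.
Proof.
  intros Hx. pose proof (fam_lower g Hg k x Hx) as L1.
  assert (Hg' : 0 < 1 - g < 1) by lra.
  pose proof (fam_lower (1 - g) Hg' k x Hx) as L2.
  replace (1 - (1 - g)) with g in L2 by ring.
  replace ((INR k - 1 + g) * fam (1 - g) k x) with ((INR k - (1 - g)) * fam (1 - g) k x) by ring.
  replace ((INR k - g) * cos x * fam g k x) with (cos x * ((INR k - g) * fam g k x)) by ring.
  rewrite L1, L2. pose proof (sin2_cos2 x) as H. unfold Rsqr in H.
  replace (sin x * sin x) with (1 - cos x * cos x) by lra. ring.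
Qed.

(** Trades the factor [cos] for a factor [sin ^ 2], which the spans [Psi] can absorb; [fam_dual]
    does the same for the passage from [1 - g] to [g]. *)
Lemma cos_fam (k : nat) (x : R) : J x ->
  cos x * fam g (S k) x
    = (INR k + g) * (INR k - g) / (2 * INR k + 1) * fam g k x
      - / (2 * INR k + 1) * (sin x * sin x * fam g (S (S k)) x).
Proof.
  intros Hx. pose proof (fam_lower g Hg k x Hx) as L.
  pose proof (fam_raise (S k) x Hx) as U. rewrite S_INR in U.
  pose proof (pos_INR k). rewrite U.
  replace ((INR k + g) * (INR k - g) / (2 * INR k + 1) * fam g k x)
    with ((INR k + g) / (2 * INR k + 1) * ((INR k - g) * fam g k x)) by (field; lra).
  rewrite L. field. lra.
Qed.

Lemma fam_dual (k : nat) (x : R) : J x ->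
  fam (1 - g) (S k) x
    = (INR k + 1 - g) * (INR k - g) / (2 * INR k + 1) * fam g k x
      + / (2 * INR k + 1) * (sin x * sin x * fam g (S (S k)) x).
Proof.
  intros Hx. pose proof (fam_lower g Hg k x Hx) as L.
  pose proof (cos_fam k x Hx) as C. pose proof (pos_INR k).
  replace (fam (1 - g) (S k) x) with ((INR k - g) * fam g k x - cos x * fam g (S k) x) by lra.
  rewrite C. field. lra.
Qed.

(** The Gegenbauer equation in every index, read off from the contiguity relations instead of the
    series. *)
Lemma fam_ODE (k : nat) (x : R) : J x ->
  sin x * sin x * fam g (S (S k)) x + (2 * INR k + 1) * cos x * fam g (S k) x
    = (INR k * INR k - g * g) * fam g k x.
Proof.
  intros Hx. pose proof (pos_INR k).
  replace ((2 * INR k + 1) * cos x * fam g (S k) x)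
    with ((2 * INR k + 1) * (cos x * fam g (S k) x)) by ring.
  rewrite (cos_fam k x Hx). field. lra.
Qed.

End Raising.

(** * A Chebyshev system *)

(** [Psi g k m] is the span of the functions [sin ^ j * fam g (k + j)], [j <= m]. *)
Fixpoint Psi (g : R) (k m : nat) (f : R -> R) : Prop :=
  match m with
  | O => exists c, forall x, J x -> f x = c * fam g k x
  | S m => exists c f1, Psi g (S k) m f1 /\ forall x, J x -> f x = c * fam g k x + sin x * f1 x
  end.

Lemma zeros_exists (f : R -> R) (lo : R) (m : nat) :
  zeros f lo (S m) -> exists a, J a /\ f a = 0.
Proof.
  remember (S m) as n eqn:E. intros Z. revert m E.
  induction Z as [|lo a n m' Hlo Ha Ho Z IH]; intros m E; [ discriminate | ].
  destruct n as [|n]; [ now apply (IH m) | ].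
  exists a; split; auto. apply Ho.
Qed.

Lemma cancel_sin_pow (n : nat) (f : R -> R) : smooth f ->
  (forall x, J x -> sin x ^ n * f x = 0) -> forall x, J x -> f x = 0.
Proof.
  intros F. induction n as [|n IH]; intros E x Hx.
  - specialize (E x Hx). simpl in E. lra.
  - apply IH; auto. intros y Hy.
    apply (cancel_sin (fun x => sin x ^ n * f x) (fun _ => 0)); auto using smooth_const.
    + apply smooth_mult; auto using smooth_pow, smooth_sin.
    + intros t Ht. rewrite Rmult_0_r, <- (E t Ht). simpl; ring.
Qed.

Section Span.

Variable g : R.
Hypothesis Hg : 0 < g < 1.

Lemma Psi_ext (k m : nat) (f h : R -> R) :
  (forall x, J x -> f x = h x) -> Psi g k m f -> Psi g k m h.
Proof.
  intros E; destruct m as [|m]; simpl.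
  - intros [c H]; exists c. intros x Hx; rewrite <- E; auto.
  - intros (c & f1 & H1 & H); exists c, f1; split; auto.
    intros x Hx; rewrite <- E; auto.
Qed.

Lemma Psi_smooth (m : nat) : forall (k : nat) (f : R -> R), Psi g k m f -> smooth f.
Proof.
  induction m as [|m IH]; simpl; intros k f.
  - intros [c H]. apply smooth_ext with (fun x => c * fam g k x).
    + intros; now rewrite H.
    + now apply smooth_scal, smooth_fam.
  - intros (c & f1 & H1 & H). apply smooth_ext with (fun x => c * fam g k x + sin x * f1 x).
    + intros; now rewrite H.
    + apply smooth_plus; eauto using smooth_mult, smooth_sin, smooth_scal, smooth_fam.
Qed.

Lemma Psi_lin (m : nat) : forall (k : nat) (a b : R) (f h : R -> R),
  Psi g k m f -> Psi g k m h -> Psi g k m (fun x => a * f x + b * h x).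
Proof.
  induction m as [|m IH]; simpl; intros k a b f h.
  - intros [c H] [c' H']. exists (a * c + b * c'). intros x Hx. rewrite H, H' by auto. ring.
  - intros (c & f1 & H1 & H) (c' & f1' & H1' & H').
    exists (a * c + b * c'), (fun x => a * f1 x + b * f1' x); split; auto.
    intros x Hx. rewrite H, H' by auto. ring.
Qed.

Lemma Psi_0 (m : nat) : forall k, Psi g k m (fun _ => 0).
Proof.
  induction m as [|m IH]; intros k; simpl.
  - exists 0; intros; ring.
  - exists 0, (fun _ => 0); split; auto. intros; ring.
Qed.

Lemma Psi_scal (k m : nat) (a : R) (f : R -> R) : Psi g k m f -> Psi g k m (fun x => a * f x).
Proof.
  intros H. apply Psi_ext with (fun x => a * f x + 0 * 0).
  - intros; ring.
  - apply (Psi_lin m k a 0 f (fun _ => 0)); auto using Psi_0.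
Qed.

Lemma Psi_plus (k m : nat) (f h : R -> R) :
  Psi g k m f -> Psi g k m h -> Psi g k m (fun x => f x + h x).
Proof.
  intros F H. apply Psi_ext with (fun x => 1 * f x + 1 * h x).
  - intros; ring.
  - now apply Psi_lin.
Qed.

Lemma Psi_S (m : nat) : forall (k : nat) (f : R -> R), Psi g k m f -> Psi g k (S m) f.
Proof.
  induction m as [|m IH]; intros k f.
  - intros [c H]. exists c, (fun _ => 0); split; [ apply (Psi_0 0) | ].
    intros x Hx; rewrite H; auto; ring.
  - intros (c & f1 & H1 & H). exists c, f1; split; auto.
Qed.

Lemma Psi_le (m m' k : nat) (f : R -> R) : (m <= m')%nat -> Psi g k m f -> Psi g k m' f.
Proof. induction 1; auto using Psi_S. Qed.

Lemma Psi_sin (k m : nat) (f : R -> R) : Psi g (S k) m f -> Psi g k (S m) (fun x => sin x * f x).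
Proof. intros H. exists 0, f; split; auto. intros; ring. Qed.

Lemma Psi_fam (k : nat) : Psi g k 0 (fam g k).
Proof. exists 1. intros; ring. Qed.

Lemma Psi_fam_2 (k m : nat) (a b : R) :
  Psi g k (S (S m)) (fun x => a * fam g k x + b * (sin x * sin x * fam g (S (S k)) x)).
Proof.
  apply Psi_le with 2%nat; [ lia | ].
  apply Psi_lin.
  - apply Psi_le with 0%nat; [ lia | apply Psi_fam ].
  - apply Psi_ext with (fun x => sin x * (sin x * fam g (S (S k)) x)).
    + intros; ring.
    + apply Psi_sin, Psi_sin, Psi_fam.
Qed.

(** By [cos_fam] on each basis function, a factor [cos] costs one base index and two dimensions. *)
Lemma Psi_cos (m : nat) : forall (k : nat) (f : R -> R),
  Psi g (S k) m f -> Psi g k (S (S m)) (fun x => cos x * f x).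
Proof.
  assert (E : forall c k m, Psi g k (S (S m)) (fun x => c * (cos x * fam g (S k) x))).
  { intros c k m'. apply Psi_scal.
    eapply Psi_ext; [ | apply (Psi_fam_2 k m'
      ((INR k + g) * (INR k - g) / (2 * INR k + 1)) (- / (2 * INR k + 1))) ].
    intros x Hx; simpl. rewrite (cos_fam g Hg) by auto. ring. }
  induction m as [|m IH]; intros k f.
  - intros [c H]. eapply Psi_ext; [ | apply (E c k 0%nat) ].
    intros x Hx; simpl. rewrite H by auto. ring.
  - intros (c & f1 & H1 & H).
    apply Psi_ext with (fun x => c * (cos x * fam g (S k) x) + sin x * (cos x * f1 x)).
    + intros x Hx. rewrite H by auto. ring.
    + apply Psi_plus; [ apply E | apply Psi_sin; auto ].
Qed.

Lemma Psi_dual (m : nat) : forall (k : nat) (f : R -> R),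
  Psi (1 - g) (S k) m f -> Psi g k (S (S m)) f.
Proof.
  assert (E : forall c k m, Psi g k (S (S m)) (fun x => c * fam (1 - g) (S k) x)).
  { intros c k m'. apply Psi_scal.
    eapply Psi_ext; [ | apply (Psi_fam_2 k m'
      ((INR k + 1 - g) * (INR k - g) / (2 * INR k + 1)) (/ (2 * INR k + 1))) ].
    intros x Hx; simpl. rewrite (fam_dual g Hg) by auto. ring. }
  induction m as [|m IH]; intros k f.
  - intros [c H]. eapply Psi_ext; [ | apply (E c k 0%nat) ].
    intros x Hx; simpl. now rewrite H by auto.
  - intros (c & f1 & H1 & H).
    apply Psi_ext with (fun x => c * fam (1 - g) (S k) x + sin x * f1 x).
    + intros x Hx. now rewrite H by auto.
    + apply Psi_plus; [ apply E | apply Psi_sin; auto ].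
Qed.

(** Only the first basis function is nonzero at 0, so its coefficient must vanish. *)
Lemma Psi_drop (k m : nat) (f : R -> R) : Psi g k (S m) f -> f 0 = 0 ->
  exists f1, Psi g (S k) m f1 /\ forall x, J x -> f x = sin x * f1 x.
Proof.
  intros (c & f1 & H1 & H) E; exists f1; split; auto.
  assert (N : fam g k 0 <> 0).
  { destruct k as [|k].
    - rewrite fam_at_0 by auto. apply Ropp_neq_0_compat, Rinv_neq_0_compat; lra.
    - pose proof (fam_pos g Hg k 0 J0); lra. }
  rewrite H, sin_0 in E by apply J0.
  assert (C : c * fam g k 0 = 0) by lra. apply Rmult_integral in C.
  destruct C as [C|C]; [ | contradiction ].
  intros x Hx; rewrite H, C by auto; ring.
Qed.

(** The Gegenbauer operator of index [k], multiplied by [sin] to clear its singularity at 0. *)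
Definition op (k : nat) (f : R -> R) (x : R) : R :=
  sin x * Derive (Derive f) x + 2 * INR k * cos x * Derive f x
    - (INR k * INR k - g * g) * (sin x * f x).

Lemma op_ext (k : nat) (f h : R -> R) :
  (forall x, J x -> f x = h x) -> forall x, J x -> op k f x = op k h x.
Proof.
  intros E x Hx. unfold op. rewrite E by auto.
  pose proof (Derive_ext_J f h E) as D.
  now rewrite (D x Hx), (Derive_ext_J _ _ D x Hx).
Qed.

Lemma Derive2_fam (k : nat) (x : R) : J x ->
  Derive (Derive (fam g k)) x = cos x * fam g (S k) x + sin x * (sin x * fam g (S (S k)) x).
Proof.
  intros Hx.
  rewrite (Derive_ext_J _ (fun x => sin x * fam g (S k) x)); auto; try (intros; apply Derive_fam; auto; fail).
  rewrite Derive_mult, Derive_sin, (Derive_fam g Hg); auto using ex_derive_sin.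
  apply smooth_ex_derive; auto using smooth_fam.
Qed.

Lemma op_fam (k : nat) (x : R) : J x -> op k (fam g k) x = 0.
Proof.
  intros Hx. unfold op. rewrite Derive2_fam, (Derive_fam g Hg) by auto.
  pose proof (fam_ODE g Hg k x Hx) as E.
  replace ((INR k * INR k - g * g) * (sin x * fam g k x))
    with (sin x * ((INR k * INR k - g * g) * fam g k x)) by ring.
  rewrite <- E. ring.
Qed.

Lemma Derive2_sin_mult (f : R -> R) (x : R) : smooth f -> J x ->
  Derive (fun x => sin x * f x) x = cos x * f x + sin x * Derive f x /\
  Derive (Derive (fun x => sin x * f x)) x
    = - sin x * f x + 2 * (cos x * Derive f x) + sin x * Derive (Derive f) x.
Proof.
  intros F Hx.
  assert (D : forall x, J x -> Derive (fun x => sin x * f x) x = cos x * f x + sin x * Derive f x).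
  { intros y Hy. rewrite Derive_mult, Derive_sin; auto using ex_derive_sin, smooth_ex_derive. }
  split; auto. rewrite (Derive_ext_J _ _ D) by auto.
  assert (ex_derive f x) by auto using smooth_ex_derive.
  assert (ex_derive (Derive f) x) by auto using smooth_ex_derive, smooth_Derive.
  rewrite Derive_plus, !Derive_mult, Derive_sin, Derive_cos; auto using ex_derive_sin, ex_derive_cos.
  - ring.
  - apply (ex_derive_mult cos f); auto using ex_derive_cos.
  - apply (ex_derive_mult sin (Derive f)); auto using ex_derive_sin.
Qed.

(** The first term is annihilated, and moving [sin] through the operator raises its index, up to a
    multiple of [f]. *)
Lemma op_shift (k : nat) (c : R) (f : R -> R) (x : R) : smooth f -> J x ->
  op k (fun x => c * fam g k x + sin x * f x) x = sin x * op (S k) f x + 2 * INR k * f x.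
Proof.
  intros F Hx.
  assert (SA : smooth (fam g k)) by now apply smooth_fam.
  assert (SF : smooth (fun x => sin x * f x)) by (apply smooth_mult; auto using smooth_sin).
  assert (D1 : forall x, J x -> Derive (fun x => c * fam g k x + sin x * f x) x
    = c * Derive (fam g k) x + Derive (fun x => sin x * f x) x).
  { intros y Hy. rewrite Derive_plus, Derive_scal; auto using smooth_ex_derive.
    apply smooth_ex_derive; auto using smooth_scal. }
  assert (D2 : Derive (Derive (fun x => c * fam g k x + sin x * f x)) x
    = c * Derive (Derive (fam g k)) x + Derive (Derive (fun x => sin x * f x)) x).
  { rewrite (Derive_ext_J _ _ D1) by auto.
    rewrite Derive_plus, Derive_scal; auto using smooth_ex_derive, smooth_Derive.
    apply smooth_ex_derive; auto using smooth_scal, smooth_Derive. }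
  pose proof (op_fam k x Hx) as O. unfold op in *.
  rewrite D1, D2 by auto. destruct (Derive2_sin_mult f x F Hx) as [-> ->].
  rewrite S_INR. pose proof (sin2_cos2 x) as P. unfold Rsqr in P.
  transitivity (c * (sin x * Derive (Derive (fam g k)) x + 2 * INR k * cos x * Derive (fam g k) x
    - (INR k * INR k - g * g) * (sin x * fam g k x))
    + (sin x * (sin x * Derive (Derive f) x + 2 * (INR k + 1) * cos x * Derive f x
        - ((INR k + 1) * (INR k + 1) - g * g) * (sin x * f x))
      + 2 * INR k * f x * (sin x * sin x + cos x * cos x))).
  - ring.
  - rewrite O, P. ring.
Qed.

(** The parameter [t] absorbs the terms [2 * INR k] that [op_shift] produces at every level of the
    recursion. *)
Lemma Psi_op_self (m : nat) : forall (k : nat) (t : R) (f : R -> R),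
  Psi g k m f -> Psi g k m (fun x => sin x * op k f x + t * f x).
Proof.
  induction m as [|m IH]; intros k t f.
  - intros [c H]. exists (t * c). intros x Hx.
    assert (E : forall x, J x -> f x = c * fam g k x + sin x * 0) by (intros; rewrite H; auto; ring).
    rewrite (op_ext k _ _ E x Hx), (op_shift k c (fun _ => 0)) by auto using smooth_const.
    assert (Z : op (S k) (fun _ => 0) x = 0).
    { unfold op. rewrite (Derive_ext_J _ (fun _ => 0)); auto.
      - rewrite !Derive_const. ring.
      - intros; now rewrite Derive_const. }
    rewrite Z, H by auto. ring.
  - intros (c & f1 & H1 & H). pose proof (Psi_smooth _ _ _ H1) as S1.
    exists (t * c), (fun x => sin x * op (S k) f1 x + (2 * INR k + t) * f1 x); split; auto.
    intros x Hx. rewrite (op_ext k _ _ H x Hx), op_shift, H by auto. ring.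
Qed.

Lemma Psi_op (k m : nat) (f : R -> R) : Psi g k (S m) f -> Psi g (S k) m (op k f).
Proof.
  intros (c & f1 & H1 & H). pose proof (Psi_smooth _ _ _ H1) as S1.
  eapply Psi_ext; [ | apply (Psi_op_self m (S k) (2 * INR k) f1 H1) ].
  intros x Hx; simpl. now rewrite (op_ext k _ _ H x Hx), op_shift by auto.
Qed.

Definition wronskian (k : nat) (f : R -> R) (x : R) : R :=
  fam g k x * Derive f x - Derive (fam g k) x * f x.

Lemma smooth_wronskian (k : nat) (f : R -> R) : smooth f -> smooth (wronskian k f).
Proof.
  intros F. pose proof (smooth_fam g Hg k). unfold wronskian.
  apply smooth_minus; auto using smooth_mult, smooth_Derive.
Qed.

(** Lagrange's identity: [sin ^ (2 * k)] is the integrating factor of [op k], and [op k] annihilates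
    [fam g k]. *)
Lemma pivot_wronskian (k : nat) (f : R -> R) (x : R) : smooth f -> J x ->
  pivot (2 * k) (wronskian k f) x = fam g k x * op k f x.
Proof.
  intros F Hx. pose proof (smooth_fam g Hg k) as SA. unfold pivot, wronskian.
  rewrite Derive_minus, !Derive_mult; auto using smooth_ex_derive, smooth_Derive;
    try (apply smooth_ex_derive; auto using smooth_mult, smooth_Derive; fail).
  rewrite mult_INR. change (INR 2) with (1 + 1).
  pose proof (op_fam k x Hx) as O. unfold op in *.
  transitivity (fam g k x * (sin x * Derive (Derive f) x + 2 * INR k * cos x * Derive f x
      - (INR k * INR k - g * g) * (sin x * f x))
    - f x * (sin x * Derive (Derive (fam g k)) x + 2 * INR k * cos x * Derive (fam g k) x
      - (INR k * INR k - g * g) * (sin x * fam g k x))).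
  - ring.
  - rewrite O. ring.
Qed.

Lemma Derive_ratio (k : nat) (f : R -> R) (x : R) : smooth f -> J x ->
  Derive (fun x => / fam g (S k) x * f x) x
    = / fam g (S k) x * / fam g (S k) x * wronskian (S k) f x.
Proof.
  intros F Hx. pose proof (smooth_fam g Hg (S k)) as SA.
  pose proof (fam_pos g Hg k x Hx). unfold wronskian.
  assert (ex_derive (fam g (S k)) x) by now apply smooth_ex_derive.
  rewrite Derive_mult, Derive_inv; auto using smooth_ex_derive; try lra.
  - field. lra.
  - apply (ex_derive_inv (fam g (S k))); auto; lra.
Qed.

(** Dividing by [fam g (S k)] and differentiating loses one zero, [pivot] loses
    none, and together they annihilate the first basis function. *)
Theorem Psi_Chebyshev (m : nat) : forall (k : nat) (f : R -> R),
  Psi g (S k) m f -> zeros f (- PI) (S m) -> forall x, J x -> f x = 0.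
Proof.
  induction m as [|m IH]; intros k f P Z.
  - destruct P as [c H].
    destruct (zeros_exists _ _ _ Z) as [a [Ja Fa]].
    rewrite H in Fa by auto. pose proof (fam_pos g Hg k a Ja).
    assert (c = 0) as -> by nra. intros x Hx; rewrite H by auto; ring.
  - pose proof (Psi_smooth _ _ _ P) as F.
    pose proof (smooth_fam g Hg (S k)) as SA.
    assert (NZ : forall x, J x -> fam g (S k) x <> 0)
      by (intros x Hx; pose proof (fam_pos g Hg k x Hx); lra).
    pose proof (smooth_inv _ SA NZ) as SI.
    set (q := fun x => / fam g (S k) x * f x).
    assert (SQ : smooth q) by (apply smooth_mult; auto).
    pose proof (smooth_wronskian (S k) f F) as SW.
    assert (Zq : zeros q (- PI) (S (S m))).
    { revert Z; apply zeros_impl. intros n a Ha. now apply ord_mult. }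
    assert (Zw : zeros (wronskian (S k) f) (- PI) (S m)).
    { generalize (zeros_Derive q (- PI) (S m) SQ Zq). apply zeros_impl.
      intros n a Ha Ho. apply ord_cancel with (fun x => / fam g (S k) x * / fam g (S k) x);
        auto using smooth_mult.
      - apply Rmult_integral_contrapositive; split; apply Rinv_neq_0_compat; auto.
      - apply ord_ext with (Derive q); auto. intros t Ht. exact (Derive_ratio k f t F Ht). }
    assert (Zo : zeros (op (S k) f) (- PI) (S m)).
    { replace (2 * S k)%nat with (S (S (2 * k))) in * by lia.
      generalize (zeros_pivot (S (2 * k)) (wronskian (S k) f) SW (- PI) (S m) (Rle_refl _) Zw).
      apply zeros_impl. intros n a Ha Ho.
      assert (So : smooth (op (S k) f)) by (eapply Psi_smooth, Psi_op, P).
      apply ord_cancel with (fam g (S k)); auto.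
      eapply ord_ext; [ | auto | exact Ho ].
      intros x Hx; simpl. rewrite <- pivot_wronskian by auto.
      now replace (2 * S k)%nat with (S (S (2 * k))) by lia. }
    pose proof (IH (S k) _ (Psi_op (S k) m f P) Zo) as O.
    (* As [op (S k) f = 0], the product of [sin ^ (2 * S k)] and the Wronskian is constant, and it
       is zero at 0. Hence [f] is a multiple of [fam g (S k)], which has no zeros. *)
    assert (W : forall x, J x -> wronskian (S k) f x = 0).
    { apply (cancel_sin_pow (S (S (2 * k)))); auto.
      set (h := fun x => sin x ^ S (S (2 * k)) * wronskian (S k) f x).
      assert (Sh : smooth h) by (apply smooth_mult; auto using smooth_pow, smooth_sin).
      intros x Hx. change (h x = 0). rewrite (const_of_Derive_0 h); auto.
      - unfold h. rewrite sin_0. simpl; ring.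
      - intros y Hy. unfold h. rewrite Derive_sin_pow_mult by auto.
        replace (S (S (2 * k))) with (2 * S k)%nat by lia.
        rewrite pivot_wronskian, O by auto. ring. }
    destruct (zeros_exists _ _ _ Z) as [a [Ja Fa]].
    intros x Hx. apply Rmult_eq_reg_l with (/ fam g (S k) x); [ | now apply Rinv_neq_0_compat, NZ ].
    change (q x = / fam g (S k) x * 0). rewrite Rmult_0_r.
    assert (C : forall x, J x -> q x = q 0).
    { apply const_of_Derive_0; auto. intros y Hy. unfold q.
      rewrite Derive_ratio, W by auto. ring. }
    rewrite C, <- (C a) by auto. unfold q. rewrite Fa; ring.
Qed.

End Span.

Lemma same_sign_interval (q : R -> R) (a b : R) :
  smooth q -> J a -> J b -> a <= b -> (forall y, a <= y <= b -> q y <> 0) -> 0 < q a * q b.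
Proof.
  intros Q Ja Jb Hab H.
  destruct Hab as [Hab| <-]; [ | specialize (H a ltac:(lra)); nra ].
  assert (Na : q a <> 0) by (apply H; lra). assert (Nb : q b <> 0) by (apply H; lra).
  assert (C : forall h, smooth h -> forall x, a <= x <= b -> continuity_pt h x).
  { intros h Sh x Hx. apply continuity_pt_filterlim, smooth_continuous; auto. unfold J in *; lra. }
  destruct (Rlt_le_dec 0 (q a * q b)) as [|Hle]; auto. exfalso.
  destruct (Rlt_le_dec (q a) 0) as [La|La].
  - destruct (IVT_interv q a b) as [z [Hz Ez]]; auto; try nra.
    + assert (0 < q b) by (destruct (Rtotal_order (q b) 0) as [|[|]]; nra). auto.
    + now apply (H z).
  - assert (q b < 0) by (destruct (Rtotal_order (q b) 0) as [|[|]]; nra).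
    destruct (IVT_interv (fun x => -1 * q x) a b) as [z [Hz Ez]]; auto using smooth_scal; try nra.
    apply (H z); auto. lra.
Qed.

(** * Constant sign between the two outer zeros *)

Section SignTransfer.

Variables (k l : nat) (x1 x2 : R).
Hypotheses (J1 : J x1) (J2 : J x2) (Hx1 : x1 < 0) (Hx2 : 0 < x2).

(** The prescribed orders already use up the [k + l] zeros that the Chebyshev property allows. *)
Lemma Psi_no_more_zeros (g : R) (q : nat) (f : R -> R) : 0 < g < 1 ->
  Psi g (S q) (k + l) f -> ord k f x1 -> ord l f x2 -> ~ (forall x, J x -> f x = 0) ->
  (forall y, x1 < y < x2 -> f y <> 0) /\ ~ ord (S k) f x1 /\ ~ ord (S l) f x2.
Proof.
  intros Hg Pf O1 O2 NZ.
  assert (Ch : ~ zeros f (- PI) (S (k + l))).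
  { intros Z. apply NZ. now apply (Psi_Chebyshev g Hg (k + l) q). }
  unfold J in J1, J2.
  repeat split.
  - intros y Hy Ey. apply Ch.
    replace (S (k + l)) with (k + (1 + (l + 0)))%nat by lia.
    apply zeros_cons with x1; auto; try lra.
    apply zeros_cons with y; try lra; [ unfold J; lra | simpl; auto | ].
    apply zeros_cons with x2; auto; try lra. constructor.
  - intros O. apply Ch. replace (S (k + l)) with (S k + (l + 0))%nat by lia.
    apply zeros_cons with x1; auto; try lra.
    apply zeros_cons with x2; auto; try lra. constructor.
  - intros O. apply Ch. replace (S (k + l)) with (k + (S l + 0))%nat by lia.
    apply zeros_cons with x1; auto; try lra.
    apply zeros_cons with x2; auto; try lra. constructor.
Qed.

(** The leading coefficients [u] of [f] and [v] of [h] at [a] satisfy [u = - r * v], so [f * h * r]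
    is negative close to [a]. *)
Lemma end_sign (a r : R) (n : nat) (f h : R -> R) :
  smooth f -> smooth h -> J a -> a = x1 \/ a = x2 -> ord n f a -> ord n h a ->
  ~ ord (S n) f a -> ~ ord (S n) h a -> ord (S n) (fun x => f x + r * h x) a ->
  exists y, x1 < y < x2 /\ f y * h y * r < 0.
Proof.
  intros F H Ja Ha Of Oh Nf Nh Ofh.
  destruct (ord_lead _ _ _ Of) as [u Lu]. destruct (ord_lead _ _ _ Oh) as [v Lv].
  rewrite (lead_ord_S _ _ _ _ Lu) in Nf. rewrite (lead_ord_S _ _ _ _ Lv) in Nh.
  assert (L : lead n (fun x => f x + r * h x) a (u + r * v)).
  { apply lead_plus; auto using smooth_scal. apply lead_mult; auto using smooth_const. }
  apply (lead_ord_S _ _ _ _ L) in Ofh.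
  destruct (lead_sign n f a u F Ja Lu Nf) as [d1 [Hd1 S1]].
  destruct (lead_sign n h a v H Ja Lv Nh) as [d2 [Hd2 S2]].
  assert (exists y, x1 < y < x2 /\ y <> a /\ Rabs (y - a) < d1 /\ Rabs (y - a) < d2)
    as [y (Hy & Hya & Y1 & Y2)].
  { set (d := Rmin (Rmin d1 d2) (x2 - x1)).
    assert (0 < d) by (unfold d; repeat apply Rmin_pos; lra).
    assert (d <= d1) by (unfold d; eapply Rle_trans; [ apply Rmin_l | apply Rmin_l ]).
    assert (d <= d2) by (unfold d; eapply Rle_trans; [ apply Rmin_l | apply Rmin_r ]).
    assert (d <= x2 - x1) by apply Rmin_r.
    destruct Ha as [-> | ->].
    - exists (x1 + d / 2). replace (x1 + d / 2 - x1) with (d / 2) by ring.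
      rewrite Rabs_right by lra. repeat split; lra.
    - exists (x2 - d / 2). replace (x2 - d / 2 - x2) with (- (d / 2)) by ring.
      rewrite Rabs_Ropp, Rabs_right by lra. repeat split; lra. }
  exists y; split; auto.
  specialize (S1 y Hya Y1). specialize (S2 y Hya Y2).
  set (X := (y - a) ^ n) in *.
  assert (u = - (r * v)) as -> by lra.
  assert (0 < (f y * - (r * v) * X) * (h y * v * X)) by now apply Rmult_lt_0_compat.
  assert (NX : X <> 0) by (apply pow_nonzero; lra).
  assert (K : 0 < (v * X) * (v * X))
    by (apply Rsqr_pos_lt, Rmult_integral_contrapositive; auto).
  set (K0 := (v * X) * (v * X)) in *.
  assert (E : 0 < - (f y * h y * r) * K0) by (unfold K0; lra).
  clearbody K0. nra.
Qed.

(** [- r1], [- r2] and [- r3] are the values of [f / h] at [x1], [x2] and 0, as limits at the ends,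
    and [f * h] has no zero in between. *)
Theorem sign_transfer (g : R) (q : nat) (f h : R -> R) (r1 r2 r3 : R) : 0 < g < 1 ->
  Psi g (S q) (k + l) f -> Psi (1 - g) (S q) (k + l) h ->
  ord k f x1 -> ord l f x2 -> ord k h x1 -> ord l h x2 ->
  ~ (forall x, J x -> f x = 0 /\ h x = 0) -> r1 <> 0 ->
  ord (S k) (fun x => f x + r1 * h x) x1 ->
  ord (S l) (fun x => f x + r2 * h x) x2 ->
  f 0 + r3 * h 0 = 0 ->
  0 < r1 * r3 /\ 0 < r2 * r3.
Proof.
  intros Hg Pf Ph Of1 Of2 Oh1 Oh2 NZ Hr1 O1 O2 O3.
  assert (Hg' : 0 < 1 - g < 1) by lra.
  pose proof (Psi_smooth g Hg _ _ _ Pf) as F. pose proof (Psi_smooth (1 - g) Hg' _ _ _ Ph) as H.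
  (* If [f] vanished identically, [r1 <> 0] would give [h] a zero of order [S k] at [x1], one too
     many. *)
  assert (NF : ~ (forall x, J x -> f x = 0)).
  { intros Zf. apply NZ. intros x Hx; split; auto. revert x Hx.
    apply Classical_Prop.NNPP; intros Zh.
    destruct (Psi_no_more_zeros (1 - g) q h) as (_ & N & _); auto.
    apply N. apply ord_cancel with (fun _ => r1); auto using smooth_const.
    apply ord_ext with (fun x => f x + r1 * h x); auto. intros x Hx; rewrite Zf; auto; ring. }
  assert (NH : ~ (forall x, J x -> h x = 0)).
  { intros Zh. destruct (Psi_no_more_zeros g q f) as (_ & N & _); auto.
    apply N. apply ord_ext with (fun x => f x + r1 * h x); auto.
    intros x Hx; rewrite Zh; auto; ring. }
  destruct (Psi_no_more_zeros g q f) as (NF0 & NF1 & NF2); auto.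
  destruct (Psi_no_more_zeros (1 - g) q h) as (NH0 & NH1 & NH2); auto.
  set (p := fun x => f x * h x).
  assert (Sp : smooth p) by now apply smooth_mult.
  assert (SG : forall y, x1 < y < x2 -> 0 < p y * p 0).
  { intros y Hy. unfold J in J1, J2.
    assert (Np : forall z, x1 < z < x2 -> p z <> 0).
    { intros z Hz. apply Rmult_integral_contrapositive; auto. }
    destruct (Rle_lt_dec y 0).
    - apply same_sign_interval; auto using J0; [ unfold J; lra | intros; apply Np; lra ].
    - rewrite Rmult_comm.
      apply same_sign_interval; auto using J0; [ unfold J; lra | lra | intros; apply Np; lra ]. }
  assert (E3 : p 0 * r3 < 0).
  { unfold p. pose proof (NH0 0 ltac:(lra)). replace (f 0) with (- (r3 * h 0)) by lra.
    pose proof (NF0 0 ltac:(lra)) as N0. replace (f 0) with (- (r3 * h 0)) in N0 by lra.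
    assert (0 < (r3 * h 0) * (r3 * h 0)) by (apply Rsqr_pos_lt; lra). nra. }
  assert (FIN : forall r, (exists y, x1 < y < x2 /\ f y * h y * r < 0) -> 0 < r * r3).
  { intros r [y [Hy Er]]. specialize (SG y Hy). fold (p y) in Er.
    assert (0 < (p y * r) * (p 0 * r3)) by nra.
    assert (0 < (p y * p 0) * (r * r3)) by lra.
    destruct (Rlt_le_dec 0 (r * r3)); auto. nra. }
  split; apply FIN.
  - apply (end_sign x1 r1 k); auto.
  - apply (end_sign x2 r2 l); auto.
Qed.

End SignTransfer.

(** * Edge factorisation and the axes *)

Lemma C_ext (a b : C) : fst a = fst b -> snd a = snd b -> a = b.
Proof. destruct a, b; simpl; congruence. Qed.

Lemma expi_plus (a b : R) : expi (a + b) = Cmult (expi a) (expi b).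
Proof. apply C_ext; simpl; [ rewrite cos_plus | rewrite sin_plus ]; ring. Qed.

Lemma expi_0 : expi 0 = RtoC 1.
Proof. apply C_ext; simpl; [ apply cos_0 | apply sin_0 ]. Qed.

Lemma expi_inv_l (a : R) : Cmult (expi (- a)) (expi a) = RtoC 1.
Proof. rewrite <- expi_plus, Rplus_opp_l. apply expi_0. Qed.

Lemma expi_inv_r (a : R) : Cmult (expi a) (expi (- a)) = RtoC 1.
Proof. rewrite <- expi_plus, Rplus_opp_r. apply expi_0. Qed.

Lemma expi_neq_0 (a : R) : expi a <> RtoC 0.
Proof.
  intros H. pose proof (expi_inv_l a) as E. rewrite H, Cmult_0_r in E.
  injection E; lra.
Qed.

Lemma Cconj_expi (a : R) : Cconj (expi a) = expi (- a).
Proof. apply C_ext; simpl; [ now rewrite cos_neg | now rewrite sin_neg ]. Qed.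

Lemma Cconj_RtoC (a : R) : Cconj (RtoC a) = RtoC a.
Proof. apply C_ext; simpl; ring. Qed.

Lemma Cconj_plus (a b : C) : Cconj (Cplus a b) = Cplus (Cconj a) (Cconj b).
Proof. apply C_ext; simpl; ring. Qed.

Lemma Cconj_opp (a : C) : Cconj (Copp a) = Copp (Cconj a).
Proof. apply C_ext; simpl; ring. Qed.

Lemma Cconj_minus (a b : C) : Cconj (Cminus a b) = Cminus (Cconj a) (Cconj b).
Proof. apply C_ext; simpl; ring. Qed.

Lemma Cconj_mult (a b : C) : Cconj (Cmult a b) = Cmult (Cconj a) (Cconj b).
Proof. apply C_ext; simpl; ring. Qed.

Lemma Cmult_eq_reg_l (c a b : C) : c <> RtoC 0 -> Cmult c a = Cmult c b -> a = b.
Proof.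
  intros H E. replace a with (Cmult (Cinv c) (Cmult c a)) by (field; auto).
  rewrite E. field; auto.
Qed.

Lemma Cmult_integral (a b : C) : Cmult a b = RtoC 0 -> a = RtoC 0 \/ b = RtoC 0.
Proof.
  intros H. destruct (Ceq_dec a (RtoC 0)) as [E|N]; auto.
  right. apply Cmult_eq_reg_l with a; auto. rewrite H. ring.
Qed.

(** * The lattice octant and path-independent transport *)

Inductive dir : Set := D1 | D2 | D3.

(** Points of [Q] with the third coordinate negated, so that every direction adds 1 to a natural
    number. *)
Definition vert : Type := (nat * nat * nat)%type.

Definition sh (d : dir) (v : vert) : vert :=
  let '(k, l, n) := v in
  match d with D1 => (S k, l, n) | D2 => (k, S l, n) | D3 => (k, l, S n) end.

Definition cnt (d : dir) (v : vert) : nat :=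
  let '(k, l, n) := v in match d with D1 => k | D2 => l | D3 => n end.

Definition lev (v : vert) : nat := let '(k, l, n) := v in (k + l + n)%nat.

Definition origin : vert := (0, 0, 0)%nat.

Definition ax (d : dir) (j : nat) : vert :=
  match d with D1 => (j, 0, 0)%nat | D2 => (0, j, 0)%nat | D3 => (0, 0, j)%nat end.

Lemma sh_comm (d e : dir) (v : vert) : sh d (sh e v) = sh e (sh d v).
Proof. destruct v as [[k l] n], d, e; reflexivity. Qed.

Lemma lev_sh (d : dir) (v : vert) : lev (sh d v) = S (lev v).
Proof. destruct v as [[k l] n], d; simpl; lia. Qed.

Lemma sh_ax (d : dir) (j : nat) : sh d (ax d j) = ax d (S j).
Proof. destruct d; reflexivity. Qed.

Lemma lev_ax (d : dir) (j : nat) : lev (ax d j) = j.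
Proof. destruct d; simpl; lia. Qed.

Lemma vert_cases (v : vert) :
  (exists d j, v = ax d j) \/ (exists d e v', d <> e /\ v = sh d (sh e v')).
Proof.
  destruct v as [[[|k] [|l]] [|n]].
  - left; now exists D1, 0%nat.
  - left; now exists D3, (S n).
  - left; now exists D2, (S l).
  - right; exists D2, D3, (0, l, n)%nat; split; [ discriminate | reflexivity ].
  - left; now exists D1, (S k).
  - right; exists D1, D3, (k, 0, n)%nat; split; [ discriminate | reflexivity ].
  - right; exists D1, D2, (k, l, 0)%nat; split; [ discriminate | reflexivity ].
  - right; exists D1, D2, (k, l, S n)%nat; split; [ discriminate | reflexivity ].
Qed.

Lemma vert_ind_sh (P : vert -> Prop) :
  P origin -> (forall d v, P v -> P (sh d v)) -> forall v, P v.
Proof.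
  intros H0 HS [[k l] n].
  induction k as [|k IH]; [ | exact (HS D1 (k, l, n) IH) ].
  induction l as [|l IH]; [ | exact (HS D2 (0, l, n)%nat IH) ].
  induction n as [|n IH]; [ exact H0 | exact (HS D3 (0, 0, n)%nat IH) ].
Qed.

Section Flat.

Variables (X : Type) (St : dir -> vert -> X -> X) (x0 : X).

(** Transport along one chosen path, in direction [D3], then [D2], then [D1]; by [sec_sh], steps
    that commute on each face make the choice irrelevant. [Inv] confines the commutation to
    nondegenerate values. *)
Fixpoint sec3 (n : nat) : X :=
  match n with O => x0 | S n => St D3 (0, 0, n)%nat (sec3 n) end.

Fixpoint sec2 (l n : nat) : X :=
  match l with O => sec3 n | S l => St D2 (0, l, n)%nat (sec2 l n) end.

Fixpoint sec1 (k l n : nat) : X :=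
  match k with O => sec2 l n | S k => St D1 (k, l, n)%nat (sec1 k l n) end.

Definition sec (v : vert) : X := let '(k, l, n) := v in sec1 k l n.

Variable Inv : X -> Prop.
Hypothesis Inv0 : Inv x0.
Hypothesis InvS : forall d v x, Inv x -> Inv (St d v x).
Hypothesis comm : forall d e v x, d <> e -> Inv x ->
  St d (sh e v) (St e v x) = St e (sh d v) (St d v x).

Lemma sec_Inv (v : vert) : Inv (sec v).
Proof.
  destruct v as [[k l] n]; simpl.
  induction k as [|k IH]; simpl; auto.
  induction l as [|l IH]; simpl; auto.
  induction n as [|n IH]; simpl; auto.
Qed.

Lemma sec_sh (d : dir) (v : vert) : sec (sh d v) = St d v (sec v).
Proof.
  destruct v as [[k l] n]; destruct d; [ reflexivity | | ].
  - induction k as [|k IH]; [ reflexivity | ].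
    transitivity (St D1 (k, S l, n) (sec (k, S l, n))); [ reflexivity | ].
    change (k, S l, n) with (sh D2 (k, l, n)). rewrite IH.
    apply comm; [ discriminate | apply (sec_Inv (k, l, n)) ].
  - induction k as [|k IH].
    + induction l as [|l IH]; [ reflexivity | ].
      transitivity (St D2 (0, l, S n)%nat (sec (0, l, S n)%nat)); [ reflexivity | ].
      change (0, l, S n)%nat with (sh D3 (0, l, n)%nat). rewrite IH.
      apply comm; [ discriminate | apply (sec_Inv (0, l, n)%nat) ].
    + transitivity (St D1 (k, l, S n) (sec (k, l, S n))); [ reflexivity | ].
      change (k, l, S n) with (sh D3 (k, l, n)). rewrite IH.
      apply comm; [ discriminate | apply (sec_Inv (k, l, n)) ].
Qed.

End Flat.

(** The factor at the end of an edge is the edge divided by [th d] and by the factor at its start;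
    the cross-ratio equation of a face says exactly that its two paths agree. *)
Lemma exists_edge_factor (Z : vert -> C) (th : dir -> C) :
  (forall d, th d <> RtoC 0) ->
  (forall d v, Cminus (Z (sh d v)) (Z v) <> RtoC 0) ->
  (forall d e v, d <> e ->
    Cmult (Cmult (th e) (th e))
      (Cmult (Cminus (Z (sh d v)) (Z v)) (Cminus (Z (sh d (sh e v))) (Z (sh e v))))
    = Cmult (Cmult (th d) (th d))
      (Cmult (Cminus (Z (sh e v)) (Z v)) (Cminus (Z (sh e (sh d v))) (Z (sh d v))))) ->
  exists w : vert -> C, w origin = RtoC 1 /\ (forall v, w v <> RtoC 0) /\
    forall d v, Cminus (Z (sh d v)) (Z v) = Cmult (th d) (Cmult (w v) (w (sh d v))).
Proof.
  intros Hth Hnz Hcr.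
  set (St := fun d v x => Cdiv (Cdiv (Cminus (Z (sh d v)) (Z v)) (th d)) x).
  set (Inv := fun x : C => x <> RtoC 0).
  assert (I0 : Inv (RtoC 1)) by (intros E; injection E; lra).
  assert (nzd : forall a b : C, a <> RtoC 0 -> b <> RtoC 0 -> Cdiv a b <> RtoC 0).
  { intros a b Ha Hb E. apply Ha. replace a with (Cmult (Cdiv a b) b) by (field; auto).
    rewrite E; ring. }
  assert (IS : forall d v x, Inv x -> Inv (St d v x)) by (intros; unfold Inv, St; auto).
  assert (CM : forall d e v x, d <> e -> Inv x ->
    St d (sh e v) (St e v x) = St e (sh d v) (St d v x)).
  { intros d e v x Hde Hx. unfold St. specialize (Hcr d e v Hde).
    pose proof (Hnz d v) as N1; pose proof (Hnz e v) as N2.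
    pose proof (Hth d); pose proof (Hth e).
    set (a := Cminus (Z (sh d v)) (Z v)) in *. set (b := Cminus (Z (sh e v)) (Z v)) in *.
    set (a' := Cminus (Z (sh d (sh e v))) (Z (sh e v))) in *.
    set (b' := Cminus (Z (sh e (sh d v))) (Z (sh d v))) in *.
    clearbody a b a' b'. unfold Inv in Hx.
    transitivity (Cmult (Cdiv (Cmult (Cmult (th e) (th e)) (Cmult a a'))
      (Cmult (Cmult (th d) (th e)) (Cmult a b))) x).
    - field; repeat split; auto.
    - rewrite Hcr. field; repeat split; auto. }
  exists (sec C St (RtoC 1)); split; [ reflexivity | split ].
  - intros v. apply (sec_Inv C St (RtoC 1) Inv I0 IS).
  - intros d v. rewrite (sec_sh C St (RtoC 1) Inv I0 IS CM). unfold St.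
    assert (sec C St (RtoC 1) v <> RtoC 0) by apply (sec_Inv C St (RtoC 1) Inv I0 IS).
    field. split; auto.
Qed.

(** The radius at the point [2 * j] of an axis, in closed form [Gamma (j + g) * Gamma (1 - g) /
    (Gamma g * Gamma (j + 1 - g))]. *)
Fixpoint rho (g : R) (j : nat) : R :=
  match j with O => 1 | S j => rho g j * ((INR j + g) / (INR j + 1 - g)) end.

Lemma rho_pos (g : R) (j : nat) : 0 < g < 1 -> 0 < rho g j.
Proof.
  intros Hg; induction j as [|j IH]; simpl; [ lra | ].
  pose proof (pos_INR j). apply Rmult_lt_0_compat; auto. apply Rdiv_lt_0_compat; lra.
Qed.

Lemma axis_solve (g : R) (e : C) (x h N : R) (X Y V : C) :
  e <> RtoC 0 -> X = Cmult e (RtoC x) -> Cminus X Y = Cmult e (RtoC h) ->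
  g <> 0 -> x <> 0 -> N * h - g * x <> 0 ->
  Cmult (RtoC (2 * g)) X
    = Cmult (RtoC (2 * N)) (Cdiv (Cmult (Cminus V X) (Cminus X Y)) (Cminus V Y)) ->
  Cminus V X = Cmult e (RtoC (g * x * h / (N * h - g * x))).
Proof.
  intros He HX Hh Hg Hx Hd E.
  assert (RC : forall a, a <> 0 -> RtoC a <> RtoC 0) by (intros a Ha H; injection H; auto).
  (* For [V = Y] the quotient would be 0, since [Cinv] of 0 is 0, but the left-hand side is not. *)
  assert (HV : Cminus V Y <> RtoC 0).
  { intros H0. rewrite H0, HX in E. unfold Cdiv in E.
    replace (Cinv (RtoC 0)) with (RtoC 0) in E
      by (apply C_ext; simpl; unfold Rdiv; ring).
    rewrite Cmult_0_r, Cmult_0_r in E.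
    apply Cmult_integral in E; destruct E as [E|E]; [ injection E; lra | ].
    apply Cmult_integral in E; destruct E as [E|E]; [ now apply He | ].
    injection E; auto. }
  set (b := Cminus V X) in *.
  assert (HVY : Cminus V Y = Cplus b (Cmult e (RtoC h))) by (rewrite <- Hh; unfold b; ring).
  rewrite HVY in *. rewrite Hh, HX in E.
  assert (E2 : Cmult (RtoC 2) (Cmult (RtoC g) (Cmult (Cmult e (RtoC x)) (Cplus b (Cmult e (RtoC h)))))
    = Cmult (RtoC 2) (Cmult (RtoC N) (Cmult b (Cmult e (RtoC h))))).
  { rewrite !RtoC_mult in E.
    transitivity (Cmult (Cmult (Cmult (RtoC 2) (RtoC g)) (Cmult e (RtoC x))) (Cplus b (Cmult e (RtoC h)))).
    - ring.
    - rewrite E. field; auto. }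
  apply Cmult_eq_reg_l in E2; [ | apply RC; lra ].
  apply Cmult_eq_reg_l with (Cmult e (RtoC (N * h - g * x))).
  - intros H0; apply Cmult_integral in H0; destruct H0 as [H0|H0]; [ now apply He | ].
    injection H0; auto.
  - transitivity (Cmult e (Cmult e (RtoC (g * x * h)))).
    + rewrite RtoC_minus, !RtoC_mult in *. 
      transitivity (Cminus (Cmult (RtoC N) (Cmult b (Cmult e (RtoC h))))
        (Cmult (RtoC g) (Cmult (Cmult e (RtoC x)) b))); [ ring | ].
      rewrite <- E2. ring.
    + replace (RtoC (g * x * h)) with (Cmult (RtoC (N * h - g * x)) (RtoC (g * x * h / (N * h - g * x)))).
      * ring.
      * rewrite <- RtoC_mult. f_equal. field; auto.
Qed.

(** The edges at the even point [2 * j] have length [rho g j], as radii of the circle centred there;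
    the closed forms of [Z] in the proof sum these lengths. *)
Lemma axis_values (g : R) (e : C) (Z : nat -> C) :
  0 < g < 1 -> e <> RtoC 0 -> Z 0%nat = RtoC 0 -> Z 1%nat = e ->
  (forall j, Cmult (RtoC (2 * g)) (Z (S j))
    = Cmult (RtoC (2 * INR (S j)))
        (Cdiv (Cmult (Cminus (Z (S (S j))) (Z (S j))) (Cminus (Z (S j)) (Z j)))
              (Cminus (Z (S (S j))) (Z j)))) ->
  forall j, Cminus (Z (S (2 * j))) (Z (2 * j)%nat) = Cmult e (RtoC (rho g j)) /\
            Cminus (Z (S (S (2 * j)))) (Z (S (2 * j))) = Cmult e (RtoC (rho g (S j))).
Proof.
  intros Hg He Z0 Z1 HC.
  assert (A : forall j, Z (2 * j)%nat = Cmult e (RtoC (INR j * rho g j / g)) /\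
    Z (S (2 * j)) = Cmult e (RtoC ((INR j / g + 1) * rho g j)) /\
    Cminus (Z (S (S (2 * j)))) (Z (S (2 * j))) = Cmult e (RtoC (rho g (S j)))).
  { assert (ST : forall j, Z (2 * j)%nat = Cmult e (RtoC (INR j * rho g j / g)) ->
      Z (S (2 * j)) = Cmult e (RtoC ((INR j / g + 1) * rho g j)) ->
      Cminus (Z (S (S (2 * j)))) (Z (S (2 * j))) = Cmult e (RtoC (rho g (S j)))).
    { intros j A1 A2. pose proof (rho_pos g j Hg) as P. pose proof (pos_INR j) as Pj.
      assert (I : INR (S (2 * j)) = 2 * INR j + 1) by (rewrite S_INR, mult_INR; reflexivity).
      assert (D : INR (S (2 * j)) * rho g j - g * ((INR j / g + 1) * rho g j)
        = (INR j + 1 - g) * rho g j) by (rewrite I; field; lra).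
      rewrite (axis_solve g e ((INR j / g + 1) * rho g j) (rho g j) (INR (S (2 * j)))
        (Z (S (2 * j))) (Z (2 * j)%nat)); auto.
      - rewrite D. do 2 f_equal. simpl rho. field. repeat split; try lra.
      - rewrite A1, A2. replace (RtoC ((INR j / g + 1) * rho g j)) with
          (Cplus (RtoC (INR j * rho g j / g)) (RtoC (rho g j))); [ ring | ].
        rewrite <- RtoC_plus. f_equal. field; lra.
      - lra.
      - apply Rmult_integral_contrapositive; split; [ | lra ].
        assert (0 <= INR j / g) by (apply Rdiv_le_0_compat; lra). lra.
      - rewrite D. apply Rmult_integral_contrapositive; split; lra. }
    induction j as [|j [A1 [A2 A3]]].
    - assert (E0 : Z (2 * 0)%nat = Cmult e (RtoC (INR 0 * rho g 0 / g))).
      { simpl. rewrite Z0. replace (0 * 1 / g) with 0 by (field; lra). ring. }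
      assert (E1 : Z (S (2 * 0)) = Cmult e (RtoC ((INR 0 / g + 1) * rho g 0))).
      { simpl. rewrite Z1. replace ((0 / g + 1) * 1) with 1 by (field; lra). ring. }
      auto.
    - pose proof (rho_pos g j Hg) as P. pose proof (rho_pos g (S j) Hg) as P'.
      pose proof (pos_INR j) as Pj.
      replace (2 * S j)%nat with (S (S (2 * j))) in * by lia.
      assert (R1 : rho g (S j) = rho g j * ((INR j + g) / (INR j + 1 - g))) by reflexivity.
      assert (E0 : Z (S (S (2 * j))) = Cmult e (RtoC (INR (S j) * rho g (S j) / g))).
      { replace (Z (S (S (2 * j)))) with
          (Cplus (Z (S (2 * j))) (Cminus (Z (S (S (2 * j)))) (Z (S (2 * j))))) by ring.
        rewrite A3, A2, <- Cmult_plus_distr_l, <- RtoC_plus. do 2 f_equal.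
        rewrite R1, S_INR. field. lra. }
      assert (E1 : Z (S (S (S (2 * j)))) = Cmult e (RtoC ((INR (S j) / g + 1) * rho g (S j)))).
      { replace (Z (S (S (S (2 * j))))) with
          (Cplus (Z (S (S (2 * j)))) (Cminus (Z (S (S (S (2 * j))))) (Z (S (S (2 * j)))))) by ring.
        assert (I : INR (S (S (2 * j))) = 2 * INR (S j)) by (rewrite !S_INR, mult_INR; simpl; ring).
        assert (D : INR (S (S (2 * j))) * rho g (S j) - g * (INR (S j) * rho g (S j) / g)
          = INR (S j) * rho g (S j)) by (rewrite I; field; lra).
        rewrite (axis_solve g e (INR (S j) * rho g (S j) / g) (rho g (S j)) (INR (S (S (2 * j))))
          (Z (S (S (2 * j)))) (Z (S (2 * j)))); auto; rewrite ?D; rewrite ?S_INR.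
        - rewrite E0, <- Cmult_plus_distr_l, <- RtoC_plus. do 2 f_equal.
          rewrite !S_INR. field. repeat split; lra.
        - lra.
        - apply Rgt_not_eq. apply Rdiv_lt_0_compat; [ apply Rmult_lt_0_compat | ]; lra.
        - apply Rmult_integral_contrapositive; split; lra. }
      split; [ exact E0 | split; [ exact E1 | ] ].
      specialize (ST (S j)). replace (2 * S j)%nat with (S (S (2 * j))) in ST by lia. auto. }
  intros j. destruct (A j) as [A1 [A2 A3]]. split; auto.
  rewrite A1, A2. replace (RtoC ((INR j / g + 1) * rho g j)) with
    (Cplus (RtoC (INR j * rho g j / g)) (RtoC (rho g j))); [ ring | ].
  rewrite <- RtoC_plus. f_equal. field; lra.
Qed.

(** * The wave function *)

Definition smoothC (f : R -> C) : Prop := smooth (fun t => fst (f t)) /\ smooth (fun t => snd (f t)).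

Definition ordC (n : nat) (f : R -> C) (a : R) : Prop :=
  ord n (fun t => fst (f t)) a /\ ord n (fun t => snd (f t)) a.

Lemma smoothC_plus (f h : R -> C) : smoothC f -> smoothC h -> smoothC (fun t => Cplus (f t) (h t)).
Proof. intros [F1 F2] [H1 H2]; split; simpl; now apply smooth_plus. Qed.

Lemma smoothC_mult (f h : R -> C) : smoothC f -> smoothC h -> smoothC (fun t => Cmult (f t) (h t)).
Proof.
  intros [F1 F2] [H1 H2]; split; simpl.
  - apply (smooth_minus (fun t => fst (f t) * fst (h t)) (fun t => snd (f t) * snd (h t)));
      now apply smooth_mult.
  - apply (smooth_plus (fun t => fst (f t) * snd (h t)) (fun t => snd (f t) * fst (h t)));
      now apply smooth_mult.
Qed.

Lemma smoothC_const (c : C) : smoothC (fun _ => c).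
Proof. split; apply smooth_const. Qed.

Lemma smoothC_expi (a b : R) : smoothC (fun t => expi (a * t + b)).
Proof. split; simpl; [ apply smooth_cos_aff | apply smooth_sin_aff ]. Qed.

Lemma smoothC_RtoC (f : R -> R) : smooth f -> smoothC (fun t => RtoC (f t)).
Proof. intros F; split; simpl; auto using smooth_const. Qed.

Lemma ordC_ext (n : nat) (f h : R -> C) (a : R) :
  (forall t, f t = h t) -> ordC n f a -> ordC n h a.
Proof.
  intros E [H1 H2]; split; [ revert H1 | revert H2 ]; apply ord_ext_loc;
    apply filter_forall; intros t; now rewrite E.
Qed.

Lemma ordC_ext_loc (n : nat) (f h : R -> C) (a : R) :
  locally a (fun t => f t = h t) -> ordC n f a -> ordC n h a.
Proof.
  intros E [H1 H2]; split; [ revert H1 | revert H2 ]; apply ord_ext_loc;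
    revert E; apply filter_imp; intros t ->; reflexivity.
Qed.

Lemma ordC_plus (n : nat) (f h : R -> C) (a : R) : smoothC f -> smoothC h -> J a ->
  ordC n f a -> ordC n h a -> ordC n (fun t => Cplus (f t) (h t)) a.
Proof. intros [F1 F2] [G1 G2] Ha [H1 H2] [K1 K2]; split; simpl; now apply ord_plus. Qed.

Lemma ord_minus (n : nat) (f h : R -> R) (a : R) : smooth f -> smooth h -> J a ->
  ord n f a -> ord n h a -> ord n (fun t => f t - h t) a.
Proof.
  intros F H Ha Hf Hh. apply ord_ext with (fun t => f t + (-1) * h t); auto.
  - intros; ring.
  - apply ord_plus; auto using smooth_scal. apply ord_mult; auto using smooth_const.
Qed.

Lemma ordC_mult (n : nat) (h f : R -> C) (a : R) : smoothC f -> smoothC h -> J a ->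
  ordC n f a -> ordC n (fun t => Cmult (h t) (f t)) a.
Proof.
  intros [F1 F2] [G1 G2] Ha [H1 H2]; split; simpl.
  - apply (ord_minus n (fun t => fst (h t) * fst (f t)) (fun t => snd (h t) * snd (f t)));
      auto using smooth_mult, ord_mult.
  - apply (ord_plus n (fun t => fst (h t) * snd (f t)) (fun t => snd (h t) * fst (f t)));
      auto using smooth_mult, ord_mult.
Qed.

Lemma ordC_shift (n : nat) (f : R -> C) (a : R) : ordC n f 0 -> ordC n (fun t => f (t - a)) a.
Proof.
  intros [H1 H2]; split;
    [ apply (ord_shift n (fun t => fst (f t))) | apply (ord_shift n (fun t => snd (f t))) ];
    now rewrite Rminus_diag.
Qed.

Lemma ordC_sin_pow (m n : nat) (f : R -> C) : smoothC f -> ordC n f 0 ->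
  ordC (m + n) (fun t => Cmult (RtoC (sin t ^ m)) (f t)) 0.
Proof.
  intros [F1 F2] [H1 H2]; split; simpl.
  - apply ord_ext with (fun t => sin t ^ m * fst (f t)); auto using J0, ord_sin_pow.
    intros; ring.
  - apply ord_ext with (fun t => sin t ^ m * snd (f t)); auto using J0, ord_sin_pow.
    intros; ring.
Qed.

Lemma ordC_1 (f : R -> C) (a : R) : f a = RtoC 0 -> ordC 1 f a.
Proof. intros E; split; simpl; rewrite E; auto. Qed.

Lemma expi_double (t : R) : Cmult (expi (t / 2)) (expi (t / 2)) = expi t.
Proof. rewrite <- expi_plus. f_equal; field. Qed.

Lemma expi_sum (t : R) : Cplus (expi t) (expi (- t)) = RtoC (2 * cos t).
Proof. apply C_ext; simpl; rewrite ?cos_neg, ?sin_neg; ring. Qed.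

Lemma RtoC_neq_0 (a : R) : a <> 0 -> RtoC a <> RtoC 0.
Proof. intros H E; injection E; auto. Qed.

(** The product of the phases [expi (psi d)] along any path from the origin to [v]. *)
Definition mono (psi : dir -> R) (v : vert) : C :=
  expi (INR (cnt D1 v) * psi D1 + INR (cnt D2 v) * psi D2 + INR (cnt D3 v) * psi D3).

Lemma mono_sh (psi : dir -> R) (d : dir) (v : vert) :
  mono psi (sh d v) = Cmult (expi (psi d)) (mono psi v).
Proof.
  unfold mono. rewrite <- expi_plus. f_equal.
  destruct v as [[k l] n], d; cbn [cnt sh]; rewrite S_INR; ring.
Qed.

Lemma mono_unit (psi : dir -> R) (v : vert) : Cmult (mono psi v) (Cconj (mono psi v)) = RtoC 1.
Proof. unfold mono. rewrite Cconj_expi. apply expi_inv_r. Qed.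

Lemma mono_origin (psi : dir -> R) : mono psi origin = RtoC 1.
Proof. unfold mono. simpl. rewrite !Rmult_0_l, !Rplus_0_l. apply expi_0. Qed.

Lemma unit_neq_0 (a b : C) : Cmult a b = RtoC 1 -> a <> RtoC 0.
Proof. intros H E. rewrite E, Cmult_0_l in H. injection H; lra. Qed.

Section Wave.

Variables (g : R) (psi : dir -> R) (w : vert -> C).
Hypothesis Hg : 0 < g < 1.
Hypothesis Hpsi : forall d, J (psi d).

Let th (d : dir) : C := expi (psi d).

Hypothesis th_distinct : forall d e, d <> e -> Cmult (th d) (th d) <> Cmult (th e) (th e).
Hypothesis w_neq_0 : forall v, w v <> RtoC 0.
Hypothesis w_hirota : forall d e v, d <> e ->
  Cplus (Cmult (th d) (Cmult (w v) (w (sh d v))))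
        (Cmult (th e) (Cmult (w (sh d v)) (w (sh e (sh d v)))))
  = Cplus (Cmult (th e) (Cmult (w v) (w (sh e v))))
        (Cmult (th d) (Cmult (w (sh e v)) (w (sh d (sh e v))))).
Hypothesis w_even_ax : forall d j, w (ax d (2 * j)) = RtoC (rho g j).
Hypothesis w_odd_ax : forall d j, w (ax d (S (2 * j))) = expi ((2 * g - 1) * psi d).

Lemma th_unit (d : dir) : Cmult (th d) (Cconj (th d)) = RtoC 1.
Proof. unfold th. rewrite Cconj_expi. apply expi_inv_r. Qed.

Lemma hirota_solved (d e : dir) (v : vert) : d <> e ->
  Cmult (w (sh d (sh e v))) (Cminus (Cmult (th e) (w (sh d v))) (Cmult (th d) (w (sh e v))))
  = Cmult (w v) (Cminus (Cmult (th e) (w (sh e v))) (Cmult (th d) (w (sh d v)))).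
Proof.
  intros H. pose proof (w_hirota d e v H) as E. rewrite (sh_comm e d) in E.
  set (y := w (sh d (sh e v))) in *. set (a := w (sh d v)) in *. set (b := w (sh e v)) in *.
  set (x := w v) in *.
  transitivity (Cminus (Cplus (Cmult (th d) (Cmult x a)) (Cmult (th e) (Cmult a y)))
    (Cplus (Cmult (th d) (Cmult x a)) (Cmult (th d) (Cmult b y)))); [ ring | ].
  rewrite E. ring.
Qed.

(** A zero denominator forces a zero numerator, and together they would give [th d] and [th e] equal
    squares. *)
Lemma hirota_den (d e : dir) (v : vert) : d <> e ->
  Cminus (Cmult (th e) (w (sh d v))) (Cmult (th d) (w (sh e v))) <> RtoC 0.
Proof.
  intros H D. pose proof (hirota_solved d e v H) as E. rewrite D, Cmult_0_r in E.
  symmetry in E. apply Cmult_integral in E; destruct E as [E|E]; [ now apply (w_neq_0 v) | ].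
  pose proof (w_neq_0 (sh d v)) as Na; pose proof (w_neq_0 (sh e v)) as Nb.
  set (a := w (sh d v)) in *. set (b := w (sh e v)) in *.
  assert (E1 : Cmult (th e) a = Cmult (th d) b).
  { replace (Cmult (th e) a) with (Cplus (Cminus (Cmult (th e) a) (Cmult (th d) b)) (Cmult (th d) b)) by ring.
    rewrite D; ring. }
  assert (E2 : Cmult (th e) b = Cmult (th d) a).
  { replace (Cmult (th e) b) with (Cplus (Cminus (Cmult (th e) b) (Cmult (th d) a)) (Cmult (th d) a)) by ring.
    rewrite E; ring. }
  apply (th_distinct d e H).
  apply Cmult_eq_reg_l with a; auto. apply Cmult_eq_reg_l with b; auto.
  transitivity (Cmult (Cmult (th d) a) (Cmult (th d) b)); [ ring | ].
  rewrite <- E1, <- E2. ring.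
Qed.

Lemma w_parity (v : vert) :
  if Nat.even (lev v) then Cconj (w v) = w v else Cmult (w v) (Cconj (w v)) = RtoC 1.
Proof.
  remember (lev v) as N eqn:EN. revert v EN.
  induction N as [N IH] using (well_founded_induction lt_wf). intros v EN.
  destruct (vert_cases v) as [(d & j & ->)|(d & e & v' & Hde & ->)].
  - rewrite lev_ax in EN. subst N.
    destruct (Nat.Even_or_Odd j) as [[i ->]|[i ->]].
    + rewrite Nat.even_mul, w_even_ax. apply Cconj_RtoC.
    + replace (2 * i + 1)%nat with (S (2 * i)) by lia.
      replace (Nat.even (S (2 * i))) with false by (rewrite Nat.even_succ, Nat.odd_mul; reflexivity).
      rewrite w_odd_ax, Cconj_expi. apply expi_inv_r.
  - rewrite !lev_sh in EN. subst N.
    pose proof (IH (lev v') ltac:(lia) v' eq_refl) as Px.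
    pose proof (IH (S (lev v')) ltac:(lia) (sh d v') ltac:(now rewrite lev_sh)) as Pa.
    pose proof (IH (S (lev v')) ltac:(lia) (sh e v') ltac:(now rewrite lev_sh)) as Pb.
    pose proof (hirota_solved d e v' Hde) as E. pose proof (hirota_den d e v' Hde) as D.
    pose proof (th_unit d) as Ud; pose proof (th_unit e) as Ue.
    pose proof (f_equal Cconj E) as Ec.
    rewrite !Cconj_mult, !Cconj_minus, !Cconj_mult in Ec.
    set (y := w (sh d (sh e v'))) in *. set (a := w (sh d v')) in *. set (b := w (sh e v')) in *.
    set (x := w v') in *. clearbody y a b x. clear IH.
    rewrite Nat.even_succ_succ. rewrite Nat.even_succ, <- Nat.negb_even in Pa, Pb.
    destruct (Nat.even (lev v')); simpl in Pa, Pb.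
    (* For [a] and [b] of modulus one, conjugation multiplies [th e * a - th d * b] and
       [th e * b - th d * a] by the same factor, so [y / x] is real. *)
    + rewrite Px in Ec.
      apply Cmult_eq_reg_l with (Cminus (Cmult (th e) a) (Cmult (th d) b)); auto.
      transitivity (Cmult y (Cminus (Cmult (th e) a) (Cmult (th d) b))); [ | ring ].
      rewrite E.
      transitivity (Copp (Cmult (Cmult (Cmult (th d) (th e)) (Cmult a b))
        (Cmult (Cconj y) (Cminus (Cmult (Cconj (th e)) (Cconj a)) (Cmult (Cconj (th d)) (Cconj b)))))).
      * transitivity (Cmult (Cconj y) (Cminus (Cmult (Cmult (th e) a) (Cmult (Cmult (th d) (Cconj (th d))) (Cmult b (Cconj b)))) (Cmult (Cmult (th d) b) (Cmult (Cmult (th e) (Cconj (th e))) (Cmult a (Cconj a)))))); [ rewrite Ud, Ue, Pa, Pb; ring | ring ].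
      * rewrite Ec.
        transitivity (Cmult x (Cminus (Cmult (Cmult (th e) b) (Cmult (Cmult (th d) (Cconj (th d))) (Cmult a (Cconj a)))) (Cmult (Cmult (th d) a) (Cmult (Cmult (th e) (Cconj (th e))) (Cmult b (Cconj b)))))); [ ring | rewrite Ud, Ue, Pa, Pb; ring ].
    (* For real [a] and [b] these two differences have equal modulus, so [y] has the modulus of
       [x]. *)
    + rewrite Pa, Pb in Ec.
      set (N1 := Cminus (Cmult (th e) a) (Cmult (th d) b)) in *.
      assert (Dc : Cminus (Cmult (Cconj (th e)) a) (Cmult (Cconj (th d)) b) <> RtoC 0).
      { intros H. apply D. unfold N1.
        assert (H' := f_equal Cconj H). rewrite Cconj_minus, !Cconj_mult, !Cconj_conj, Pa, Pb in H'.
        rewrite H'. apply Cconj_RtoC. }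
      set (N2 := Cminus (Cmult (Cconj (th e)) a) (Cmult (Cconj (th d)) b)) in *.
      apply Cmult_eq_reg_l with (Cmult N1 N2).
      { intros H; apply Cmult_integral in H; tauto. }
      transitivity (Cmult (Cmult y N1) (Cmult (Cconj y) N2)); [ ring | ].
      rewrite E, Ec.
      transitivity (Cmult (Cmult x (Cconj x)) (Cmult (Cminus (Cmult (th e) b) (Cmult (th d) a)) (Cminus (Cmult (Cconj (th e)) b) (Cmult (Cconj (th d)) a)))); [ ring | ].
      rewrite Px. unfold N1, N2.
      transitivity (Cminus (Cplus (Cmult (Cmult (th e) (Cconj (th e))) (Cmult b b)) (Cmult (Cmult (th d) (Cconj (th d))) (Cmult a a))) (Cmult (Cplus (Cmult (th e) (Cconj (th d))) (Cmult (th d) (Cconj (th e)))) (Cmult a b))); [ ring | ].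
      rewrite Ud, Ue.
      transitivity (Cminus (Cplus (Cmult (Cmult (th e) (Cconj (th e))) (Cmult a a)) (Cmult (Cmult (th d) (Cconj (th d))) (Cmult b b))) (Cmult (Cplus (Cmult (th e) (Cconj (th d))) (Cmult (th d) (Cconj (th e)))) (Cmult a b))); [ rewrite Ud, Ue; ring | ring ].
Qed.

Lemma w_even (v : vert) : Nat.even (lev v) = true -> w v = RtoC (fst (w v)).
Proof.
  intros H. pose proof (w_parity v) as P. rewrite H in P.
  apply C_ext; simpl; auto. apply (f_equal snd) in P. simpl in P. lra.
Qed.

Lemma w_odd (v : vert) : Nat.even (lev v) = false -> Cmult (w v) (Cconj (w v)) = RtoC 1.
Proof. intros H. pose proof (w_parity v) as P. now rewrite H in P. Qed.

(** The Lax matrix of an edge at spectral parameter [exp (- 2 i t)], degenerate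
    at [t = psi d]. *)
Definition step (t : R) (d : dir) (v : vert) (s : C * C) : C * C :=
  (Cplus (Cmult (expi (t / 2)) (fst s))
         (Cmult (Cmult (Cmult (th d) (w (sh d v))) (expi (- (t / 2)))) (snd s)),
   Cplus (Cmult (Cmult (Cdiv (w (sh d v)) (w v)) (expi (t / 2))) (snd s))
         (Cmult (Cmult (Cdiv (th d) (w v)) (expi (- (t / 2)))) (fst s))).

(** A symmetric gauge: the second component is multiplied by [expi t] and then both by
    [expi ((g - / 2) * t)]. At the origin the components are then conjugate up to sign, and this
    reality propagates. *)
Definition wave (v : vert) (t : R) : C * C :=
  sec (C * C) (step t) (expi ((g - / 2) * t), Copp (expi (- ((g - / 2) * t)))) v.

Definition wave_p (v : vert) (t : R) : C := fst (wave v t).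
Definition wave_y (v : vert) (t : R) : C := snd (wave v t).

(** Flatness of the Lax matrices. The Hirota relation enters in the form [F], which equates the
    mixed coefficients of the two paths. *)
Lemma step_comm (t : R) (d e : dir) (v : vert) (s : C * C) : d <> e ->
  step t d (sh e v) (step t e v s) = step t e (sh d v) (step t d v s).
Proof.
  intros H. destruct s as [p y]. unfold step; simpl.
  pose proof (w_hirota d e v H) as E.
  pose proof (w_neq_0 v) as N; pose proof (w_neq_0 (sh d v)) as Nd;
  pose proof (w_neq_0 (sh e v)) as Ne.
  rewrite (sh_comm e d) in *.
  set (z := w (sh d (sh e v))) in *. set (a := w (sh d v)) in *. set (b := w (sh e v)) in *.
  set (x := w v) in *. set (E1 := expi (t / 2)). set (E2 := expi (- (t / 2))).
  set (td := th d) in *; set (te := th e) in *.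
  assert (F : Cmult b (Cplus (Cmult te x) (Cmult td z)) = Cmult a (Cplus (Cmult td x) (Cmult te z))).
  { transitivity (Cplus (Cmult te (Cmult x b)) (Cmult td (Cmult b z))); [ ring | ].
    rewrite <- E. ring. }
  clearbody z a b x E1 E2 td te. f_equal.
  - transitivity (Cplus (Cmult (Cplus (Cmult E1 E1) (Cdiv (Cmult (Cmult td te) (Cmult z (Cmult E2 E2))) x)) p)
      (Cmult (Cdiv (Cmult (Cmult E1 E2) (Cmult b (Cplus (Cmult te x) (Cmult td z)))) x) y)).
    + field; auto.
    + rewrite F. field; auto.
  - transitivity (Cplus (Cmult (Cplus (Cdiv (Cmult z (Cmult E1 E1)) x) (Cmult (Cmult td te) (Cmult E2 E2))) y)
      (Cmult (Cdiv (Cmult (Cmult E1 E2) (Cmult a (Cplus (Cmult td x) (Cmult te z)))) (Cmult x (Cmult a b))) p)).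
    + field; auto.
    + rewrite <- F. field; auto.
Qed.

Lemma wave_sh (d : dir) (v : vert) (t : R) : wave (sh d v) t = step t d v (wave v t).
Proof.
  unfold wave. apply (sec_sh (C * C) (step t) _ (fun _ => True)); auto.
  intros; now apply step_comm.
Qed.

Lemma wave_p_sh (d : dir) (v : vert) (t : R) :
  wave_p (sh d v) t = Cplus (Cmult (expi (t / 2)) (wave_p v t))
    (Cmult (Cmult (Cmult (th d) (w (sh d v))) (expi (- (t / 2)))) (wave_y v t)).
Proof. unfold wave_p, wave_y. now rewrite wave_sh. Qed.

Lemma wave_y_sh (d : dir) (v : vert) (t : R) :
  wave_y (sh d v) t = Cplus (Cmult (Cmult (Cdiv (w (sh d v)) (w v)) (expi (t / 2))) (wave_y v t))
    (Cmult (Cmult (Cdiv (th d) (w v)) (expi (- (t / 2)))) (wave_p v t)).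
Proof. unfold wave_p, wave_y. now rewrite wave_sh. Qed.

(** At even points the components determine each other; at odd points both lie on one real line
    through 0 that does not depend on [t], so they can be treated as real functions. *)
Lemma wave_reality (v : vert) (t : R) :
  if Nat.even (lev v)
  then wave_y v t = Copp (Cmult (mono psi v) (Cconj (wave_p v t)))
  else wave_p v t = Copp (Cmult (Cmult (mono psi v) (w v)) (Cconj (wave_p v t))) /\
       wave_y v t = Copp (Cmult (Cmult (mono psi v) (w v)) (Cconj (wave_y v t))).
Proof.
  induction v as [|d v IH] using vert_ind_sh.
  - change (lev origin) with 0%nat. rewrite mono_origin. change (Nat.even 0) with true.
    unfold wave_y, wave_p, wave. cbn [sec sec1 sec2 sec3 origin fst snd].
    rewrite Cconj_expi. ring.
  - rewrite lev_sh, Nat.even_succ, <- Nat.negb_even.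
    rewrite mono_sh. change (expi (psi d)) with (th d).
    rewrite wave_p_sh, wave_y_sh.
    pose proof (w_parity v) as Wv. pose proof (w_parity (sh d v)) as Wd.
    rewrite lev_sh, Nat.even_succ, <- Nat.negb_even in Wd.
    pose proof (th_unit d) as Ud. pose proof (mono_unit psi v) as Um.
    pose proof (expi_inv_r (t / 2)) as UE.
    assert (CE : Cconj (expi (t / 2)) = expi (- (t / 2))) by apply Cconj_expi.
    assert (CE' : Cconj (expi (- (t / 2))) = expi (t / 2)) by (rewrite Cconj_expi, Ropp_involutive; auto).
    pose proof (w_neq_0 v) as Nv.
    set (p := wave_p v t) in *. set (y := wave_y v t) in *. set (E1 := expi (t / 2)) in *.
    set (E2 := expi (- (t / 2))) in *. set (M := mono psi v) in *. set (a := w (sh d v)) in *.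
    set (x := w v) in *. set (s := th d) in *.
    clearbody p y E1 E2 M a x s.
    assert (Ns : s <> RtoC 0) by (eapply unit_neq_0; eauto).
    assert (NM : M <> RtoC 0) by (eapply unit_neq_0; eauto).
    assert (Cs : Cconj s = Cinv s) by (apply Cmult_eq_reg_l with s; auto; rewrite Ud; field; auto).
    assert (CM : Cconj M = Cinv M) by (apply Cmult_eq_reg_l with M; auto; rewrite Um; field; auto).
    destruct (Nat.even (lev v)); simpl in *.
    + assert (Na : a <> RtoC 0) by (eapply unit_neq_0; eauto).
      assert (Ca : Cconj a = Cinv a) by (apply Cmult_eq_reg_l with a; auto; rewrite Wd; field; auto).
      subst y. unfold Cdiv. rewrite !Cconj_plus, !Cconj_mult, !Cconj_opp, !Cconj_mult, !Cconj_conj.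
      rewrite CE, CE', Cs, Ca, CM. rewrite Cinv_conj by auto. rewrite Wv.
      split; field; auto.
    + destruct IH as [Hp Hy].
      assert (Na : x <> RtoC 0) by (eapply unit_neq_0; eauto).
      assert (Cx : Cconj x = Cinv x) by (apply Cmult_eq_reg_l with x; auto; rewrite Wv; field; auto).
      rewrite !Cconj_plus, !Cconj_mult, CE, CE', Wd, Cs.
      rewrite Hp at 1. rewrite Hy at 1. field; auto.
Qed.

(** Unless [t] equals some [psi d] modulo [PI], the Lax matrices are invertible; the proof applies
    the adjugate, with [Q] the relevant factor of the determinant. *)
Lemma wave_neq_0 (v : vert) (t : R) :
  (forall d, expi (2 * t) <> Cmult (th d) (th d)) -> ~ (wave_p v t = RtoC 0 /\ wave_y v t = RtoC 0).
Proof.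
  intros Ht. induction v as [|d v IH] using vert_ind_sh.
  - intros [H _]. unfold wave_p, wave in H. cbn [sec sec1 sec2 sec3 origin fst] in H.
    now apply expi_neq_0 in H.
  - rewrite wave_p_sh, wave_y_sh. intros [H1 H2]. apply IH.
    pose proof (w_neq_0 v) as N. pose proof (w_neq_0 (sh d v)) as Nd.
    pose proof (expi_inv_r (t / 2)) as UE.
    assert (D : Cminus (Cmult (expi (t / 2)) (expi (t / 2)))
        (Cmult (Cmult (th d) (th d)) (Cmult (expi (- (t / 2))) (expi (- (t / 2))))) <> RtoC 0).
    { intros D. apply (Ht d). replace (expi (2 * t)) with
        (Cmult (Cmult (expi (t / 2)) (expi (t / 2))) (Cmult (expi (t / 2)) (expi (t / 2))))
        by (rewrite expi_double, <- expi_plus; f_equal; ring).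
      set (E1 := expi (t / 2)) in *. set (E2 := expi (- (t / 2))) in *. set (s := th d) in *.
      transitivity (Cplus (Cmult (Cmult E1 E1) (Cminus (Cmult E1 E1) (Cmult (Cmult s s) (Cmult E2 E2))))
        (Cmult (Cmult s s) (Cmult (Cmult E1 E2) (Cmult E1 E2)))); [ ring | ].
      rewrite D, UE. ring. }
    set (p := wave_p v t) in *. set (y := wave_y v t) in *. set (E1 := expi (t / 2)) in *.
    set (E2 := expi (- (t / 2))) in *. set (a := w (sh d v)) in *.
    set (x := w v) in *. set (s := th d) in *.
    set (Q := Cminus (Cmult E1 E1) (Cmult (Cmult s s) (Cmult E2 E2))) in *.
    set (X1 := Cplus (Cmult E1 p) (Cmult (Cmult (Cmult s a) E2) y)) in *.
    set (X2 := Cplus (Cmult (Cmult (Cdiv a x) E1) y) (Cmult (Cmult (Cdiv s x) E2) p)) in *.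
    split; apply Cmult_eq_reg_l with Q; auto; rewrite Cmult_0_r.
    + transitivity (Cminus (Cmult E1 X1) (Cmult (Cmult (Cmult s x) E2) X2)).
      * unfold X1, X2, Q. field; auto.
      * rewrite H1, H2. ring.
    + transitivity (Cminus (Cmult (Cdiv (Cmult x E1) a) X2) (Cmult (Cdiv (Cmult s E2) a) X1)).
      * unfold X1, X2, Q. field; auto.
      * rewrite H1, H2. ring.
Qed.

(** Two steps combine the half angles into [expi t], [expi (- t)] and constants, which act on the
    spans [Psi]. *)
Lemma wave_p_two_step (d e : dir) (v : vert) (t : R) :
  wave_p (sh e (sh d v)) t =
    Cplus (Cmult (Cplus (expi t)
        (Cmult (Cdiv (Cmult (Cmult (th d) (th e)) (w (sh e (sh d v)))) (w v)) (expi (- t)))) (wave_p v t))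
      (Cmult (Cplus (Cmult (th d) (w (sh d v)))
        (Cdiv (Cmult (Cmult (th e) (w (sh e (sh d v)))) (w (sh d v))) (w v))) (wave_y v t)).
Proof.
  rewrite !wave_p_sh, wave_y_sh. pose proof (w_neq_0 v). pose proof (expi_inv_r (t / 2)) as UE.
  replace (expi t) with (Cmult (expi (t / 2)) (expi (t / 2))) by apply expi_double.
  replace (expi (- t)) with (Cmult (expi (- (t / 2))) (expi (- (t / 2))))
    by (rewrite <- expi_plus; f_equal; field).
  set (E1 := expi (t / 2)) in *. set (E2 := expi (- (t / 2))) in *.
  set (z := w (sh e (sh d v))). set (a := w (sh d v)). set (x := w v) in *.
  transitivity (Cplus (Cmult (Cplus (Cmult E1 E1)
        (Cmult (Cdiv (Cmult (Cmult (th d) (th e)) z) x) (Cmult E2 E2))) (wave_p v t))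
     (Cmult (Cmult E1 E2) (Cmult (Cplus (Cmult (th d) a) (Cdiv (Cmult (Cmult (th e) z) a) x)) (wave_y v t)))).
  - field; auto.
  - rewrite UE. field; auto.
Qed.

Lemma wave_y_two_step (d e : dir) (v : vert) (t : R) :
  wave_y (sh e (sh d v)) t =
    Cplus (Cmult (Cplus (Cmult (Cdiv (w (sh e (sh d v))) (w v)) (expi t))
        (Cmult (Cmult (th d) (th e)) (expi (- t)))) (wave_y v t))
      (Cmult (Cplus (Cdiv (Cmult (th d) (w (sh e (sh d v)))) (Cmult (w v) (w (sh d v))))
        (Cdiv (th e) (w (sh d v)))) (wave_p v t)).
Proof.
  rewrite !wave_y_sh, wave_p_sh. pose proof (w_neq_0 v). pose proof (w_neq_0 (sh d v)).
  pose proof (expi_inv_r (t / 2)) as UE.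
  replace (expi t) with (Cmult (expi (t / 2)) (expi (t / 2))) by apply expi_double.
  replace (expi (- t)) with (Cmult (expi (- (t / 2))) (expi (- (t / 2))))
    by (rewrite <- expi_plus; f_equal; field).
  set (E1 := expi (t / 2)) in *. set (E2 := expi (- (t / 2))) in *.
  set (z := w (sh e (sh d v))). set (a := w (sh d v)) in *. set (x := w v) in *.
  transitivity (Cplus (Cmult (Cplus (Cmult (Cdiv z x) (Cmult E1 E1))
        (Cmult (Cmult (th d) (th e)) (Cmult E2 E2))) (wave_y v t))
     (Cmult (Cmult E1 E2) (Cmult (Cplus (Cdiv (Cmult (th d) z) (Cmult x a)) (Cdiv (th e) a)) (wave_p v t)))).
  - field; auto.
  - rewrite UE. field; auto.
Qed.

Lemma fam_raise_dual (k : nat) (x : R) : J x ->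
  sin x * sin x * fam (1 - g) (S k) x
    = (INR k - g) * fam g k x - (INR k - 1 + g) * cos x * fam (1 - g) k x.
Proof.
  intros Hx. rewrite (fam_raise (1 - g)) by (auto; lra).
  replace (1 - (1 - g)) with g by ring. ring.
Qed.

(** Constraint (ii) enters through the radii [rho]: the relation [a = b * rho g j] turns each double
    step into an instance of [fam_raise]. *)
Lemma axis_wave (d : dir) (j : nat) :
  exists (K : C) (a b : R), a = b * rho g j /\ forall t, J (t - psi d) ->
    wave_p (ax d (S (2 * j))) t
      = Cmult K (RtoC (sin (t - psi d) ^ S (2 * j) * (a * fam g (S j) (t - psi d)))) /\
    wave_y (ax d (S (2 * j))) t
      = Copp (Cmult K (RtoC (sin (t - psi d) ^ S (2 * j) * (b * fam (1 - g) (S j) (t - psi d))))).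
Proof.
  induction j as [|j (K & a & b & Hab & IH)].
  - exists (Cmult (RtoC 2) (Cmult Ci (expi (g * psi d)))), 1, 1. split; [ simpl; ring | ].
    intros t Ht. replace (ax d (S (2 * 0))) with (sh d origin) by (destruct d; reflexivity).
    rewrite wave_p_sh, wave_y_sh. replace (sh d origin) with (ax d (S (2 * 0))) by (destruct d; reflexivity).
    rewrite w_odd_ax. replace origin with (ax d (2 * 0)) by (destruct d; reflexivity).
    rewrite w_even_ax. simpl rho.
    replace (ax d (2 * 0)) with origin by (destruct d; reflexivity).
    unfold wave_p, wave_y, wave. cbn [sec sec1 sec2 sec3 origin fst snd].
    simpl pow. rewrite !Rmult_1_r, !Rmult_1_l.
    destruct (fam_0_1 g Hg _ Ht) as [_ ->].
    destruct (fam_0_1 (1 - g) ltac:(lra) _ Ht) as [_ ->].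
    (* Differences of exponentials produce [sin (g * x)] and [sin ((1 - g) * x)] at [x = t - psi d],
       which are the functions of index 1 times [sin]. *)
    assert (S2 : forall u v, Cminus (expi (u + v)) (expi (u - v))
      = Cmult (RtoC 2) (Cmult (Cmult Ci (expi u)) (RtoC (sin v)))).
    { intros u v. apply C_ext; simpl; rewrite ?cos_plus, ?cos_minus, ?sin_plus, ?sin_minus; ring. }
    split.
    + transitivity (Cminus (expi (g * psi d + g * (t - psi d))) (expi (g * psi d - g * (t - psi d)))).
      * unfold th, Cminus. f_equal.
        -- rewrite <- expi_plus. f_equal. field.
        -- transitivity (Copp (Cmult (Cmult (Cmult (expi (psi d)) (expi ((2 * g - 1) * psi d)))
             (expi (- (t / 2)))) (expi (- ((g - / 2) * t))))); [ ring | ].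
           rewrite <- !expi_plus. do 2 f_equal. field.
      * rewrite S2. ring.
    + transitivity (Copp (Cminus (expi (g * psi d + (1 - g) * (t - psi d)))
        (expi (g * psi d - (1 - g) * (t - psi d))))).
      * transitivity (Cplus (Copp (Cmult (Cmult (expi ((2 * g - 1) * psi d)) (expi (t / 2)))
            (expi (- ((g - / 2) * t)))))
          (Cmult (Cmult (expi (psi d)) (expi (- (t / 2)))) (expi ((g - / 2) * t)))).
        -- unfold th. field.
        -- rewrite <- !expi_plus. 
           replace ((2 * g - 1) * psi d + t / 2 + - ((g - / 2) * t)) with
             (g * psi d + (1 - g) * (t - psi d)) by field.
           replace (psi d + - (t / 2) + (g - / 2) * t) with
             (g * psi d - (1 - g) * (t - psi d)) by field. ring.
      * rewrite S2. ring.
  - pose proof (pos_INR j) as Pj. pose proof (rho_pos g j Hg) as Pr.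
    (* The divisors are the coefficients of [fam_raise] in index [S j]; their quotient is
       [rho g (S j) / rho g j]. *)
    exists (Copp (Cmult (RtoC 2) (Cmult (th d) K))), (a / (INR j + 1 - g)), (b / (INR j + g)).
    split; [ rewrite Hab; simpl rho; field; lra | ].
    intros t Ht. destruct (IH t Ht) as [HP HY].
    replace (ax d (S (2 * S j))) with (sh d (sh d (ax d (S (2 * j)))))
      by (rewrite !sh_ax; do 2 f_equal; lia).
    rewrite wave_p_two_step, wave_y_two_step, HP, HY.
    replace (sh d (sh d (ax d (S (2 * j))))) with (ax d (S (2 * S j)))
      by (rewrite !sh_ax; do 2 f_equal; lia).
    replace (sh d (ax d (S (2 * j)))) with (ax d (2 * S j)) by (rewrite sh_ax; f_equal; lia).
    rewrite !w_odd_ax, w_even_ax.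
    pose proof (expi_neq_0 ((2 * g - 1) * psi d)) as Nw.
    pose proof (rho_pos g (S j) Hg) as Pr'.
    assert (Nr : RtoC (rho g (S j)) <> RtoC 0) by (apply RtoC_neq_0; lra).
    set (x := t - psi d) in *. set (om := expi ((2 * g - 1) * psi d)) in *.
    assert (E : Cplus (expi t) (Cmult (Cmult (th d) (th d)) (expi (- t)))
      = Cmult (th d) (RtoC (2 * cos x))).
    { rewrite <- expi_sum. unfold th, x. rewrite Cmult_plus_distr_l, <- !expi_plus.
      f_equal; f_equal; ring. }
    replace (S (2 * S j)) with (S (S (S (2 * j)))) by lia.
    set (n := S (2 * j)).
    pose proof (fam_raise g Hg (S j) x Ht) as R1. pose proof (fam_raise_dual (S j) x Ht) as R2.
    rewrite S_INR in R1, R2.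
    split.
    + transitivity (Cmult (Cmult (RtoC 2) (Cmult (th d) K))
        (RtoC (cos x * (sin x ^ n * (a * fam g (S j) x))
          - rho g (S j) * (sin x ^ n * (b * fam (1 - g) (S j) x))))).
      * rewrite RtoC_minus. rewrite (RtoC_mult (cos x)), (RtoC_mult (rho g (S j))).
        transitivity (Cplus (Cmult (Cplus (expi t) (Cmult (Cmult (th d) (th d)) (expi (- t))))
            (Cmult K (RtoC (sin x ^ n * (a * fam g (S j) x)))))
          (Cmult (Cmult (RtoC 2) (Cmult (th d) (RtoC (rho g (S j)))))
             (Copp (Cmult K (RtoC (sin x ^ n * (b * fam (1 - g) (S j) x))))))).
        { field; auto. }
        rewrite E, RtoC_mult. ring.
      * match goal with |- Cmult _ (RtoC ?u) = Cmult _ (RtoC ?v) => assert (EX : u = - v) end.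
        { transitivity (- (sin x ^ n * (a / (INR j + 1 - g) * (sin x * sin x * fam g (S (S j)) x))));
            [ | simpl; ring ].
          rewrite R1, Hab. simpl rho. field. lra. }
        rewrite EX, RtoC_opp. ring.
    + transitivity (Cmult (Cmult (RtoC 2) (Cmult (th d) K))
        (RtoC (/ rho g (S j) * (sin x ^ n * (a * fam g (S j) x))
          - cos x * (sin x ^ n * (b * fam (1 - g) (S j) x))))).
      * rewrite RtoC_minus. rewrite (RtoC_mult (cos x)), (RtoC_mult (/ rho g (S j))).
        rewrite RtoC_inv by lra.
        transitivity (Cplus (Cmult (Cplus (expi t) (Cmult (Cmult (th d) (th d)) (expi (- t))))
            (Copp (Cmult K (RtoC (sin x ^ n * (b * fam (1 - g) (S j) x))))))
          (Cmult (Cmult (RtoC 2) (Cmult (th d) (Cinv (RtoC (rho g (S j))))))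
             (Cmult K (RtoC (sin x ^ n * (a * fam g (S j) x)))))).
        { field; auto. }
        rewrite E, RtoC_mult. ring.
      * match goal with |- Cmult _ (RtoC ?u) = Copp (Cmult _ (RtoC ?v)) => assert (EX : u = v) end.
        { transitivity (sin x ^ n * (b / (INR j + g) * (sin x * sin x * fam (1 - g) (S (S j)) x)));
            [ | simpl; ring ].
          rewrite R2, Hab. simpl rho. field. lra. }
        rewrite EX. ring.
Qed.

Lemma smoothC_ext (f h : R -> C) : (forall t, f t = h t) -> smoothC f -> smoothC h.
Proof.
  intros E [F1 F2]; split; [ revert F1 | revert F2 ]; apply smooth_ext; intros t _; now rewrite E.
Qed.

Lemma smoothC_half (b : R) : smoothC (fun t => expi ((t + b) / 2)).
Proof.
  apply smoothC_ext with (fun t => expi (/ 2 * t + b / 2)); [ | apply smoothC_expi ].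
  intros; f_equal; field.
Qed.

Lemma smoothC_half_opp (b : R) : smoothC (fun t => expi (- ((t + b) / 2))).
Proof.
  apply smoothC_ext with (fun t => expi (- / 2 * t + - b / 2)); [ | apply smoothC_expi ].
  intros; f_equal; field.
Qed.

Lemma smoothC_half0 : smoothC (fun t => expi (t / 2)).
Proof.
  apply smoothC_ext with (fun t => expi ((t + 0) / 2)); [ | apply smoothC_half ].
  intros; f_equal; field.
Qed.

Lemma smoothC_half0_opp : smoothC (fun t => expi (- (t / 2))).
Proof.
  apply smoothC_ext with (fun t => expi (- ((t + 0) / 2))); [ | apply smoothC_half_opp ].
  intros; f_equal; field.
Qed.

Lemma smoothC_coef1 (c : C) : smoothC (fun t => Cmult c (expi (t / 2))).
Proof. apply smoothC_mult; auto using smoothC_const, smoothC_half0. Qed.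

Lemma smoothC_coef2 (c : C) : smoothC (fun t => Cmult c (expi (- (t / 2)))).
Proof. apply smoothC_mult; auto using smoothC_const, smoothC_half0_opp. Qed.

Lemma wave_smooth (v : vert) : smoothC (wave_p v) /\ smoothC (wave_y v).
Proof.
  induction v as [|d v [HP HY]] using vert_ind_sh.
  - split.
    + apply smoothC_ext with (fun t => expi ((g - / 2) * t + 0)); [ | apply smoothC_expi ].
      intros t. unfold wave_p, wave. simpl. f_equal; ring.
    + apply smoothC_ext with (fun t => Cmult (RtoC (-1)) (expi (- (g - / 2) * t + 0))).
      * intros t. unfold wave_y, wave. cbn [sec sec1 sec2 sec3 origin snd].
        replace (- ((g - / 2) * t)) with (- (g - / 2) * t + 0) by ring.
        apply C_ext; simpl; ring.
      * apply smoothC_mult; auto using smoothC_const, smoothC_expi.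
  - split; (eapply smoothC_ext; [ intros t; symmetry; first [ apply wave_p_sh | apply wave_y_sh ] | ]);
      apply smoothC_plus; apply smoothC_mult; auto using smoothC_half0, smoothC_coef1, smoothC_coef2.
Qed.

Lemma ord_step (n : nat) (e : dir) (v : vert) (a : R) : J a ->
  ordC n (wave_p v) a -> ordC n (wave_y v) a -> ordC n (wave_p (sh e v)) a /\ ordC n (wave_y (sh e v)) a.
Proof.
  intros Ja HP HY. destruct (wave_smooth v) as [SP SY].
  split; (eapply ordC_ext; [ intros t; symmetry; first [ apply wave_p_sh | apply wave_y_sh ] | ]);
    (apply ordC_plus; [ | | auto | | ]);
    auto using ordC_mult, smoothC_mult, smoothC_half0, smoothC_coef1, smoothC_coef2.
Qed.

Lemma J_shift_locally (a : R) : locally a (fun t => J (t - a)).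
Proof.
  apply (locally_interval _ a (a - PI) (a + PI)); simpl; pose proof PI_RGT_0; try lra.
  intros y H1 H2; unfold J; simpl in *; lra.
Qed.

Lemma ord_sin_pow_centered (m n : nat) (a : R) (f h : R -> C) : smoothC h -> ordC n h 0 ->
  (forall t, J (t - a) -> f t = Cmult (RtoC (sin (t - a) ^ m)) (h (t - a))) ->
  ordC (m + n) f a.
Proof.
  intros Sh Oh E.
  apply ordC_ext_loc with (fun t => Cmult (RtoC (sin (t - a) ^ m)) (h (t - a))).
  - generalize (J_shift_locally a). apply filter_imp. intros t Ht; now rewrite E.
  - apply (ordC_shift (m + n) (fun x => Cmult (RtoC (sin x ^ m)) (h x))).
    now apply ordC_sin_pow.
Qed.

(** At odd points the order is the power of [sin] in [axis_wave]; at even points the last,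
    degenerate step adds one. *)
Lemma ord_axis (d : dir) (j : nat) :
  ordC j (wave_p (ax d j)) (psi d) /\ ordC j (wave_y (ax d j)) (psi d).
Proof.
  destruct j as [|j]; [ repeat split | ].
  destruct (Nat.Even_or_Odd j) as [[i ->]|[i ->]];
    destruct (axis_wave d i) as (K & a & b & Hab & W).
  - rewrite <- (Nat.add_0_r (S (2 * i))).
    split.
    + apply ord_sin_pow_centered with (fun x => Cmult K (RtoC (a * fam g (S i) x))).
      * apply smoothC_mult, smoothC_RtoC; auto using smoothC_const, smooth_scal, smooth_fam.
      * repeat split.
      * intros t Ht. rewrite Nat.add_0_r. destruct (W t Ht) as [-> _]. rewrite RtoC_mult. ring.
    + apply ord_sin_pow_centered with (fun x => Cmult (Copp K) (RtoC (b * fam (1 - g) (S i) x))).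
      * apply smoothC_mult, smoothC_RtoC; auto using smoothC_const.
        apply smooth_scal, smooth_fam; lra.
      * repeat split.
      * intros t Ht. rewrite Nat.add_0_r. destruct (W t Ht) as [_ ->]. rewrite RtoC_mult. ring.
  - replace (S (2 * i + 1)) with (S (2 * i) + 1)%nat by lia.
    replace (ax d (S (2 * i) + 1)) with (sh d (ax d (S (2 * i)))) by (rewrite sh_ax; f_equal; lia).
    assert (Ew : w (sh d (ax d (S (2 * i)))) = RtoC (rho g (S i))).
    { rewrite sh_ax. replace (S (S (2 * i))) with (2 * S i)%nat by lia. apply w_even_ax. }
    assert (Hg' : 0 < 1 - g < 1) by lra.
    pose proof (pos_INR i) as Pi_.
    (* [fam_raise] at 0, where its left-hand side vanishes, makes the two terms of the degenerate
       step cancel. *)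
    assert (Z : a * fam g (S i) 0 = rho g (S i) * (b * fam (1 - g) (S i) 0)).
    { pose proof (fam_raise g Hg (S i) 0 J0) as E. rewrite sin_0, cos_0, S_INR in E.
      rewrite Hab. simpl rho.
      replace (fam (1 - g) (S i) 0) with ((INR i + 1 - g) * fam g (S i) 0 / (INR i + g))
        by (apply Rmult_eq_reg_l with (INR i + g); [ field_simplify; lra | lra ]).
      field. lra. }
    pose proof (smooth_fam g Hg (S i)) as SA. pose proof (smooth_fam (1 - g) Hg' (S i)) as SB.
    set (h1 := fun x => Cmult K (RtoC (a * fam g (S i) x))).
    set (h2 := fun x => Cmult (Copp K) (RtoC (b * fam (1 - g) (S i) x))).
    assert (S1 : smoothC h1)
      by (apply smoothC_mult, smoothC_RtoC; auto using smoothC_const, smooth_scal).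
    assert (S2 : smoothC h2)
      by (apply smoothC_mult, smoothC_RtoC; auto using smoothC_const, smooth_scal).
    assert (E2 : expi (psi d / 2) = Cmult (th d) (expi (- (psi d / 2)))).
    { unfold th. rewrite <- expi_plus. f_equal; field. }
    split.
    + apply ord_sin_pow_centered with (fun x => Cplus (Cmult (expi ((x + psi d) / 2)) (h1 x))
        (Cmult (Cmult (Cmult (th d) (RtoC (rho g (S i)))) (expi (- ((x + psi d) / 2)))) (h2 x))).
      * apply smoothC_plus; auto using smoothC_mult, smoothC_half, smoothC_half_opp, smoothC_const.
      * apply ordC_1. rewrite Rplus_0_l, E2. unfold h1, h2. rewrite Z, !RtoC_mult. ring.
      * intros t Ht. destruct (W t Ht) as [W1 W2]. rewrite wave_p_sh, W1, W2, Ew.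
        replace (t - psi d + psi d) with t by ring. unfold h1, h2. rewrite !RtoC_mult. ring.
    + apply ord_sin_pow_centered with (fun x => Cplus
        (Cmult (Cmult (Cdiv (RtoC (rho g (S i))) (w (ax d (S (2 * i))))) (expi ((x + psi d) / 2))) (h2 x))
        (Cmult (Cmult (Cdiv (th d) (w (ax d (S (2 * i))))) (expi (- ((x + psi d) / 2)))) (h1 x))).
      * apply smoothC_plus; auto using smoothC_mult, smoothC_half, smoothC_half_opp, smoothC_const.
      * apply ordC_1. rewrite Rplus_0_l, E2. unfold h1, h2. rewrite Z, !RtoC_mult.
        field. apply w_neq_0.
      * intros t Ht. destruct (W t Ht) as [W1 W2]. rewrite wave_y_sh, W1, W2, Ew.
        replace (t - psi d + psi d) with t by ring. unfold h1, h2. rewrite !RtoC_mult. ring.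
Qed.

Lemma cnt_sh_same (d : dir) (v : vert) : cnt d (sh d v) = S (cnt d v).
Proof. destruct v as [[k l] n], d; reflexivity. Qed.

Lemma cnt_sh_other (d e : dir) (v : vert) : d <> e -> cnt d (sh e v) = cnt d v.
Proof. destruct v as [[k l] n], d, e; intros; congruence || reflexivity. Qed.

Lemma vert_axis_or (d : dir) (v : vert) :
  v = ax d (cnt d v) \/ exists e v', d <> e /\ v = sh e v'.
Proof.
  destruct v as [[[|k] [|l]] [|n]], d; simpl; auto; right.
  all: first
    [ exists D3; eexists (_, _, _); split; [ discriminate | reflexivity ]
    | exists D2; eexists (_, _, _); split; [ discriminate | reflexivity ]
    | exists D1; eexists (_, _, _); split; [ discriminate | reflexivity ] ].
Qed.

(** By path independence the steps in direction [d] may come first; the others preserve the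
    order. *)
Lemma wave_ord (d : dir) (v : vert) :
  ordC (cnt d v) (wave_p v) (psi d) /\ ordC (cnt d v) (wave_y v) (psi d).
Proof.
  remember (lev v) as N eqn:EN. revert v EN.
  induction N as [N IH] using (well_founded_induction lt_wf). intros v EN.
  destruct (vert_axis_or d v) as [->|(e & v' & Hde & ->)].
  - replace (cnt d (ax d (cnt d v))) with (cnt d v) by (destruct d; reflexivity).
    apply ord_axis.
  - rewrite lev_sh in EN. rewrite cnt_sh_other by auto.
    destruct (IH (lev v') ltac:(lia) v' eq_refl). now apply ord_step.
Qed.

Local Arguments Psi : simpl never.

(** * Representation of the wave function in the Gegenbauer spans *)

Definition PsiC (h : R) (k m : nat) (f : R -> C) : Prop :=
  Psi h k m (fun t => fst (f t)) /\ Psi h k m (fun t => snd (f t)).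

Lemma PsiC_plus (h : R) (k m : nat) (f f' : R -> C) : 0 < h < 1 ->
  PsiC h k m f -> PsiC h k m f' -> PsiC h k m (fun t => Cplus (f t) (f' t)).
Proof. intros Hh [F1 F2] [H1 H2]; split; simpl; now apply Psi_plus. Qed.

Lemma PsiC_const (h : R) (k m : nat) (c : C) (f : R -> C) : 0 < h < 1 ->
  PsiC h k m f -> PsiC h k m (fun t => Cmult c (f t)).
Proof.
  intros Hh [F1 F2]; split; simpl.
  - apply Psi_ext with (fun t => fst c * fst (f t) + - snd c * snd (f t)); [ intros; ring | ].
    now apply Psi_lin.
  - apply (Psi_lin h m k (fst c) (snd c)); auto.
Qed.

Lemma PsiC_trig (h : R) (k m : nat) (f : R -> C) : 0 < h < 1 -> PsiC h (S k) m f ->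
  PsiC h k (S (S m)) (fun t => Cmult (expi t) (f t)) /\
  PsiC h k (S (S m)) (fun t => Cmult (expi (- t)) (f t)).
Proof.
  intros Hh [F1 F2].
  pose proof (Psi_cos h Hh m k _ F1) as C1. pose proof (Psi_cos h Hh m k _ F2) as C2.
  pose proof (Psi_S h _ _ _ (Psi_sin h k m _ F1)) as S1.
  pose proof (Psi_S h _ _ _ (Psi_sin h k m _ F2)) as S2.
  split; split; simpl; rewrite ?cos_neg.
  - apply Psi_ext with (fun t => 1 * (cos t * fst (f t)) + -1 * (sin t * snd (f t))); [ intros; ring | ].
    now apply Psi_lin.
  - apply (Psi_plus h k _ (fun t => cos t * snd (f t)) (fun t => sin t * fst (f t))); auto.
  - apply Psi_ext with (fun t => cos t * fst (f t) + sin t * snd (f t)).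
    + intros; rewrite cos_neg, sin_neg; ring.
    + now apply Psi_plus.
  - apply Psi_ext with (fun t => 1 * (cos t * snd (f t)) + -1 * (sin t * fst (f t))).
    + intros; rewrite cos_neg, sin_neg; ring.
    + now apply Psi_lin.
Qed.

(** The first component belongs to the parameter [g], the second to [1 - g]; [n] counts the zeros at
    0 that have been divided out. *)
Definition Rep (v : vert) (n k m : nat) : Prop :=
  exists f h : R -> C, PsiC g k m f /\ PsiC (1 - g) k m h /\
    forall t, J t -> wave_p v t = Cmult (RtoC (sin t ^ n)) (f t) /\
                     wave_y v t = Cmult (RtoC (sin t ^ n)) (h t).

(** The components get mixed; [Psi_dual] moves the foreign one into the right span at the same price
    that [Psi_cos] charges. *)
Lemma Rep_two_step (d e : dir) (v : vert) (n k m : nat) :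
  Rep v n (S k) m -> Rep (sh e (sh d v)) n k (S (S m)).
Proof.
  assert (Hg' : 0 < 1 - g < 1) by lra.
  intros (f & h & Hf & Hh & E).
  destruct (PsiC_trig g k m f Hg Hf) as [F1 F2].
  destruct (PsiC_trig (1 - g) k m h Hg' Hh) as [H1 H2].
  assert (Fd : PsiC (1 - g) k (S (S m)) f).
  { destruct Hf; split; apply Psi_dual; auto; now replace (1 - (1 - g)) with g by ring. }
  assert (Hd : PsiC g k (S (S m)) h) by (destruct Hh; split; now apply Psi_dual).
  exists (fun t => Cplus (Cplus (Cmult (expi t) (f t))
      (Cmult (Cdiv (Cmult (Cmult (th d) (th e)) (w (sh e (sh d v)))) (w v)) (Cmult (expi (- t)) (f t))))
      (Cmult (Cplus (Cmult (th d) (w (sh d v)))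
        (Cdiv (Cmult (Cmult (th e) (w (sh e (sh d v)))) (w (sh d v))) (w v))) (h t))).
  exists (fun t => Cplus (Cplus (Cmult (Cdiv (w (sh e (sh d v))) (w v)) (Cmult (expi t) (h t)))
      (Cmult (Cmult (th d) (th e)) (Cmult (expi (- t)) (h t))))
      (Cmult (Cplus (Cdiv (Cmult (th d) (w (sh e (sh d v)))) (Cmult (w v) (w (sh d v))))
        (Cdiv (th e) (w (sh d v)))) (f t))).
  split; [ | split ].
  - apply PsiC_plus; auto; [ apply PsiC_plus; auto | ]; apply PsiC_const; auto.
  - apply PsiC_plus; auto; [ apply PsiC_plus; auto | ]; apply PsiC_const; auto.
  - intros t Ht. destruct (E t Ht) as [E1 E2]. rewrite wave_p_two_step, wave_y_two_step, E1, E2.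
    split; ring.
Qed.

Lemma PsiC_drop (h : R) (n k m : nat) (p f : R -> C) : 0 < h < 1 -> PsiC h k (S m) f ->
  (forall t, J t -> p t = Cmult (RtoC (sin t ^ n)) (f t)) -> ordC (S n) p 0 ->
  exists f1, PsiC h (S k) m f1 /\ forall t, J t -> p t = Cmult (RtoC (sin t ^ S n)) (f1 t).
Proof.
  intros Hh [F1 F2] E [O1 O2].
  assert (Z1 : fst (f 0) = 0).
  { apply (ord_sin_pow_S n (fun t => fst (f t))); [ eapply Psi_smooth; eauto | ].
    revert O1. apply ord_ext; auto using J0. intros t Ht; rewrite E by auto. simpl; ring. }
  assert (Z2 : snd (f 0) = 0).
  { apply (ord_sin_pow_S n (fun t => snd (f t))); [ eapply Psi_smooth; eauto | ].
    revert O2. apply ord_ext; auto using J0. intros t Ht; rewrite E by auto. simpl; ring. }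
  destruct (Psi_drop h Hh _ _ _ F1 Z1) as (a & Ha & Ea).
  destruct (Psi_drop h Hh _ _ _ F2 Z2) as (b & Hb & Eb).
  exists (fun t => (a t, b t)); split; [ split; auto | ].
  intros t Ht. rewrite E by auto. apply C_ext; simpl; rewrite Ea, Eb by auto; ring.
Qed.

Hypothesis psi_D3 : psi D3 = 0.

(** The zero of order [S n] at 0 yields one more factor [sin], which wins back a base index and
    removes a dimension. *)
Lemma Rep_drop (v : vert) (n k m : nat) :
  Rep v n k (S m) -> cnt D3 v = S n -> Rep v (S n) (S k) m.
Proof.
  assert (Hg' : 0 < 1 - g < 1) by lra.
  intros (f & h & Hf & Hh & E) Hc. destruct (wave_ord D3 v) as [O1 O2].
  rewrite Hc, psi_D3 in O1, O2.
  destruct (PsiC_drop g n k m (wave_p v) f) as (f1 & Hf1 & E1); auto; [ intros; now apply E | ].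
  destruct (PsiC_drop (1 - g) n k m (wave_y v) h) as (h1 & Hh1 & E2); auto; [ intros; now apply E | ].
  exists f1, h1; auto.
Qed.

Lemma PsiC_fam (h : R) (k : nat) (c : C) : 0 < h < 1 ->
  PsiC h k 0 (fun t => Cmult c (RtoC (fam h k t))).
Proof. intros Hh; apply PsiC_const; auto. split; [ apply Psi_fam | apply Psi_0 ]. Qed.

Lemma Rep_axis (q : nat) : Rep (0, 0, S (2 * q))%nat (S (2 * q)) (S q) 0.
Proof.
  destruct (axis_wave D3 q) as (K & a & b & _ & W).
  exists (fun t => Cmult (Cmult K (RtoC a)) (RtoC (fam g (S q) t))),
    (fun t => Cmult (Cmult (Copp K) (RtoC b)) (RtoC (fam (1 - g) (S q) t))).
  split; [ apply PsiC_fam; auto | split; [ apply PsiC_fam; lra | ] ].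
  intros t Ht. rewrite psi_D3 in W. specialize (W t). rewrite Rminus_0_r in W.
  destruct (W Ht) as [W1 W2]. change (0, 0, S (2 * q))%nat with (ax D3 (S (2 * q))).
  rewrite W1, W2, !RtoC_mult. split; ring.
Qed.

(** Two steps in directions [D1] or [D2] keep the third coordinate, so they lower [q] by one and
    raise [m] by two, exactly the cost in [Rep_two_step]. *)
Lemma Rep_dominant (m : nat) : forall q k l, (k + l = m)%nat ->
  Rep (k, l, m + S (2 * q))%nat (m + S (2 * q)) (S q) m.
Proof.
  induction m as [m IH] using (well_founded_induction lt_wf). intros q k l Hkl.
  destruct m as [|[|m]].
  - replace k with 0%nat by lia. replace l with 0%nat by lia. apply Rep_axis.
  (* For [m = 1] the pair of steps must include one in direction [D3]; the zero that it brings
     restores the base index and leaves one extra dimension. *)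
  - apply Rep_drop; [ | reflexivity ].
    destruct k as [|k].
    + replace l with 1%nat by lia.
      apply (Rep_two_step D3 D2 (0, 0, S (2 * q))%nat), Rep_axis.
    + replace k with 0%nat by lia. replace l with 0%nat by lia.
      apply (Rep_two_step D3 D1 (0, 0, S (2 * q))%nat), Rep_axis.
  - replace (S (S m) + S (2 * q))%nat with (m + S (2 * S q))%nat by lia.
    destruct k as [|[|k]].
    + replace l with (S (S m)) by lia.
      apply (Rep_two_step D2 D2 (0, m, _)%nat), IH; lia.
    + replace l with (S m) by lia.
      apply (Rep_two_step D2 D1 (0, m, _)%nat), IH; lia.
    + apply (Rep_two_step D1 D1 (k, l, _)%nat), IH; lia.
Qed.

(** The solutions of [p = K * Cconj p] form a real line spanned by [tau]. The coordinate on it is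
    one real linear form for all [p], so it keeps functions inside the spans [Psi]. *)
Lemma real_split (K : C) : Cmult K (Cconj K) = RtoC 1 ->
  exists (tau : C) (a b : R), tau <> RtoC 0 /\ forall p, p = Cmult K (Cconj p) ->
    p = Cmult tau (RtoC (a * fst p + b * snd p)).
Proof.
  (* The line is spanned by the inverse of [1 + Cconj K], except for [K = -1], when it is the
     imaginary axis. *)
  intros HK. destruct (Ceq_dec (Cplus (RtoC 1) (Cconj K)) (RtoC 0)) as [E|N].
  - exists Ci, 0, 1. split; [ intros H; injection H; lra | ].
    assert (EK : K = RtoC (-1)).
    { apply C_ext; [ apply (f_equal fst) in E | apply (f_equal snd) in E ]; simpl in *; lra. }
    intros p Hp. rewrite EK in Hp. apply (f_equal fst) in Hp. simpl in Hp.
    apply C_ext; simpl; lra.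
  - exists (Cinv (Cplus (RtoC 1) (Cconj K))), 2, 0. split.
    + intros H. assert (E := Cinv_r _ N). rewrite H, Cmult_0_r in E. injection E; lra.
    + intros p Hp. apply Cmult_eq_reg_l with (Cplus (RtoC 1) (Cconj K)); auto.
      transitivity (RtoC (2 * fst p + 0 * snd p)); [ | field; auto ].
      transitivity (Cplus p (Cconj p)).
      * transitivity (Cplus p (Cmult (Cconj K) p)); [ ring | ]. f_equal.
        rewrite Hp at 1. rewrite Cmult_assoc, (Cmult_comm (Cconj K)), HK. ring.
      * apply C_ext; simpl; ring.
Qed.

(** The radius at [sh d v] is the value of [- f / h] at [psi d]. *)
Lemma radius_vanishing (d : dir) (v : vert) (tau : C) (f h : R -> R) (r : R) :
  tau <> RtoC 0 -> smooth f -> smooth h -> w (sh d v) = RtoC r ->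
  (forall t, J t -> wave_p v t = Cmult tau (RtoC (f t)) /\ wave_y v t = Cmult tau (RtoC (h t))) ->
  ord (S (cnt d v)) (fun t => f t + r * h t) (psi d).
Proof.
  intros Nt Sf Sh Er E. destruct (wave_ord d (sh d v)) as [O _].
  rewrite cnt_sh_same in O.
  (* Removing [tau] and half of the phase leaves the real part
     [cos ((t - psi d) / 2) * (f t + r * h t)], whose cosine is 1 at [psi d]. *)
  assert (O' : ordC (S (cnt d v)) (fun t => Cmult (Cmult (Cinv tau) (expi (- (psi d / 2)))) (wave_p (sh d v) t)) (psi d)).
  { apply ordC_mult; auto using smoothC_const. apply wave_smooth. }
  destruct O' as [O' _].
  apply ord_cancel with (fun t => cos (/ 2 * t + - psi d / 2)); auto using smooth_cos_aff.
  - apply smooth_plus; auto using smooth_scal.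
  - replace (/ 2 * psi d + - psi d / 2) with 0 by field. rewrite cos_0; lra.
  - revert O'. apply ord_ext; auto. intros t Ht. rewrite wave_p_sh, Er.
    destruct (E t Ht) as [-> ->].
    transitivity (fst (Cplus (Cmult (expi (/ 2 * t + - psi d / 2)) (RtoC (f t)))
      (Cmult (expi (- (/ 2 * t + - psi d / 2))) (RtoC (r * h t))))).
    + f_equal.
      replace (/ 2 * t + - psi d / 2) with (t / 2 + - (psi d / 2)) by field.
      replace (- (t / 2 + - (psi d / 2))) with (psi d + (- (t / 2) + - (psi d / 2))) by field.
      rewrite !expi_plus, RtoC_mult. unfold th. field; auto.
    + simpl. rewrite cos_neg. ring.
Qed.

Hypothesis psi_D1 : psi D1 < 0.
Hypothesis psi_D2 : 0 < psi D2.

Let radius (v : vert) : R := fst (w v).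

(** At such a parameter the wave does not vanish, so its components are not both identically
    zero. *)
Lemma exists_generic : exists t, J t /\ forall d, expi (2 * t) <> Cmult (th d) (th d).
Proof.
  assert (A : forall t d, J t -> expi (2 * t) = Cmult (th d) (th d) -> sin (t - psi d) = 0).
  { intros t d Ht E. unfold th in E. rewrite <- expi_plus in E.
    assert (E' : expi (2 * (t - psi d)) = RtoC 1).
    { replace (2 * (t - psi d)) with (2 * t + - (psi d + psi d)) by ring.
      rewrite expi_plus, E. apply expi_inv_r. }
    apply (f_equal fst) in E'. simpl in E'. rewrite cos_2a_sin in E'. nra. }
  pose proof (Hpsi D1) as H1. pose proof (Hpsi D2) as H2. unfold J in H1, H2.
  assert (B : forall x, 0 < Rabs x < PI -> sin x <> 0).
  { intros x Hx E. unfold Rabs in Hx. destruct (Rcase_abs x).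
    - pose proof (sin_gt_0 (- x)). rewrite sin_neg in *. lra.
    - pose proof (sin_gt_0 x). lra. }
  set (t := Rmin (psi D2) (PI + psi D1) / 2).
  assert (Ht : 0 < t /\ t < psi D2 /\ t < PI + psi D1).
  { unfold t. pose proof (Rmin_l (psi D2) (PI + psi D1)). pose proof (Rmin_r (psi D2) (PI + psi D1)).
    assert (0 < Rmin (psi D2) (PI + psi D1)) by (apply Rmin_pos; lra). lra. }
  exists t; split; [ unfold J; lra | ].
  intros d E. apply A in E; [ | unfold J; lra ]. revert E. apply B.
  destruct d; rewrite ?psi_D3; unfold Rabs; destruct (Rcase_abs _); lra.
Qed.

Lemma radius_signs (q k l : nat) :
  0 < radius (sh D1 (k, l, k + l + S (2 * q))%nat) * radius (sh D3 (k, l, k + l + S (2 * q))%nat) /\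
  0 < radius (sh D2 (k, l, k + l + S (2 * q))%nat) * radius (sh D3 (k, l, k + l + S (2 * q))%nat).
Proof.
  set (v := (k, l, k + l + S (2 * q))%nat). set (n := (k + l + S (2 * q))%nat) in *.
  assert (Hlev : Nat.even (lev v) = false).
  { unfold v, n; simpl. replace (k + l + (k + l + S (q + (q + 0))))%nat with (S (2 * (k + l + q))) by lia.
    rewrite Nat.even_succ, Nat.odd_mul. reflexivity. }
  assert (Hev : forall d, w (sh d v) = RtoC (radius (sh d v))).
  { intros d. apply w_even. rewrite lev_sh, Nat.even_succ, <- Nat.negb_even, Hlev. reflexivity. }
  assert (Hg' : 0 < 1 - g < 1) by lra.
  destruct (Rep_dominant (k + l) q k l eq_refl) as (F & H & HF & HH & E).
  fold n in E. change (k, l, n) with v in E.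
  set (K := Copp (Cmult (mono psi v) (w v))).
  assert (HK : Cmult K (Cconj K) = RtoC 1).
  { unfold K. rewrite Cconj_opp, Cconj_mult.
    transitivity (Cmult (Cmult (mono psi v) (Cconj (mono psi v))) (Cmult (w v) (Cconj (w v)))); [ ring | ].
    rewrite mono_unit, w_odd by auto. ring. }
  destruct (real_split K HK) as (tau & a & b & Nt & RS).
  set (f := fun t => a * fst (F t) + b * snd (F t)).
  set (h := fun t => a * fst (H t) + b * snd (H t)).
  assert (Pf : Psi g (S q) (k + l) f) by (apply Psi_lin; apply HF).
  assert (Ph : Psi (1 - g) (S q) (k + l) h) by (apply Psi_lin; apply HH).
  pose proof (Psi_smooth g Hg _ _ _ Pf) as Sf. pose proof (Psi_smooth (1 - g) Hg' _ _ _ Ph) as Sh.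
  assert (PY : forall t, J t -> wave_p v t = Cmult tau (RtoC (sin t ^ n * f t)) /\
                                wave_y v t = Cmult tau (RtoC (sin t ^ n * h t))).
  { intros t Ht. pose proof (wave_reality v t) as W. rewrite Hlev in W.
    destruct W as [W1 W2]. destruct (E t Ht) as [E1 E2].
    assert (W1' : wave_p v t = Cmult K (Cconj (wave_p v t))) by (rewrite W1 at 1; unfold K; ring).
    assert (W2' : wave_y v t = Cmult K (Cconj (wave_y v t))) by (rewrite W2 at 1; unfold K; ring).
    rewrite (RS _ W1'), (RS _ W2'). rewrite E1, E2.
    split; do 2 f_equal; unfold f, h; simpl; ring. }
  assert (Ssn : smooth (fun t => sin t ^ n)) by auto using smooth_pow, smooth_sin.
  assert (RV : forall d, ord (S (cnt d v)) (fun t => sin t ^ n * (f t + radius (sh d v) * h t)) (psi d)).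
  { intros d. apply ord_ext with (fun t => sin t ^ n * f t + radius (sh d v) * (sin t ^ n * h t)); auto.
    - intros; ring.
    - apply radius_vanishing with tau; auto using smooth_mult. }
  assert (OV : forall d, psi d <> 0 -> forall f', smooth f' ->
    ord (cnt d v) (fun t => sin t ^ n * f' t) (psi d) -> ord (cnt d v) f' (psi d)).
  { intros d Hd f' Sf' O. apply ord_cancel with (fun t => sin t ^ n); auto.
    apply pow_nonzero, sin_J_neq_0; auto. }
  assert (OO : forall d, psi d <> 0 -> ord (cnt d v) f (psi d) /\ ord (cnt d v) h (psi d)).
  { intros d Hd. destruct (wave_ord d v) as [O1 O2].
    assert (X : forall p f', (forall t, J t -> p t = Cmult tau (RtoC (sin t ^ n * f' t))) ->
      smoothC p -> ordC (cnt d v) p (psi d) -> ord (cnt d v) (fun t => sin t ^ n * f' t) (psi d)).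
    { intros p f' Ep Sp Op.
      assert (O' : ordC (cnt d v) (fun t => Cmult (Cinv tau) (p t)) (psi d))
        by (apply ordC_mult; auto using smoothC_const).
      destruct O' as [O' _]. revert O'. apply ord_ext; auto. intros t Ht.
      rewrite Ep by auto.
      replace (Cmult (Cinv tau) (Cmult tau (RtoC (sin t ^ n * f' t)))) with (RtoC (sin t ^ n * f' t))
        by (field; auto). reflexivity. }
    destruct (wave_smooth v) as [SP SY].
    split; apply OV; auto; [ apply (X (wave_p v)) | apply (X (wave_y v)) ]; auto; intros; now apply PY. }
  assert (R1 : psi D1 <> 0) by lra. assert (R2 : psi D2 <> 0) by lra.
  destruct (OO D1 R1) as [A1 A2]. destruct (OO D2 R2) as [B1 B2].
  apply (sign_transfer k l (psi D1) (psi D2)) with (g := g) (q := q) (f := f) (h := h); auto.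
  - intros Z. destruct exists_generic as [t [Jt Ht]].
    apply (wave_neq_0 v t Ht). destruct (PY t Jt) as [-> ->]. destruct (Z t Jt) as [-> ->].
    rewrite Rmult_0_r. split; ring.
  - intros Z. apply (w_neq_0 (sh D1 v)). rewrite Hev, Z. reflexivity.
  - apply ord_cancel with (fun t => sin t ^ n); auto using smooth_plus, smooth_scal.
    + apply pow_nonzero, sin_J_neq_0; auto.
    + apply (RV D1).
  - apply ord_cancel with (fun t => sin t ^ n); auto using smooth_plus, smooth_scal.
    + apply pow_nonzero, sin_J_neq_0; auto.
    + apply (RV D2).
  (* At [psi D3 = 0] the factor [sin ^ n] accounts for [n] of the [S n] zeros, and the remaining one
     belongs to [f + r * h]. *)
  - apply (ord_sin_pow_S n (fun t => f t + radius (sh D3 v) * h t)); auto using smooth_plus, smooth_scal.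
    specialize (RV D3). rewrite psi_D3 in RV. exact RV.
Qed.

(** Exchanging a step in direction [D1] or [D2] for one in direction [D3] lowers [m] but raises [q];
    hence the induction covers all [q], although the centres of [Q_H] have [q = 0]. *)
Theorem radius_pos (m : nat) : forall k l q, (k + l = m)%nat ->
  0 < radius (k, l, m + 2 * q)%nat.
Proof.
  induction m as [|m IH]; intros k l q Hkl.
  - replace k with 0%nat by lia. replace l with 0%nat by lia. unfold radius.
    change (0, 0, 0 + 2 * q)%nat with (ax D3 (2 * q)). rewrite w_even_ax. simpl.
    now apply rho_pos.
  - destruct k as [|k].
    + destruct l as [|l]; [ lia | ].
      pose proof (proj2 (radius_signs q 0 l)) as S1. pose proof (IH 0%nat l (S q) ltac:(lia)) as S2.
      cbn [sh] in S1.
      replace (0 + l + S (2 * q))%nat with (S m + 2 * q)%nat in S1 by lia.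
      replace (S (S m + 2 * q)) with (m + 2 * S q)%nat in S1 by lia.
      apply Rmult_lt_reg_r with (1 := S2). rewrite Rmult_0_l. exact S1.
    + pose proof (proj1 (radius_signs q k l)) as S1. pose proof (IH k l (S q) ltac:(lia)) as S2.
      cbn [sh] in S1.
      replace (k + l + S (2 * q))%nat with (S m + 2 * q)%nat in S1 by lia.
      replace (S (S m + 2 * q)) with (m + 2 * S q)%nat in S1 by lia.
      apply Rmult_lt_reg_r with (1 := S2). rewrite Rmult_0_l. exact S1.
Qed.

End Wave.

(** * Kites and sectors *)

Lemma atan_polar (x y : R) : 0 < x -> exists m, 0 < m /\ x = m * cos (atan (y / x)) /\ y = m * sin (atan (y / x)).
Proof.
  intros Hx. set (s := y / x).
  assert (H : 0 < sqrt (1 + Rsqr s)) by (apply sqrt_lt_R0; pose proof (Rle_0_sqr s); lra).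
  exists (x * sqrt (1 + Rsqr s)); split; [ now apply Rmult_lt_0_compat | ].
  rewrite cos_atan, sin_atan. set (k := sqrt (1 + Rsqr s)) in *. clearbody k.
  split; [ | unfold s ]; field; lra.
Qed.

Lemma carg_polar (u : C) : u <> RtoC 0 ->
  - PI < carg u <= PI /\ exists m, 0 < m /\ fst u = m * cos (carg u) /\ snd u = m * sin (carg u).
Proof.
  intros Hu. destruct u as [x y]. unfold carg; simpl.
  pose proof PI_RGT_0 as HPI. pose proof (atan_bound (y / x)) as B.
  destruct (Rlt_dec 0 x) as [Hx|Hx]; [ split; [ lra | now apply atan_polar ] | ].
  destruct (Rlt_dec x 0) as [Hx'|Hx'].
  - destruct (atan_polar (- x) (- y)) as (m & Hm & E1 & E2); [ lra | ].
    replace (- y / - x) with (y / x) in * by (field; lra).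
    assert (Sg : 0 <= y -> atan (y / x) <= 0).
    { intros Hy. destruct (Rle_lt_dec (atan (y / x)) 0); auto.
      assert (0 < sin (atan (y / x))) by (apply sin_gt_0; lra). nra. }
    assert (Sg' : ~ 0 <= y -> 0 < atan (y / x)).
    { intros Hy. destruct (Rlt_le_dec 0 (atan (y / x))); auto.
      assert (0 <= sin (- atan (y / x))) by (apply sin_ge_0; lra). rewrite sin_neg in *. nra. }
    destruct (Rle_dec 0 y) as [Hy|Hy].
    + split; [ specialize (Sg Hy); lra | ]. exists m; split; auto.
      rewrite neg_cos, neg_sin. lra.
    + split; [ specialize (Sg' Hy); lra | ]. exists m; split; auto.
      replace (atan (y / x) - PI) with (- (PI - atan (y / x))) by ring.
      rewrite cos_neg, sin_neg.
      replace (PI - atan (y / x)) with (- atan (y / x) + PI) by ring.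
      rewrite neg_cos, neg_sin, cos_neg, sin_neg. lra.
  - assert (x = 0) as -> by lra. destruct (Rlt_dec 0 y) as [Hy|Hy].
    + split; [ lra | ]. exists y. rewrite cos_PI2, sin_PI2. lra.
    + destruct (Rlt_dec y 0) as [Hy'|Hy'].
      * split; [ lra | ]. exists (- y). rewrite cos_neg, sin_neg, cos_PI2, sin_PI2. lra.
      * exfalso; apply Hu. assert (y = 0) as -> by lra. reflexivity.
Qed.

Lemma cos_eq_1 (d : R) : cos d = 1 -> - (2 * PI) < d < 2 * PI -> d = 0.
Proof.
  intros H Hd. destruct (Req_dec (d / 2) 0) as [|N]; [ lra | ].
  exfalso. apply (sin_J_neq_0 (d / 2)); auto; [ unfold J; lra | ].
  replace d with (2 * (d / 2)) in H by field. rewrite cos_2a_sin in H. nra.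
Qed.

Lemma carg_unique (u : C) (m a : R) :
  0 < m -> fst u = m * cos a -> snd u = m * sin a -> - PI < a <= PI -> carg u = a.
Proof.
  intros Hm E1 E2 Ha.
  assert (Hu : u <> RtoC 0).
  { intros ->. simpl in *. pose proof (sin2_cos2 a) as P. unfold Rsqr in P.
    assert (cos a = 0) by (apply Rmult_eq_reg_l with m; lra).
    assert (sin a = 0) by (apply Rmult_eq_reg_l with m; lra). nra. }
  destruct (carg_polar u Hu) as [B (m' & Hm' & F1 & F2)].
  set (b := carg u) in *.
  pose proof (sin2_cos2 a) as Pa. pose proof (sin2_cos2 b) as Pb. unfold Rsqr in *.
  assert (M : m = m').
  { assert (Q : m * m = m' * m').
    { transitivity (fst u * fst u + snd u * snd u).
      - rewrite E1, E2. replace (m * cos a * (m * cos a) + m * sin a * (m * sin a))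
          with (m * m * (sin a * sin a + cos a * cos a)) by ring. rewrite Pa; ring.
      - rewrite F1, F2. replace (m' * cos b * (m' * cos b) + m' * sin b * (m' * sin b))
          with (m' * m' * (sin b * sin b + cos b * cos b)) by ring. rewrite Pb; ring. }
    nra. }
  subst m'.
  assert (cos b = cos a) by (apply Rmult_eq_reg_l with m; lra).
  assert (sin b = sin a) by (apply Rmult_eq_reg_l with m; lra).
  assert (b - a = 0); [ | lra ].
  apply cos_eq_1; [ | lra ]. rewrite cos_minus. rewrite H, H0. lra.
Qed.

(** The segment [a, b], seen from [w] and rotated by [s], avoids the negative real axis. *)
Definition clear (s w a b : C) : Prop := forall t, 0 <= t <= 1 ->
  let u := Cmult s (Cminus (Cplus a (Cmult (RtoC t) (Cminus b a))) w) in
  snd u = 0 -> 0 < fst u.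

Lemma clear_sym (s w a b : C) : clear s w a b -> clear s w b a.
Proof.
  intros H t Ht. specialize (H (1 - t) ltac:(lra)).
  replace (Cplus b (Cmult (RtoC t) (Cminus a b)))
    with (Cplus a (Cmult (RtoC (1 - t)) (Cminus b a))) by (rewrite RtoC_minus; ring).
  exact H.
Qed.

(** The difference of the principal arguments could be off by [2 * PI] only if the segment from [u]
    to [v] met the negative real axis. *)
Lemma carg_diff (u v : C) :
  (forall t, 0 <= t <= 1 -> snd u + t * (snd v - snd u) = 0 -> 0 < fst u + t * (fst v - fst u)) ->
  carg (Cdiv v u) = carg v - carg u.
Proof.
  intros H.
  assert (Hu : u <> RtoC 0).
  { intros ->. specialize (H 0 ltac:(lra)). simpl in H. lra. }
  assert (Hv : v <> RtoC 0).
  { intros ->. specialize (H 1 ltac:(lra)). simpl in H. lra. }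
  destruct (carg_polar u Hu) as [Bu (m & Hm & U1 & U2)].
  destruct (carg_polar v Hv) as [Bv (n & Hn & V1 & V2)].
  set (a := carg u) in *. set (b := carg v) in *.
  pose proof PI_RGT_0.
  assert (Cr : fst u * snd v - snd u * fst v = m * n * sin (b - a))
    by (rewrite U1, U2, V1, V2, sin_minus; ring).
  (* The quotient is the abscissa at which the segment crosses the real axis. *)
  assert (X : snd u * snd v < 0 -> 0 < (fst u * snd v - snd u * fst v) / (snd v - snd u)).
  { intros Hneg.
    assert (Dn : snd v - snd u <> 0) by (intros E; assert (snd v = snd u) as E' by lra; rewrite E' in Hneg; nra).
    specialize (H (- snd u / (snd v - snd u))).
    replace ((fst u * snd v - snd u * fst v) / (snd v - snd u)) with
      (fst u + - snd u / (snd v - snd u) * (fst v - fst u)) by (field; auto).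
    apply H; [ | field; auto ].
    destruct (Rlt_le_dec (snd u) 0).
    - assert (0 < snd v) by nra. split.
      + apply Rdiv_le_0_compat; lra.
      + apply Rmult_le_reg_r with (snd v - snd u); [ lra | ]. field_simplify; lra.
    - assert (0 < snd u) by nra. assert (snd v < 0) by nra.
      replace (- snd u / (snd v - snd u)) with (snd u / (snd u - snd v)) by (field; lra).
      split.
      + apply Rdiv_le_0_compat; lra.
      + apply Rmult_le_reg_r with (snd u - snd v); [ lra | ]. field_simplify; lra. }
  assert (D : fst u * fst u + snd u * snd u = m * m).
  { rewrite U1, U2. pose proof (sin2_cos2 a) as Pa. unfold Rsqr in Pa.
    replace (m * cos a * (m * cos a) + m * sin a * (m * sin a))
      with (m * m * (sin a * sin a + cos a * cos a)) by ring. rewrite Pa; ring. }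
  apply carg_unique with (n / m).
  - now apply Rdiv_lt_0_compat.
  - unfold Cdiv, Cinv; simpl. rewrite !Rmult_1_r, D, U1, U2, V1, V2, cos_minus. field; lra.
  - unfold Cdiv, Cinv; simpl. rewrite !Rmult_1_r, D, U1, U2, V1, V2, sin_minus. field; lra.
  - assert (Npi : forall c k z, 0 < k -> fst z = k * cos c -> snd z = k * sin c -> (snd z = 0 -> 0 < fst z) ->
      c <> PI).
    { intros c k z Hk Z1 Z2 Hz ->. rewrite cos_PI in Z1. rewrite sin_PI in Z2. lra. }
    assert (a <> PI).
    { apply (Npi a m u); auto. intros E. specialize (H 0 ltac:(lra)). lra. }
    assert (b <> PI).
    { apply (Npi b n v); auto. intros E. specialize (H 1 ltac:(lra)). lra. }
    assert (Hmn : 0 < m * n) by now apply Rmult_lt_0_compat.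
    split.
    + destruct (Rlt_le_dec (- PI) (b - a)) as [|Hle]; auto. exfalso.
      assert (0 < sin a) by (apply sin_gt_0; lra).
      assert (0 < sin (- b)) by (apply sin_gt_0; lra). rewrite sin_neg in *.
      assert (S1 : 0 <= sin (b - a + 2 * PI)) by (apply sin_ge_0; lra).
      rewrite sin_plus, cos_2PI, sin_2PI in S1.
      assert (0 < snd u) by (rewrite U2; nra). assert (snd v < 0) by (rewrite V2; nra).
      specialize (X ltac:(nra)). rewrite Cr in X.
      assert (0 <= m * n * sin (b - a)) by (apply Rmult_le_pos; lra).
      assert (P : 0 < m * n * sin (b - a) / (snd v - snd u) * (snd u - snd v))
        by (apply Rmult_lt_0_compat; lra).
      replace (m * n * sin (b - a) / (snd v - snd u) * (snd u - snd v)) with (- (m * n * sin (b - a))) in P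
        by (field; lra). lra.
    + destruct (Rle_lt_dec (b - a) PI) as [|Hlt]; auto. exfalso.
      assert (0 < sin b) by (apply sin_gt_0; lra).
      assert (0 < sin (- a)) by (apply sin_gt_0; lra). rewrite sin_neg in *.
      assert (S1 : 0 < sin (b - a - PI)) by (apply sin_gt_0; lra).
      rewrite sin_minus, cos_PI, sin_PI in S1.
      assert (snd u < 0) by (rewrite U2; nra). assert (0 < snd v) by (rewrite V2; nra).
      specialize (X ltac:(nra)). rewrite Cr in X.
      assert (0 < m * n * - sin (b - a)) by (apply Rmult_lt_0_compat; lra).
      assert (P : 0 < m * n * sin (b - a) / (snd v - snd u) * (snd v - snd u))
        by (apply Rmult_lt_0_compat; lra).
      replace (m * n * sin (b - a) / (snd v - snd u) * (snd v - snd u)) with (m * n * sin (b - a)) in P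
        by (field; lra). lra.
Qed.

Lemma edge_angle_clear (s w a b : C) : clear s w a b ->
  edge_angle w a b = carg (Cmult s (Cminus b w)) - carg (Cmult s (Cminus a w)).
Proof.
  intros H. unfold edge_angle.
  assert (Na : Cmult s (Cminus a w) <> RtoC 0).
  { intros E. specialize (H 0 ltac:(lra)). cbv zeta in H.
    replace (Cplus a (Cmult (RtoC 0) (Cminus b a))) with a in H by ring.
    rewrite E in H. specialize (H eq_refl). simpl in H. lra. }
  assert (Ns : s <> RtoC 0) by (intros ->; apply Na; ring).
  assert (Naw : Cminus a w <> RtoC 0) by (intros E; apply Na; rewrite E; ring).
  rewrite <- carg_diff.
  - f_equal. field; auto.
  - intros t Ht. specialize (H t Ht). cbv zeta in H.
    replace (Cmult s (Cminus (Cplus a (Cmult (RtoC t) (Cminus b a))) w)) with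
      (Cplus (Cmult s (Cminus a w))
         (Cmult (RtoC t) (Cminus (Cmult s (Cminus b w)) (Cmult s (Cminus a w))))) in H by ring.
    set (u := Cmult s (Cminus a w)) in *. set (v := Cmult s (Cminus b w)) in *.
    intros E.
    replace (fst u + t * (fst v - fst u)) with (fst (Cplus u (Cmult (RtoC t) (Cminus v u))))
      by (simpl; ring).
    apply H. rewrite <- E. simpl. ring.
Qed.

(** One branch of the argument serves all four sides, so the edge angles telescope to 0. *)
Lemma no_winding (s w a b c d : C) :
  clear s w a b -> clear s w b c -> clear s w c d -> clear s w d a ->
  ~ poly_interior [a; b; c; d] w.
Proof.
  intros H1 H2 H3 H4 [_ N]. apply N. simpl.
  rewrite !(edge_angle_clear s) by auto. ring.
Qed.

Lemma on_segment_sym (w a b : C) : on_segment w a b -> on_segment w b a.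
Proof.
  intros (t & Ht & ->). exists (1 - t); split; [ lra | ].
  apply C_ext; simpl; ring.
Qed.

Definition nsq (u : C) : R := fst u * fst u + snd u * snd u.

(** The open sector with apex [c], axis [b - c] and a boundary ray through [x],
    written without angles. *)
Definition sector (x c b w : C) : Prop :=
  let e := Cmult (Cminus x c) (Cconj (Cminus b c)) in
  let q := Cmult (Cminus w c) (Cconj (Cminus b c)) in
  Rabs (snd q) * fst e < fst q * Rabs (snd e).

Section Kite.

Variables x c x' b w : C.
Hypothesis Hxc : nsq (Cminus x c) = nsq (Cminus x' c).
Hypothesis Hxb : nsq (Cminus x b) = nsq (Cminus x' b).
Hypothesis Hx : x <> x'.
Hypothesis Hside : snd (Cmult (Cminus x c) (Cconj (Cminus b c))) <> 0.

Let s := Cconj (Cminus b c).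

(** Equal distances to both [c] and [b] make [x] and [x'] mirror images in the axis, whose direction
    becomes real after multiplication by [s]. *)
Lemma kite_mirror :
  fst (Cmult (Cminus x' c) s) = fst (Cmult (Cminus x c) s) /\
  snd (Cmult (Cminus x' c) s) = - snd (Cmult (Cminus x c) s).
Proof.
  assert (E1 : fst (Cmult (Cminus x' c) s) = fst (Cmult (Cminus x c) s)).
  { unfold s, nsq in *. simpl in *. nra. }
  split; auto.
  assert (E2 : snd (Cmult (Cminus x' c) s) * snd (Cmult (Cminus x' c) s)
    = snd (Cmult (Cminus x c) s) * snd (Cmult (Cminus x c) s)).
  { assert (M : forall u, nsq (Cmult u s) = nsq u * nsq s) by (intros; unfold nsq; simpl; ring).
    pose proof (M (Cminus x c)) as M1. pose proof (M (Cminus x' c)) as M2.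
    rewrite <- Hxc, <- M1 in M2. unfold nsq in M2. rewrite E1 in M2. lra. }
  set (y := snd (Cmult (Cminus x c) s)) in *. set (y' := snd (Cmult (Cminus x' c) s)) in *.
  assert (F : (y' - y) * (y' + y) = 0) by lra.
  apply Rmult_integral in F; destruct F as [F|F]; [ exfalso | lra ].
  apply Hx.
  assert (Ns : s <> RtoC 0) by (intros E; apply Hside; fold s; rewrite E; simpl; ring).
  assert (E : Cminus x' c = Cminus x c).
  { apply Cmult_eq_reg_l with s; auto. rewrite (Cmult_comm s), (Cmult_comm s).
    apply C_ext; auto. fold y y'. lra. }
  replace x with (Cplus (Cminus x c) c) by ring. rewrite <- E. ring.
Qed.

Lemma axis_length : fst (Cmult (Cminus b c) s) > 0 /\ snd (Cmult (Cminus b c) s) = 0.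
Proof.
  unfold s; split; simpl; [ | ring ].
  simpl in Hside.
  set (u := fst b + - fst c) in *. set (v := snd b + - snd c) in *.
  assert (~ (u = 0 /\ v = 0)) by (intros [-> ->]; apply Hside; ring).
  destruct (Req_dec u 0); nra.
Qed.

Section OutsideSector.

Hypothesis Hout : ~ sector x c b w.

(** With the axis pointing to the right, the leftward ray from a point outside the sector misses the
    kite: a side point at the height of [w] lies to the right of [w]. *)
Lemma clear_side_apex (p : C) :
  fst (Cmult (Cminus p c) s) = fst (Cmult (Cminus x c) s) ->
  Rabs (snd (Cmult (Cminus p c) s)) = Rabs (snd (Cmult (Cminus x c) s)) ->
  ~ on_segment w c p -> clear s w c p.
Proof.
  intros P1 P2 Hon t Ht u E. unfold sector in Hout. fold s in Hout.
  set (e := Cmult (Cminus x c) s) in *. set (q := Cmult (Cminus w c) s) in *.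
  set (f := Cmult (Cminus p c) s) in *. cbv zeta in Hout.
  assert (Eu : u = Cminus (Cmult (RtoC t) f) q) by (unfold u, f, q; ring).
  assert (U1 : fst u = t * fst f - fst q) by (rewrite Eu; simpl; ring).
  assert (U2 : snd u = t * snd f - snd q) by (rewrite Eu; simpl; ring).
  assert (Q2 : Rabs (snd q) = t * Rabs (snd e)).
  { replace (snd q) with (t * snd f) by lra. rewrite Rabs_mult, P2, (Rabs_right t); lra. }
  assert (He : 0 < Rabs (snd e)) by now apply Rabs_pos_lt.
  rewrite Q2 in Hout.
  assert (L : fst q <= t * fst e) by nra.
  rewrite U1, P1. destruct (Rlt_le_dec (fst q) (t * fst e)); [ lra | ].
  exfalso; apply Hon. exists t; split; auto.
  assert (Ns : s <> RtoC 0) by (intros E0; apply Hside; fold s; rewrite E0; simpl; ring).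
  assert (Z : u = RtoC 0) by (apply C_ext; [ change (fst (RtoC 0)) with 0; rewrite U1, P1; lra | exact E ]).
  unfold u in Z. apply Cmult_integral in Z; destruct Z as [Z|Z]; [ contradiction | ].
  replace w with (Cplus w (RtoC 0)) by ring. rewrite <- Z. ring.
Qed.

Lemma clear_side_far (p : C) :
  fst (Cmult (Cminus p c) s) = fst (Cmult (Cminus x c) s) ->
  Rabs (snd (Cmult (Cminus p c) s)) = Rabs (snd (Cmult (Cminus x c) s)) ->
  ~ on_segment w p b -> clear s w p b.
Proof.
  intros P1 P2 Hon t Ht u E. unfold sector in Hout. fold s in Hout.
  destruct axis_length as [D1 D2].
  set (e := Cmult (Cminus x c) s) in *. set (q := Cmult (Cminus w c) s) in *.
  set (f := Cmult (Cminus p c) s) in *. set (D := Cmult (Cminus b c) s) in *. cbv zeta in Hout.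
  assert (Eu : u = Cminus (Cplus (Cmult (RtoC (1 - t)) f) (Cmult (RtoC t) D)) q)
    by (unfold u, f, q, D; rewrite RtoC_minus; ring).
  assert (U1 : fst u = (1 - t) * fst f + t * fst D - fst q) by (rewrite Eu; simpl; ring).
  assert (U2 : snd u = (1 - t) * snd f - snd q) 
    by (transitivity ((1 - t) * snd f + t * snd D - snd q); [ rewrite Eu; simpl; ring | rewrite D2; ring ]).
  assert (Q2 : Rabs (snd q) = (1 - t) * Rabs (snd e)).
  { replace (snd q) with ((1 - t) * snd f) by lra. rewrite Rabs_mult, P2, (Rabs_right (1 - t)); lra. }
  assert (He : 0 < Rabs (snd e)) by now apply Rabs_pos_lt.
  rewrite Q2 in Hout.
  assert (L : fst q <= (1 - t) * fst e) by nra.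
  rewrite U1, P1. destruct (Req_dec t 0) as [T0|T0].
  - destruct (Rlt_le_dec (fst q) ((1 - t) * fst e)); [ subst t; lra | ].
    exfalso; apply Hon. exists t; split; auto.
    assert (Ns : s <> RtoC 0) by (intros E0; apply Hside; fold s; rewrite E0; simpl; ring).
    assert (Z : u = RtoC 0) by (apply C_ext; [ change (fst (RtoC 0)) with 0; rewrite U1, P1, T0; rewrite T0 in *; lra | exact E ]).
    unfold u in Z. apply Cmult_integral in Z; destruct Z as [Z|Z]; [ contradiction | ].
    replace w with (Cplus w (RtoC 0)) by ring. rewrite <- Z. ring.
  - assert (0 < t * fst D) by (apply Rmult_lt_0_compat; lra). lra.
Qed.

Lemma clear_kite :
  ~ on_segment w c x -> ~ on_segment w c x' -> ~ on_segment w x b -> ~ on_segment w x' b ->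
  clear s w c x /\ clear s w c x' /\ clear s w x b /\ clear s w x' b.
Proof.
  destruct kite_mirror as [M1 M2]. intros.
  assert (M2' : Rabs (snd (Cmult (Cminus x' c) s)) = Rabs (snd (Cmult (Cminus x c) s)))
    by (rewrite M2; apply Rabs_Ropp).
  repeat split; auto using clear_side_apex, clear_side_far.
Qed.

End OutsideSector.

(** Outside the sector all four sides are clear, so the winding number is 0. The lists start at
    either of [x] and [x'], in either orientation. *)
Lemma kite_in_sector (vs : list C) :
  In vs [[x; c; x'; b]; [x'; c; x; b]; [x; b; x'; c]; [x'; b; x; c]] ->
  poly_interior vs w -> sector x c b w.
Proof.
  intros Hvs [HF N]. destruct (Classical_Prop.classic (sector x c b w)) as [|Hout]; auto.
  exfalso.
  simpl in Hvs. destruct Hvs as [<-|[<-|[<-|[<-|[]]]]];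
    (pose proof HF as G; cbn [quad_edges] in G; rewrite !Forall_cons_iff in G;
     destruct G as (F1 & F2 & F3 & F4 & _); cbn [fst snd] in F1, F2, F3, F4;
     destruct (clear_kite Hout) as (K1 & K2 & K3 & K4);
       [ first [ assumption | intros O; apply on_segment_sym in O; contradiction ] .. | ];
     apply (no_winding s w _ _ _ _) with (5 := conj HF N); auto using clear_sym).
Qed.

End Kite.

(** In the frame where the common boundary ray is the positive real axis, the
    axes of the two sectors are [(c1, - s1)] and [(c2, s2)]; the half angles
    have sum less than [PI] as soon as [s1 * c2 + s2 * c1 > 0]. *)
Lemma sectors_disjoint_frame (c1 s1 c2 s2 qx qy : R) :
  0 < s1 -> 0 < s2 -> 0 < s1 * c2 + s2 * c1 ->
  Rabs (qy * c1 + qx * s1) * c1 < (qx * c1 - qy * s1) * s1 ->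
  Rabs (qy * c2 - qx * s2) * c2 < (qx * c2 + qy * s2) * s2 -> False.
Proof.
  (* [2 * x * c * s + y * (s * s - c * c)] tells the side of the second boundary ray, the mirror
     image of the positive real axis. The sector lies in the intersection of two half planes if
     [c >= 0] and in their union if [c < 0]. *)
  assert (HALF : forall c s x y, 0 < s -> Rabs (y * c - x * s) * c < (x * c + y * s) * s ->
    (0 <= c -> 0 < y /\ 0 < 2 * x * c * s + y * (s * s - c * c)) /\
    (c < 0 -> 0 < y \/ 0 < 2 * x * c * s + y * (s * s - c * c))).
  { intros c s x y Hs H.
    pose proof (Rle_abs (y * c - x * s)) as A1. pose proof (Rle_abs (- (y * c - x * s))) as A2.
    rewrite Rabs_Ropp in A2. split; intros Hc.
    - assert (B1 : (y * c - x * s) * c <= Rabs (y * c - x * s) * c) by (apply Rmult_le_compat_r; lra).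
      assert (B2 : - (y * c - x * s) * c <= Rabs (y * c - x * s) * c) by (apply Rmult_le_compat_r; lra).
      split; [ | lra ].
      assert (0 < y * (s * s + c * c)) by lra.
      assert (0 < s * s + c * c) by nra. apply Rmult_lt_reg_r with (s * s + c * c); lra.
    - assert (0 < s * s + c * c) by nra.
      unfold Rabs in H. destruct (Rcase_abs (y * c - x * s)).
      + left. assert (0 < y * (s * s + c * c)) by lra.
        apply Rmult_lt_reg_r with (s * s + c * c); lra.
      + right. lra. }
  intros H1 H2 H12 S1 S2.
  replace (qy * c1 + qx * s1) with (- (- qy * c1 - qx * s1)) in S1 by ring.
  rewrite Rabs_Ropp in S1.
  replace (qx * c1 - qy * s1) with (qx * c1 + - qy * s1) in S1 by ring.
  destruct (HALF c1 s1 qx (- qy) H1 S1) as [P1 N1]. destruct (HALF c2 s2 qx qy H2 S2) as [P2 N2].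
  (* A sector wider than a half plane against a narrower one: the weights [- (c * s)] and [c' * s']
     eliminate [x], and the angle condition fixes the sign of the rest. *)
  assert (FIN : forall c s c' s' x y, 0 < s -> 0 < s' -> 0 < s * c' + s' * c -> c < 0 ->
    0 < y -> 0 < 2 * x * c' * s' + y * (s' * s' - c' * c') ->
    0 < 2 * x * c * s + - y * (s * s - c * c) -> False).
  { intros c s c' s' x y Hs Hs' Hss Hc Hy E' E.
    assert (Hc' : 0 < c') by nra.
    assert (Z1 : 0 < (- (c * s)) * (2 * x * c' * s' + y * (s' * s' - c' * c')))
      by (apply Rmult_lt_0_compat; auto; nra).
    assert (Z2 : 0 < (c' * s') * (2 * x * c * s + - y * (s * s - c * c)))
      by (apply Rmult_lt_0_compat; auto; nra).
    assert (Z3 : 0 < y * ((s * c' + s' * c) * (s * s' - c * c'))).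
    { apply Rmult_lt_0_compat; auto. apply Rmult_lt_0_compat; auto. nra. }
    nra. }
  destruct (Rlt_le_dec c1 0) as [L1|L1]; destruct (Rlt_le_dec c2 0) as [L2|L2].
  - nra.
  - destruct (P2 L2) as [Y2 E2]. destruct (N1 L1) as [Y1|E1]; [ lra | ].
    now apply (FIN c1 s1 c2 s2 qx qy).
  - destruct (P1 L1) as [Y1 E1]. destruct (N2 L2) as [Y2|E2]; [ lra | ].
    apply (FIN c2 s2 c1 s1 qx (- qy)); auto; try lra.
  - destruct (P1 L1). destruct (P2 L2). lra.
Qed.

(** The triangle [x c b1] has the angle [PI - a1] at [x], so its angle at [c], the half angle of the
    sector, is less than [a1]; likewise for [b2]. *)
Lemma sectors_disjoint (x c b1 b2 w om : C) (r r1 r2 a1 a2 : R) :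
  Cmult om (Cconj om) = RtoC 1 -> 0 < r -> 0 < r1 -> 0 < r2 ->
  0 < a1 -> 0 < a2 -> a1 + a2 < PI ->
  Cminus c x = Cmult om (RtoC r) ->
  Cminus b1 x = Cmult (Cmult om (expi (PI - a1))) (RtoC r1) ->
  Cminus b2 x = Cmult (Cmult om (expi (- (PI - a2)))) (RtoC r2) ->
  sector x c b1 w -> sector x c b2 w -> False.
Proof.
  intros Hom Hr Hr1 Hr2 Ha1 Ha2 Ha E E1 E2 S1 S2.
  set (q := Cmult (Cminus w c) (Copp (Cconj om))).
  assert (Q : Cminus w c = Cmult (Copp om) q).
  { unfold q. transitivity (Cmult (Cmult om (Cconj om)) (Cminus w c)); [ rewrite Hom; ring | ring ]. }
  assert (X : Cminus x c = Cmult (Copp om) (RtoC r)).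
  { transitivity (Copp (Cminus c x)); [ ring | rewrite E; ring ]. }
  assert (P1 : expi (PI - a1) = Copp (expi (- a1))).
  { apply C_ext; simpl; rewrite ?cos_minus, ?sin_minus, cos_PI, sin_PI, ?cos_neg, ?sin_neg; ring. }
  assert (P2 : expi (- (PI - a2)) = Copp (expi a2)).
  { apply C_ext; simpl; rewrite ?cos_neg, ?sin_neg, ?cos_minus, ?sin_minus, cos_PI, sin_PI; ring. }
  assert (B1 : Cminus b1 c = Cmult (Copp om) (Cplus (RtoC r) (Cmult (expi (- a1)) (RtoC r1)))).
  { transitivity (Cminus (Cminus b1 x) (Cminus c x)); [ ring | ]. rewrite E, E1, P1. ring. }
  assert (B2 : Cminus b2 c = Cmult (Copp om) (Cplus (RtoC r) (Cmult (expi a2) (RtoC r2)))).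
  { transitivity (Cminus (Cminus b2 x) (Cminus c x)); [ ring | ]. rewrite E, E2, P2. ring. }
  assert (UN : forall u v, Cmult (Cmult (Copp om) u) (Cconj (Cmult (Copp om) v)) = Cmult u (Cconj v)).
  { intros u v. rewrite Cconj_mult, Cconj_opp.
    transitivity (Cmult (Cmult om (Cconj om)) (Cmult u (Cconj v))); [ ring | rewrite Hom; ring ]. }
  unfold sector in S1, S2. rewrite Q, X in S1, S2. rewrite B1 in S1. rewrite B2 in S2.
  rewrite !UN in S1. rewrite !UN in S2. cbv zeta in S1, S2. clearbody q.
  assert (0 < sin a1) by (apply sin_gt_0; lra). assert (0 < sin a2) by (apply sin_gt_0; lra).
  assert (0 < sin (a1 + a2)) by (apply sin_gt_0; lra).
  set (c1 := r + r1 * cos a1). set (s1 := r1 * sin a1).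
  set (c2 := r + r2 * cos a2). set (s2 := r2 * sin a2).
  assert (Hs1 : 0 < s1) by now apply Rmult_lt_0_compat.
  assert (Hs2 : 0 < s2) by now apply Rmult_lt_0_compat.
  apply (sectors_disjoint_frame c1 s1 c2 s2 (fst q) (snd q)); auto.
  - replace (s1 * c2 + s2 * c1) with (r * s1 + r * s2 + r1 * r2 * sin (a1 + a2))
      by (unfold s1, s2, c1, c2; rewrite sin_plus; ring).
    assert (0 < r * s1) by now apply Rmult_lt_0_compat.
    assert (0 < r * s2) by now apply Rmult_lt_0_compat.
    assert (0 < r1 * r2 * sin (a1 + a2)) by (repeat apply Rmult_lt_0_compat; auto). lra.
  - simpl in S1. rewrite cos_neg, sin_neg in S1.
    match type of S1 with Rabs ?A * ?B < ?F * Rabs ?G =>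
      replace A with (snd q * c1 + fst q * s1) in S1 by (unfold c1, s1; ring);
      replace B with (r * c1) in S1 by (unfold c1; ring);
      replace F with (fst q * c1 - snd q * s1) in S1 by (unfold c1, s1; ring);
      replace G with (r * s1) in S1 by (unfold s1; ring) end.
    rewrite (Rabs_right (r * s1)) in S1 by (apply Rle_ge, Rlt_le, Rmult_lt_0_compat; auto).
    apply Rmult_lt_reg_l with r; auto. lra.
  - simpl in S2.
    match type of S2 with Rabs ?A * ?B < ?F * Rabs ?G =>
      replace A with (snd q * c2 - fst q * s2) in S2 by (unfold c2, s2; ring);
      replace B with (r * c2) in S2 by (unfold c2; ring);
      replace F with (fst q * c2 + snd q * s2) in S2 by (unfold c2, s2; ring);
      replace G with (- (r * s2)) in S2 by (unfold s2; ring) end.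
    rewrite Rabs_Ropp, (Rabs_right (r * s2)) in S2 by (apply Rle_ge, Rlt_le, Rmult_lt_0_compat; auto).
    apply Rmult_lt_reg_l with r; auto. lra.
Qed.

(** * The hexagonal circle pattern *)

Lemma expi_eq_1 (x : R) : expi (2 * x) = RtoC 1 -> - PI < x < PI -> x = 0.
Proof.
  intros E Hx. apply (f_equal fst) in E. simpl in E.
  assert (2 * x = 0); [ apply cos_eq_1; lra | lra ].
Qed.

Lemma expi_sq_neq (x y : R) : - PI < x - y < PI -> x <> y ->
  Cmult (expi x) (expi x) <> Cmult (expi y) (expi y).
Proof.
  intros H N E. apply N. assert (x - y = 0); [ | lra ].
  apply expi_eq_1; auto.
  replace (2 * (x - y)) with (x + x + - (y + y)) by ring.
  rewrite expi_plus, (expi_plus x x), E, <- expi_plus. apply expi_inv_r.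
Qed.

Lemma Cinv_opp (x : C) : Cinv (Copp x) = Copp (Cinv x).
Proof.
  apply C_ext; simpl; unfold Rdiv;
    replace (- fst x * (- fst x * 1) + - snd x * (- snd x * 1))
      with (fst x * (fst x * 1) + snd x * (snd x * 1)) by ring; ring.
Qed.

Lemma qcr_eq (a b c d q : C) : q_eq a b c d q ->
  Cmult (Cminus a b) (Cminus c d) = Cmult q (Cmult (Cminus b c) (Cminus d a)).
Proof.
  intros [(Hab & Hac & Had & Hbc & Hbd & Hcd) <-]. unfold qcr.
  assert (D : forall x y, x <> y -> Cminus x y <> RtoC 0).
  { intros x y H E. apply H. replace x with (Cplus (Cminus x y) y) by ring. rewrite E; ring. }
  field. split; apply D; auto.
Qed.

Section Solution.

Variables (a1 a2 a3 c : R) (z : Z -> Z -> Z -> C).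
Hypotheses (Ha1 : 0 < a1) (Ha2 : 0 < a2) (Ha3 : 0 < a3).
Hypothesis Hsum : a1 + a2 + a3 = PI.
Hypothesis Hc : 0 < c < 2.
Hypothesis Hz : is_solution a1 a2 a3 c z.
Hypothesis Hz1 : z 1%Z 0%Z 0%Z = RtoC 1.
Hypothesis Hz2 : z 0%Z 1%Z 0%Z = expi (c * (a2 + a3)).
Hypothesis Hz3 : z 0%Z 0%Z (-1)%Z = expi (c * a3).

Let g : R := c / 2.

(** The rotated initial points are [expi (c * psi d)], and the cross-ratio of a face is the quotient
    of the squares of two of the [expi (psi d)]. *)
Definition psi (d : dir) : R := match d with D1 => - a3 | D2 => a2 | D3 => 0 end.

Let th (d : dir) : C := expi (psi d).

Let raw (v : vert) : C :=
  let '(k, l, n) := v in z (Z.of_nat k) (Z.of_nat l) (- Z.of_nat n).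

(** Rotated so that the middle direction [D3] of the sector becomes real. *)
Let Zn (v : vert) : C := Cmult (expi (- (c * a3))) (raw v).

Lemma g_bounds : 0 < g < 1.
Proof. unfold g; lra. Qed.

Lemma psi_J (d : dir) : J (psi d).
Proof. unfold J; destruct d; simpl; lra. Qed.

Lemma th_distinct (d e : dir) : d <> e -> Cmult (th d) (th d) <> Cmult (th e) (th e).
Proof. intros H; apply expi_sq_neq; destruct d, e; simpl; try congruence; lra. Qed.

Lemma face_cross (A B D F q t t' : C) : t' = Cmult q t -> q_eq A B D F q ->
  Cmult t (Cmult (Cminus B A) (Cminus D F)) = Cmult t' (Cmult (Cminus F A) (Cminus D B)).
Proof.
  intros -> H. apply qcr_eq in H.
  transitivity (Copp (Cmult t (Cmult (Cminus A B) (Cminus D F)))); [ ring | ].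
  transitivity (Copp (Cmult t (Cmult q (Cmult (Cminus B D) (Cminus F A))))); [ | ring ].
  now rewrite H.
Qed.

Definition cross (h : vert -> C) (d e : dir) (v : vert) : Prop :=
  Cmult (Cmult (th e) (th e)) (Cmult (Cminus (h (sh d v)) (h v)) (Cminus (h (sh d (sh e v))) (h (sh e v))))
  = Cmult (Cmult (th d) (th d)) (Cmult (Cminus (h (sh e v)) (h v)) (Cminus (h (sh e (sh d v))) (h (sh d v)))).

Lemma raw_cross (d e : dir) (v : vert) : d <> e -> cross raw d e v.
Proof.
  destruct Hz as (F1 & F2 & F3 & _).
  assert (TH : forall d e q, expi q = expi (2 * psi d + - (2 * psi e)) ->
    Cmult (th d) (th d) = Cmult (expi q) (Cmult (th e) (th e))).
  { intros d' e' q ->. unfold th. rewrite <- !expi_plus. f_equal; ring. }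
  destruct v as [[k l] n].
  assert (S1 : forall m, Z.of_nat (S m) = (Z.of_nat m + 1)%Z) by lia.
  assert (S2 : forall m, (- (Z.of_nat m + 1) = - Z.of_nat m - 1)%Z) by lia.
  assert (E12 : cross raw D2 D1 (k, l, n)).
  (* These faces are stated at the corner with the larger first coordinate, hence the shift. The
     angles match because [2 * (a2 + a3)] is [2 * PI - 2 * a1]. *)
  { specialize (F1 (Z.of_nat k + 1)%Z (Z.of_nat l) (- Z.of_nat n)%Z).
    rewrite Z.add_simpl_r in F1.
    assert (E := face_cross _ _ _ _ _ _ _ (TH D2 D1 (-2 * a1) ltac:(
      replace (2 * psi D2 + - (2 * psi D1)) with (-2 * a1 + 2 * PI) by (simpl; lra);
      apply C_ext; simpl; rewrite ?cos_plus, ?sin_plus, cos_2PI, sin_2PI; ring))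
      (F1 ltac:(repeat split; lia) ltac:(repeat split; lia) ltac:(repeat split; lia) ltac:(repeat split; lia))).
    unfold cross. cbn [sh raw]. rewrite !S1.
    etransitivity; [ etransitivity; [ | exact E ]; ring | ring ]. }
  assert (E23 : cross raw D3 D2 (k, l, n)).
  { unfold cross. cbn [sh raw]. rewrite !S1, !S2.
    apply (face_cross _ _ _ _ (expi (-2 * a2)));
      [ apply TH; f_equal; simpl; ring | apply F2; repeat split; lia ]. }
  assert (E13 : cross raw D1 D3 (k, l, n)).
  { unfold cross. cbn [sh raw]. rewrite !S1, !S2.
    apply (face_cross _ _ _ _ (expi (-2 * a3)));
      [ apply TH; f_equal; simpl; ring | apply F3; repeat split; lia ]. }
  intros H. destruct d, e; try congruence; auto; symmetry; auto.
Qed.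

Lemma Zn_cross (d e : dir) (v : vert) : d <> e -> cross Zn d e v.
Proof.
  intros H. pose proof (raw_cross d e v H) as E. unfold cross, Zn in *.
  set (R := expi (- (c * a3))).
  match type of E with ?L = ?M =>
    transitivity (Cmult (Cmult R R) L); [ ring | rewrite E; ring ] end.
Qed.

Lemma Zn_edge_neq_0 (d : dir) (v : vert) : Cminus (Zn (sh d v)) (Zn v) <> RtoC 0.
Proof.
  assert (A : raw (sh d v) <> raw v).
  { destruct Hz as (_ & F2 & F3 & _). destruct v as [[k l] n], d; cbn [sh raw];
      rewrite Nat2Z.inj_succ; unfold Z.succ;
      try replace (- (Z.of_nat n + 1))%Z with (- Z.of_nat n - 1)%Z by lia.
    - destruct (F3 (Z.of_nat k) (Z.of_nat l) (- Z.of_nat n)%Z) as [(H & _) _]; try (repeat split; lia); auto.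
    - destruct (F2 (Z.of_nat k) (Z.of_nat l) (- Z.of_nat n)%Z) as [(_ & _ & H & _) _]; try (repeat split; lia); auto.
    - destruct (F2 (Z.of_nat k) (Z.of_nat l) (- Z.of_nat n)%Z) as [(H & _) _]; try (repeat split; lia); auto. }
  intros E. apply A. unfold Zn in E.
  assert (E' : Cmult (expi (- (c * a3))) (Cminus (raw (sh d v)) (raw v)) = RtoC 0) by (rewrite <- E; ring).
  apply Cmult_integral in E'; destruct E' as [E'|E']; [ now apply expi_neq_0 in E' | ].
  replace (raw (sh d v)) with (Cplus (Cminus (raw (sh d v)) (raw v)) (raw v)) by ring.
  rewrite E'; ring.
Qed.

Lemma raw_origin : raw origin = RtoC 0.
Proof.
  destruct Hz as (_ & _ & _ & F4). specialize (F4 0%Z 0%Z 0%Z ltac:(repeat split; lia)).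
  unfold cterm in F4. simpl in F4. change (raw origin) with (z 0%Z 0%Z 0%Z).
  apply Cmult_eq_reg_l with (RtoC c); [ apply RtoC_neq_0; lra | ]. rewrite F4. ring.
Qed.

Lemma raw_axis (d : dir) (j : nat) :
  Cmult (RtoC (2 * g)) (raw (ax d (S j)))
  = Cmult (RtoC (2 * INR (S j)))
      (Cdiv (Cmult (Cminus (raw (ax d (S (S j)))) (raw (ax d (S j)))) (Cminus (raw (ax d (S j))) (raw (ax d j))))
            (Cminus (raw (ax d (S (S j)))) (raw (ax d j)))).
Proof.
  destruct Hz as (_ & _ & _ & F4). replace (2 * g) with c by (unfold g; field).
  assert (Nz : forall m, Z.eqb (Z.of_nat (S m)) 0 = false) by (intros; apply Z.eqb_neq; lia).
  assert (Nz' : forall m, Z.eqb (- Z.of_nat (S m)) 0 = false) by (intros; apply Z.eqb_neq; lia).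
  destruct d; cbn [ax raw]; change (Z.of_nat 0) with 0%Z; try change (- 0)%Z with 0%Z.
  - rewrite (F4 (Z.of_nat (S j)) 0%Z 0%Z) by (repeat split; lia).
    unfold cterm. rewrite Nz. cbn [Z.eqb].
    replace (Z.of_nat (S j) + 1)%Z with (Z.of_nat (S (S j))) by lia.
    replace (Z.of_nat (S j) - 1)%Z with (Z.of_nat j) by lia.
    rewrite INR_IZR_INZ. ring.
  - rewrite (F4 0%Z (Z.of_nat (S j)) 0%Z) by (repeat split; lia).
    unfold cterm. rewrite Nz. cbn [Z.eqb].
    replace (Z.of_nat (S j) + 1)%Z with (Z.of_nat (S (S j))) by lia.
    replace (Z.of_nat (S j) - 1)%Z with (Z.of_nat j) by lia.
    rewrite INR_IZR_INZ. ring.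
  - rewrite (F4 0%Z 0%Z (- Z.of_nat (S j))%Z) by (repeat split; lia).
    unfold cterm. rewrite Nz'. cbn [Z.eqb].
    replace (- Z.of_nat (S j) + 1)%Z with (- Z.of_nat j)%Z by lia.
    replace (- Z.of_nat (S j) - 1)%Z with (- Z.of_nat (S (S j)))%Z by lia.
    rewrite INR_IZR_INZ, opp_IZR.
    (* Reversing the third direction changes the sign of the coefficient and of the denominator. *)
    set (A := z 0%Z 0%Z (- Z.of_nat j)%Z). set (B := z 0%Z 0%Z (- Z.of_nat (S j))%Z).
    set (D := z 0%Z 0%Z (- Z.of_nat (S (S j)))%Z).
    unfold Cdiv. replace (Cminus A D) with (Copp (Cminus D A)) by ring.
    rewrite Cinv_opp. replace (2 * - IZR (Z.of_nat (S j))) with (- (2 * IZR (Z.of_nat (S j)))) by ring.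
    rewrite RtoC_opp. ring.
Qed.

Lemma raw_axis_1 (d : dir) : Cmult (expi (- (c * a3))) (raw (ax d 1)) = expi (2 * g * psi d) /\
  raw (ax d 1) <> RtoC 0.
Proof.
  replace (2 * g) with c by (unfold g; field).
  destruct d; cbn [ax raw psi].
  - change (z (Z.of_nat 1) (Z.of_nat 0) (- Z.of_nat 0)%Z) with (z 1%Z 0%Z 0%Z). rewrite Hz1.
    split; [ rewrite Cmult_1_r; f_equal; ring | apply RtoC_neq_0; lra ].
  - change (z (Z.of_nat 0) (Z.of_nat 1) (- Z.of_nat 0)%Z) with (z 0%Z 1%Z 0%Z). rewrite Hz2.
    split; [ rewrite <- expi_plus; f_equal; ring | apply expi_neq_0 ].
  - change (z (Z.of_nat 0) (Z.of_nat 0) (- Z.of_nat 1)%Z) with (z 0%Z 0%Z (-1)%Z). rewrite Hz3.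
    split; [ rewrite <- expi_plus; f_equal; ring | apply expi_neq_0 ].
Qed.

Lemma Zn_axis (d : dir) (j : nat) :
  Cminus (Zn (ax d (S (2 * j)))) (Zn (ax d (2 * j))) = Cmult (expi (2 * g * psi d)) (RtoC (rho g j)) /\
  Cminus (Zn (ax d (S (S (2 * j))))) (Zn (ax d (S (2 * j)))) = Cmult (expi (2 * g * psi d)) (RtoC (rho g (S j))).
Proof.
  destruct (raw_axis_1 d) as [R1 N1].
  assert (R0 : raw (ax d 0) = RtoC 0) by (rewrite <- raw_origin; destruct d; reflexivity).
  destruct (axis_values g (raw (ax d 1)) (fun j => raw (ax d j)) g_bounds N1 R0 eq_refl (raw_axis d) j) as [A1 A2].
  rewrite <- R1. unfold Zn. split.
  - rewrite <- Cmult_assoc, <- A1. ring.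
  - rewrite <- Cmult_assoc, <- A2. ring.
Qed.

(** The points [(k, l, k + l)] are the circle centres of [Q_H], and the values of [w] there are the
    radii. *)
Lemma radius_phase : exists w : vert -> C,
  (forall d v, Cminus (Zn (sh d v)) (Zn v) = Cmult (th d) (Cmult (w v) (w (sh d v)))) /\
  (forall v, Nat.even (lev v) = true -> w v = RtoC (fst (w v))) /\
  (forall v, Nat.even (lev v) = false -> Cmult (w v) (Cconj (w v)) = RtoC 1) /\
  (forall k l, 0 < fst (w (k, l, k + l)%nat)).
Proof.
  destruct (exists_edge_factor Zn th) as (w & w0 & wn & wE).
  { intros d; apply expi_neq_0. }
  { apply Zn_edge_neq_0. }
  { apply Zn_cross. }
  assert (wA : forall d j, w (ax d (2 * j)) = RtoC (rho g j) /\
    w (ax d (S (2 * j))) = expi ((2 * g - 1) * psi d)).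
  { intros d.
    assert (ST : forall j, w (ax d (2 * j)) = RtoC (rho g j) ->
      w (ax d (S (2 * j))) = expi ((2 * g - 1) * psi d)).
    { intros j E. destruct (Zn_axis d j) as [A _].
      pose proof (wE d (ax d (2 * j))) as F. rewrite sh_ax, A, E in F.
      apply Cmult_eq_reg_l with (Cmult (th d) (RtoC (rho g j))).
      - intros H; apply Cmult_integral in H; destruct H as [H|H]; [ now apply expi_neq_0 in H | ].
        revert H. apply RtoC_neq_0. pose proof (rho_pos g j g_bounds); lra.
      - transitivity (Cmult (th d) (Cmult (RtoC (rho g j)) (w (ax d (S (2 * j)))))); [ ring | ].
        rewrite <- F. unfold th.
        replace (2 * g * psi d) with (psi d + (2 * g - 1) * psi d) by ring.
        rewrite expi_plus. ring. }
    induction j as [|j [E1 E2]].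
    - assert (E : w (ax d (2 * 0)) = RtoC (rho g 0)) by (simpl rho; rewrite <- w0; destruct d; reflexivity).
      auto.
    - assert (E : w (ax d (2 * S j)) = RtoC (rho g (S j))).
      { destruct (Zn_axis d j) as [_ A].
        pose proof (wE d (ax d (S (2 * j)))) as F. rewrite sh_ax, A, E2 in F.
        replace (2 * S j)%nat with (S (S (2 * j))) by lia.
        apply Cmult_eq_reg_l with (expi (2 * g * psi d)); [ apply expi_neq_0 | ].
        rewrite F. unfold th. 
        replace (2 * g * psi d) with (psi d + (2 * g - 1) * psi d) by ring.
        rewrite expi_plus. ring. }
      auto. }
  assert (wH : forall d e v, d <> e ->
    Cplus (Cmult (th d) (Cmult (w v) (w (sh d v)))) (Cmult (th e) (Cmult (w (sh d v)) (w (sh e (sh d v)))))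
    = Cplus (Cmult (th e) (Cmult (w v) (w (sh e v)))) (Cmult (th d) (Cmult (w (sh e v)) (w (sh d (sh e v)))))).
  { intros d e v _. rewrite <- !wE, (sh_comm e d). ring. }
  assert (wA0 : forall d j, w (ax d (2 * j)) = RtoC (rho g j)) by (intros; apply wA).
  assert (wA1 : forall d j, w (ax d (S (2 * j))) = expi ((2 * g - 1) * psi d)) by (intros; apply wA).
  exists w. split; [ exact wE | split; [ | split ] ].
  - intros v. apply (w_even g psi w); auto using g_bounds; exact th_distinct.
  - intros v. apply (w_odd g psi w); auto using g_bounds; exact th_distinct.
  - intros k l.
    replace (k + l)%nat with (k + l + 2 * 0)%nat by lia.
    apply (radius_pos g psi w g_bounds psi_J); auto; try exact th_distinct; simpl; lra.
Qed.

(** * Quadrilaterals and the circle centres around an intersection point *)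

Definition zlev (p : pt) : Z := let '(k, l, m) := p in (k + l + m)%Z.

Definition inQp (p : pt) : Prop := let '(k, l, m) := p in inQ k l m.

Definition sub_e (p : pt) (i : nat) : pt :=
  let '(k, l, m) := p in
  match i with
  | 1%nat => ((k - 1)%Z, l, m)
  | 2%nat => (k, (l - 1)%Z, m)
  | _ => (k, l, (m - 1)%Z)
  end.

(** The circle centre adjacent to the intersection point [u] in direction [i]. *)
Definition cen (u : pt) (i : nat) : pt := if (zlev u <? 0)%Z then add_e u i else sub_e u i.
Definition vn (p : pt) : vert := let '(k, l, m) := p in (Z.to_nat k, Z.to_nat l, Z.to_nat (- m)).

(** Directions of the three centres seen from an intersection point. *)
Definition eta (i : nat) : R := match i with 1%nat => - a3 | 2%nat => a2 | _ => PI end.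

Lemma zv_raw (p : pt) : inQp p -> zv z p = raw (vn p).
Proof.
  destruct p as [[k l] m]. intros (Hk & Hl & Hm). simpl. f_equal; lia.
Qed.

Lemma raw_Zn (v v' : vert) : Cminus (raw v') (raw v) = Cmult (expi (c * a3)) (Cminus (Zn v') (Zn v)).
Proof.
  unfold Zn.
  transitivity (Cmult (Cmult (expi (c * a3)) (expi (- (c * a3)))) (Cminus (raw v') (raw v))); [ | ring ].
  rewrite expi_inv_r. ring.
Qed.

Lemma edge_directions : exists (r : pt -> R) (om : pt -> C),
  forall u, inQp u -> (zlev u = 1 \/ zlev u = -1)%Z ->
    Cmult (om u) (Cconj (om u)) = RtoC 1 /\
    forall i, (1 <= i <= 3)%nat -> inQp (cen u i) ->
      0 < r (cen u i) /\
      Cminus (zv z (cen u i)) (zv z u) = Cmult (Cmult (om u) (expi (eta i))) (RtoC (r (cen u i))).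
Proof.
  destruct radius_phase as (w & wE & wev & wod & wpos).
  (* At level 1 the centres are [u - e_i] instead of [u + e_i], which reverses all three directions;
     hence the sign. *)
  exists (fun p => fst (w (vn p))),
    (fun p => Cmult (RtoC (if (zlev p <? 0)%Z then 1 else -1)) (Cmult (expi (c * a3)) (w (vn p)))).
  intros u Hu Lu. split.
  - assert (O : Nat.even (lev (vn u)) = false).
    { destruct u as [[k l] m]. destruct Hu as (Hk & Hl & Hm). simpl in *.
      destruct (Nat.even (Z.to_nat k + Z.to_nat l + Z.to_nat (- m))) eqn:E; auto.
      apply Nat.even_spec in E. destruct E as [q Hq]. lia. }
    rewrite !Cconj_mult, Cconj_expi, Cconj_RtoC.
    set (sg := if (zlev u <? 0)%Z then 1 else -1).
    transitivity (Cmult (RtoC (sg * sg)) (Cmult (Cmult (expi (c * a3)) (expi (- (c * a3))))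
      (Cmult (w (vn u)) (Cconj (w (vn u)))))); [ rewrite RtoC_mult; ring | ].
    rewrite expi_inv_r, wod by auto.
    replace (sg * sg) with 1 by (unfold sg; destruct (zlev u <? 0)%Z; ring). ring.
  - intros i Hi HC.
    assert (L0 : zlev (cen u i) = 0%Z).
    { unfold cen. destruct (Z.ltb_spec (zlev u) 0); destruct u as [[k l] m];
        destruct i as [|[|[|[|i]]]]; simpl in *; lia. }
    assert (PR : 0 < fst (w (vn (cen u i))) /\ w (vn (cen u i)) = RtoC (fst (w (vn (cen u i))))).
    { destruct (cen u i) as [[k l] m]. destruct HC as (Hk & Hl & Hm). simpl in L0. unfold vn.
      replace (Z.to_nat (- m)) with (Z.to_nat k + Z.to_nat l)%nat by lia. split; auto.
      apply wev. simpl. replace (Z.to_nat k + Z.to_nat l + (Z.to_nat k + Z.to_nat l))%nat with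
        (2 * (Z.to_nat k + Z.to_nat l))%nat by lia. apply Nat.even_mul. }
    destruct PR as [PR ER]. split; auto. rewrite <- ER.
    assert (ED : forall d p q, inQp p -> inQp q -> vn q = sh d (vn p) ->
      Cminus (zv z q) (zv z p) = Cmult (expi (c * a3)) (Cmult (th d) (Cmult (w (vn p)) (w (vn q))))).
    { intros d p q Hp Hq E. rewrite !zv_raw, raw_Zn, E, wE by auto. reflexivity. }
    assert (OP : forall x y : C, Cminus x y = Copp (Cminus y x)) by (intros; ring).
    assert (NEG1 : RtoC (-1) = Copp (RtoC 1)) by (apply C_ext; simpl; ring).
    assert (EPI : expi PI = RtoC (-1)) by (apply C_ext; simpl; [ apply cos_PI | apply sin_PI ]).
    unfold cen in *. destruct (Z.ltb_spec (zlev u) 0).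
    + destruct i as [|[|[|[|i]]]]; try lia; cbn [eta].
      * rewrite (ED D1); auto; [ unfold th; simpl psi; ring | ].
        destruct u as [[k l] m], Hu as (? & ? & ?). unfold vn, add_e, sh. repeat f_equal; lia.
      * rewrite (ED D2); auto; [ unfold th; simpl psi; ring | ].
        destruct u as [[k l] m], Hu as (? & ? & ?). unfold vn, add_e, sh. repeat f_equal; lia.
      * rewrite OP, (ED D3); auto.
        -- unfold th; simpl psi. rewrite expi_0, EPI, NEG1. ring.
        -- destruct u as [[k l] m], HC as (? & ? & ?). unfold vn, add_e, sh. repeat f_equal; lia.
    + destruct i as [|[|[|[|i]]]]; try lia; cbn [eta].
      * rewrite OP, (ED D1); auto.
        -- unfold th; simpl psi. rewrite NEG1. ring.
        -- destruct u as [[k l] m], HC as (? & ? & ?). unfold vn, sub_e, sh. repeat f_equal; lia.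
      * rewrite OP, (ED D2); auto.
        -- unfold th; simpl psi. rewrite NEG1. ring.
        -- destruct u as [[k l] m], HC as (? & ? & ?). unfold vn, sub_e, sh. repeat f_equal; lia.
      * rewrite (ED D3); auto.
        -- unfold th; simpl psi. rewrite expi_0, EPI, !NEG1. ring.
        -- destruct u as [[k l] m], Hu as (? & ? & ?). unfold vn, sub_e, sh. repeat f_equal; lia.
Qed.

Lemma sub_add (p : pt) (i : nat) : sub_e (add_e p i) i = p.
Proof. destruct p as [[k l] m], i as [|[|[|i]]]; simpl; repeat f_equal; lia. Qed.

Lemma add_comm (p : pt) (i j : nat) : add_e (add_e p i) j = add_e (add_e p j) i.
Proof. destruct p as [[k l] m], i as [|[|[|i]]], j as [|[|[|j]]]; reflexivity. Qed.

Lemma zlev_add (p : pt) (i : nat) : zlev (add_e p i) = (zlev p + 1)%Z.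
Proof. destruct p as [[k l] m], i as [|[|[|i]]]; simpl; lia. Qed.

Lemma add_inj (p : pt) (i j : nat) : (1 <= i <= 3)%nat -> (1 <= j <= 3)%nat ->
  add_e p i = add_e p j -> i = j.
Proof.
  intros Hi Hj E. destruct p as [[k l] m], i as [|[|[|[|i]]]], j as [|[|[|[|j]]]]; try lia;
    simpl in E; injection E; intros; lia.
Qed.

Lemma sub_inj (p : pt) (i j : nat) : (1 <= i <= 3)%nat -> (1 <= j <= 3)%nat ->
  sub_e p i = sub_e p j -> i = j.
Proof.
  intros Hi Hj E. destruct p as [[k l] m], i as [|[|[|[|i]]]], j as [|[|[|[|j]]]]; try lia;
    simpl in E; injection E; intros; lia.
Qed.

Lemma inQH_inQp (p : pt) : inQH p -> inQp p /\ (-1 <= zlev p <= 1)%Z.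
Proof. destruct p as [[k l] m]. exact (fun H => H). Qed.

(** An elementary quadrilateral [p, i, j] seen from its edge joining [u] to [cen u a]. *)
Definition seen (p : pt) (i j : nat) (u : pt) (a b : nat) : Prop :=
  ((a = i /\ b = j) \/ (a = j /\ b = i)) /\
  ((u = p /\ zlev p = (-1)%Z) \/ (u = add_e (add_e p i) j /\ zlev p = (-1)%Z)).

(** Opposite corners [p] and [p + e_i + e_j] differ by 2 in level, and [H] has only the levels -1, 0
    and 1. *)
Lemma elem_quad_level (p : pt) (i j : nat) : elem_quad p i j -> zlev p = (-1)%Z.
Proof.
  intros (_ & _ & _ & F). unfold quad_vertices in F. rewrite !Forall_cons_iff in F.
  destruct F as (F1 & _ & F3 & _ & _). apply inQH_inQp in F1, F3.
  rewrite !zlev_add in F3. lia.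
Qed.

Lemma edge_seen (p : pt) (i j : nat) (s t : pt) : elem_quad p i j ->
  In (s, t) (quad_edges (quad_vertices p i j)) ->
  exists u a b, seen p i j u a b /\
    ((s = u /\ t = cen u a) \/ (t = u /\ s = cen u a)).
Proof.
  intros Q HIn. pose proof (elem_quad_level p i j Q) as L.
  set (q := add_e (add_e p i) j).
  assert (Lq : zlev q = 1%Z) by (unfold q; rewrite !zlev_add; lia).
  assert (Cp : forall e, cen p e = add_e p e) by (intros; unfold cen; now rewrite L).
  assert (Cq : cen q j = add_e p i /\ cen q i = add_e p j).
  { unfold cen. rewrite Lq. simpl. unfold q. split; [ apply sub_add | ].
    rewrite add_comm. apply sub_add. }
  destruct Cq as [Cq1 Cq2].
  simpl in HIn. destruct HIn as [E|[E|[E|[E|[]]]]]; injection E; intros <- <-.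
  - exists p, i, j. unfold seen. rewrite Cp. auto 6.
  - exists q, j, i. unfold seen. rewrite Cq1. auto 8.
  - exists q, i, j. unfold seen. rewrite Cq2. auto 8.
  - exists p, j, i. unfold seen. rewrite Cp. auto 8.
Qed.

(** [x'] is the other intersection point of the quadrilateral; it sees the same two centres with the
    directions exchanged. *)
Lemma seen_facts (p : pt) (i j : nat) (u : pt) (a b : nat) : elem_quad p i j -> seen p i j u a b ->
  inQp u /\ (zlev u = 1 \/ zlev u = -1)%Z /\ (1 <= a <= 3)%nat /\ (1 <= b <= 3)%nat /\ a <> b /\
  inQp (cen u a) /\ inQp (cen u b) /\
  (exists x', x' <> u /\ inQp x' /\ (zlev x' = 1 \/ zlev x' = -1)%Z /\
     cen x' b = cen u a /\ cen x' a = cen u b /\ zv z u <> zv z x' /\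
     In (quad_vertices p i j) [[u; cen u a; x'; cen u b]; [x'; cen u a; u; cen u b];
                               [u; cen u b; x'; cen u a]; [x'; cen u b; u; cen u a]]).
Proof.
  intros Q [Hab Hu]. pose proof (elem_quad_level p i j Q) as L.
  destruct Q as (Hi & Hij & Hj & F). unfold quad_vertices in *. rewrite !Forall_cons_iff in F.
  destruct F as (F1 & F2 & F3 & F4 & _).
  apply inQH_inQp in F1, F2, F3, F4. destruct F1 as [F1 _], F2 as [F2 _], F3 as [F3 _], F4 as [F4 _].
  set (q := add_e (add_e p i) j) in *.
  assert (Lq : zlev q = 1%Z) by (unfold q; rewrite !zlev_add; lia).
  assert (Npq : p <> q) by (intros E; rewrite E in L; lia).
  assert (Cp : forall e, cen p e = add_e p e) by (intros; unfold cen; now rewrite L).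
  assert (Cq : cen q j = add_e p i /\ cen q i = add_e p j).
  { unfold cen. rewrite Lq. simpl. unfold q. split; [ apply sub_add | ].
    rewrite add_comm. apply sub_add. }
  destruct Cq as [Cq1 Cq2].
  assert (D : zv z p <> zv z q).
  { destruct Hz as (G1 & G2 & G3 & _). unfold q in *. clear Cp Cq1 Cq2 Lq Npq Hu Hab q.
    destruct p as [[k l] m]. destruct F1 as (K & M & N).
    destruct i as [|[|[|i]]], j as [|[|[|[|j]]]]; try lia; cbn [zv add_e] in *.
    - destruct F3 as (? & ? & ?).
      specialize (G1 (k + 1)%Z l m). rewrite Z.add_simpl_r in G1.
      destruct G1 as [(_ & _ & _ & _ & G & _) _]; try (repeat split; lia); auto.
    - destruct F3 as (? & ? & ?).
      specialize (G3 k l (m + 1)%Z). rewrite Z.add_simpl_r in G3.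
      destruct G3 as [(_ & _ & _ & _ & G & _) _]; try (repeat split; lia); auto.
    - destruct F3 as (? & ? & ?).
      specialize (G2 k l (m + 1)%Z). rewrite Z.add_simpl_r in G2.
      destruct G2 as [(_ & _ & _ & _ & G & _) _]; try (repeat split; lia); auto. }
  destruct Hab as [[-> ->]|[-> ->]]; destruct Hu as [[-> _]|[-> _]]; fold q;
    rewrite ?Cp, ?Cq1, ?Cq2.
  - repeat split; auto; try lia. exists q. rewrite Cq1, Cq2. repeat split; auto. simpl; auto.
  - repeat split; auto; try lia. exists p. rewrite !Cp. repeat split; auto. simpl; auto.
  - repeat split; auto; try lia. exists q. rewrite Cq1, Cq2. repeat split; auto. simpl; auto.
  - repeat split; auto; try lia. exists p. rewrite !Cp. repeat split; auto. simpl; auto.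
Qed.

Lemma seen_unique (p : pt) (i j : nat) (p' : pt) (i' j' : nat) (u : pt) (a b : nat) :
  elem_quad p i j -> elem_quad p' i' j' ->
  seen p i j u a b -> seen p' i' j' u a b -> (p, i, j) = (p', i', j').
Proof.
  intros Q Q' [Hab Hu] [Hab' Hu'].
  pose proof (elem_quad_level _ _ _ Q) as L. pose proof (elem_quad_level _ _ _ Q') as L'.
  destruct Q as (_ & Hij & _), Q' as (_ & Hij' & _).
  assert (i = i' /\ j = j') as [<- <-] by lia.
  assert (SS : forall p, sub_e (sub_e (add_e (add_e p i) j) j) i = p)
    by (intros; now rewrite !sub_add).
  do 2 f_equal. 
  destruct Hu as [[-> _]|[-> _]], Hu' as [[E _]|[E _]]; auto.
  - rewrite E, !zlev_add in L. lia.
  - rewrite <- E, !zlev_add in L'. lia.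
  - rewrite <- (SS p), <- (SS p'). now rewrite E.
Qed.

(** [u] and [x'] lie on both circles, so the image is a kite with its axis through the two
    centres. *)
Lemma quad_in_sector (p : pt) (i j : nat) (u : pt) (a b : nat) (x : C) :
  elem_quad p i j -> seen p i j u a b ->
  poly_interior (map (zv z) (quad_vertices p i j)) x ->
  sector (zv z u) (zv z (cen u a)) (zv z (cen u b)) x.
Proof.
  intros Q S. destruct (seen_facts _ _ _ _ _ _ Q S)
    as (Hu & Lu & Ha & Hb & Nab & Qa & Qb & (x' & Nx & Qx & Lx & Ca & Cb & Dx & HIn)).
  destruct edge_directions as (r & om & ED).
  destruct (ED u Hu Lu) as [Ou Eu]. destruct (ED x' Qx Lx) as [Ox Ex].
  destruct (Eu a Ha Qa) as [Ra Ea]. destruct (Eu b Hb Qb) as [Rb Eb].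
  destruct (Ex b Hb) as [_ Fa]; [ now rewrite Ca | ].
  destruct (Ex a Ha) as [_ Fb]; [ now rewrite Cb | ].
  rewrite Ca in Fa. rewrite Cb in Fb.
  assert (NS : forall c0 o e r0 y, Cmult o (Cconj o) = RtoC 1 ->
    Cminus c0 y = Cmult (Cmult o (expi e)) (RtoC r0) -> nsq (Cminus y c0) = r0 * r0).
  { intros c0 o e r0 y Ho E.
    assert (T : Cmult (Cminus c0 y) (Cconj (Cminus c0 y)) = RtoC (r0 * r0)).
    { rewrite E, !Cconj_mult, Cconj_expi, Cconj_RtoC.
      transitivity (Cmult (Cmult o (Cconj o)) (Cmult (Cmult (expi e) (expi (- e))) (Cmult (RtoC r0) (RtoC r0)))); [ ring | ].
      rewrite Ho, expi_inv_r, RtoC_mult. ring. }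
    apply (f_equal fst) in T. unfold nsq. simpl in *. lra. }
  apply (kite_in_sector (zv z u) (zv z (cen u a)) (zv z x') (zv z (cen u b)) x).
  - rewrite (NS _ _ _ _ _ Ou Ea), (NS _ _ _ _ _ Ox Fa). reflexivity.
  - rewrite (NS _ _ _ _ _ Ou Eb), (NS _ _ _ _ _ Ox Fb). reflexivity.
  - exact Dx.
  - replace (Cminus (zv z u) (zv z (cen u a))) with (Copp (Cminus (zv z (cen u a)) (zv z u))) by ring.
    replace (Cminus (zv z (cen u b)) (zv z (cen u a))) with
      (Cminus (Cminus (zv z (cen u b)) (zv z u)) (Cminus (zv z (cen u a)) (zv z u))) by ring.
    rewrite Ea, Eb. set (ra := r (cen u a)) in *. set (rb := r (cen u b)) in *.
    (* The kite is nondegenerate because no two of the directions [eta] differ by a multiple of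
       [PI]. *)
    replace (snd _) with (- (ra * rb) * sin (eta a - eta b)).
    + assert (sin (eta a - eta b) <> 0).
      { assert (0 < sin (a2 + a3)) by (apply sin_gt_0; lra).
        assert (0 < sin a2) by (apply sin_gt_0; lra).
        assert (0 < sin a3) by (apply sin_gt_0; lra).
        assert (sin (a2 + a3) = sin a2 * cos a3 + cos a2 * sin a3) by apply sin_plus.
        rewrite sin_minus. destruct a as [|[|[|[|a]]]], b as [|[|[|[|b]]]]; try lia; simpl;
          rewrite ?cos_neg, ?sin_neg, ?sin_PI, ?cos_PI; lra. }
      apply Rmult_integral_contrapositive; split; auto.
      apply Ropp_neq_0_compat, Rgt_not_eq, Rmult_lt_0_compat; auto.
    + assert (UN : forall u0 v0, Cmult (Cmult (om u) u0) (Cconj (Cmult (om u) v0)) = Cmult u0 (Cconj v0)).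
      { intros u0 v0. rewrite Cconj_mult.
        transitivity (Cmult (Cmult (om u) (Cconj (om u))) (Cmult u0 (Cconj v0))); [ ring | rewrite Ou; ring ]. }
      transitivity (snd (Cmult (Cmult (om u) (Copp (Cmult (expi (eta a)) (RtoC ra))))
        (Cconj (Cmult (om u) (Cminus (Cmult (expi (eta b)) (RtoC rb)) (Cmult (expi (eta a)) (RtoC ra))))))).
      * rewrite UN. simpl. rewrite sin_minus. ring.
      * f_equal. f_equal; [ ring | f_equal; ring ].
  - cbn [In] in HIn. destruct HIn as [E|[E|[E|[E|[]]]]]; rewrite <- E; simpl; auto.
Qed.

Lemma three_directions (a b b' : nat) :
  (1 <= a <= 3)%nat -> (1 <= b <= 3)%nat -> (1 <= b' <= 3)%nat -> a <> b -> a <> b' -> b <> b' ->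
  (a = 1 /\ b = 2 /\ b' = 3 \/ a = 2 /\ b = 3 /\ b' = 1 \/ a = 3 /\ b = 1 /\ b' = 2 \/
   a = 1 /\ b' = 2 /\ b = 3 \/ a = 2 /\ b' = 3 /\ b = 1 \/ a = 3 /\ b' = 1 /\ b = 2)%nat.
Proof.
  intros. destruct a as [|[|[|[|a]]]], b as [|[|[|[|b]]]], b' as [|[|[|[|b']]]]; try lia; tauto.
Qed.

Theorem adjacent_disjoint (p : pt) (i j : nat) (p' : pt) (i' j' : nat) (x : C) :
  adjacent p i j p' i' j' ->
  poly_interior (map (zv z) (quad_vertices p i j)) x ->
  poly_interior (map (zv z) (quad_vertices p' i' j')) x -> False.
Proof.
  intros (Q & Q' & Nq & s & t & I1 & I2) P1 P2.
  destruct (edge_seen p i j s t Q I1) as (u & a & b & S & E).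
  assert (exists u' a' b', seen p' i' j' u' a' b' /\
    ((s = u' /\ t = cen u' a') \/ (t = u' /\ s = cen u' a'))) as (u' & a' & b' & S' & E').
  { destruct I2 as [I2|I2]; destruct (edge_seen p' i' j' _ _ Q' I2) as (u' & a' & b' & S' & E');
      exists u', a', b'; tauto. }
  destruct (seen_facts _ _ _ _ _ _ Q S) as (Hu & Lu & Ha & Hb & Nab & Qa & Qb & _).
  destruct (seen_facts _ _ _ _ _ _ Q' S') as (Hu' & Lu' & Ha' & Hb' & Nab' & Qa' & Qb' & _).
  assert (L0 : forall u a, (zlev u = 1 \/ zlev u = -1)%Z -> (zlev (cen u a) = 0)%Z).
  { intros [[k l] m] e He. unfold cen. simpl zlev in *.
    destruct (Z.ltb_spec (k + l + m) 0); destruct e as [|[|[|e]]]; simpl; lia. }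
  (* Levels tell the ends of the shared edge apart: centres have level 0, intersection points 1 or
     -1. *)
  assert (u = u' /\ cen u a = cen u' a') as [<- Ec].
  { destruct E as [[-> ->]|[-> ->]], E' as [[E1 E2]|[E1 E2]]; auto.
    - exfalso. pose proof (L0 u a Lu). rewrite E1 in *. lia.
    - exfalso. pose proof (L0 u a Lu). rewrite E1 in *. lia. }
  assert (a = a') as <-.
  { unfold cen in Ec. destruct (zlev u <? 0)%Z; [ apply (add_inj u) | apply (sub_inj u) ]; auto. }
  assert (Nbb : b <> b').
  { intros <-. apply Nq. now apply (seen_unique _ _ _ _ _ _ u a b). }
  pose proof (quad_in_sector _ _ _ _ _ _ x Q S P1) as X1.
  pose proof (quad_in_sector _ _ _ _ _ _ x Q' S' P2) as X2.
  destruct edge_directions as (r & om & ED). destruct (ED u Hu Lu) as [Ou Eu].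
  destruct (Eu a Ha Qa) as [Ra Ea]. destruct (Eu b Hb Qb) as [Rb Eb].
  destruct (Eu b' Hb' Qb') as [Rb' Eb'].
  assert (Oa : Cmult (Cmult (om u) (expi (eta a))) (Cconj (Cmult (om u) (expi (eta a)))) = RtoC 1).
  { rewrite Cconj_mult, Cconj_expi.
    transitivity (Cmult (Cmult (om u) (Cconj (om u))) (Cmult (expi (eta a)) (expi (- eta a)))); [ ring | ].
    rewrite Ou, expi_inv_r. ring. }
  assert (PER : forall y, expi (y + 2 * PI) = expi y).
  { intros y. apply C_ext; simpl; rewrite ?cos_plus, ?sin_plus, cos_2PI, sin_2PI; ring. }
  assert (FIN : forall al al' d d', 0 < al -> 0 < al' -> al + al' < PI ->
    sector (zv z u) (zv z (cen u a)) (zv z (cen u d)) x ->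
    sector (zv z u) (zv z (cen u a)) (zv z (cen u d')) x ->
    expi (eta d) = expi (eta a + (PI - al)) -> expi (eta d') = expi (eta a + - (PI - al')) ->
    0 < r (cen u d) -> 0 < r (cen u d') ->
    Cminus (zv z (cen u d)) (zv z u) = Cmult (Cmult (om u) (expi (eta d))) (RtoC (r (cen u d))) ->
    Cminus (zv z (cen u d')) (zv z u) = Cmult (Cmult (om u) (expi (eta d'))) (RtoC (r (cen u d'))) ->
    False).
  { intros al al' d d' A1 A2 A3 SD SD' G G' RD RD' ED1 ED2.
    apply (sectors_disjoint (zv z u) (zv z (cen u a)) (zv z (cen u d)) (zv z (cen u d')) x
      (Cmult (om u) (expi (eta a))) (r (cen u a)) (r (cen u d)) (r (cen u d')) al al'); auto.
    - rewrite ED1, G, expi_plus. ring.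
    - rewrite ED2, G', expi_plus. ring. }
  pose proof (three_directions a b b' Ha Hb Hb' Nab Nab' Nbb) as CYC.
  (* By the angle sum, consecutive directions differ by [PI - a1], [PI - a2] and [PI - a3] modulo a
     full turn. *)
  assert (H21 : expi (eta 2) = expi (eta 1 + (PI - a1))) by (f_equal; simpl; lra).
  assert (H32 : expi (eta 3) = expi (eta 2 + (PI - a2))) by (f_equal; simpl; lra).
  assert (H13 : expi (eta 1) = expi (eta 3 + (PI - a3))).
  { rewrite <- PER. f_equal; simpl; lra. }
  assert (H12 : expi (eta 1) = expi (eta 2 + - (PI - a1))) by (f_equal; simpl; lra).
  assert (H23 : expi (eta 2) = expi (eta 3 + - (PI - a2))) by (f_equal; simpl; lra).
  assert (H31 : expi (eta 3) = expi (eta 1 + - (PI - a3))).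
  { rewrite <- (PER (eta 1 + _)). f_equal; simpl; lra. }
  clear S S' E E' I1 I2 P1 P2.
  destruct CYC as [C|[C|[C|[C|[C|C]]]]]; destruct C as (-> & -> & ->).
  - apply (FIN a1 a3 2%nat 3%nat); auto; lra.
  - apply (FIN a2 a1 3%nat 1%nat); auto; lra.
  - apply (FIN a3 a2 1%nat 2%nat); auto; lra.
  - apply (FIN a1 a3 2%nat 3%nat); auto; lra.
  - apply (FIN a2 a1 3%nat 1%nat); auto; lra.
  - apply (FIN a3 a2 1%nat 2%nat); auto; lra.
Qed.

End Solution.

Theorem theorem1 (a1 a2 a3 c : R) (z : Z -> Z -> Z -> C) :
  (0 < a1)%R -> (0 < a2)%R -> (0 < a3)%R -> (a1 + a2 + a3 = PI)%R ->
  (0 < c < 2)%R ->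
  is_solution a1 a2 a3 c z ->
  z 1%Z 0%Z 0%Z = RtoC 1 ->
  z 0%Z 1%Z 0%Z = expi (c * (a2 + a3)) ->
  z 0%Z 0%Z (-1)%Z = expi (c * a3) ->
  immersion z.
Proof.
  intros. intros p i j p' i' j' Hadj x [H1' H2'].
  eapply (adjacent_disjoint a1 a2 a3 c z); eauto.
Qed.
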